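(* Assume (A), (B) and (C) (as stated in the context). Then the optimal control problem $$\inf\Big\{\mathcal I[u]=\ell(x^u_T)+\frac{\alpha}{2}\int_I|u(t)|^2\,\mathrm dt\colon u\in\mathcal U\Big\}$$ admits a minimizer in the class $\mathcal U$, i.e. there is $u^*\in\mathcal U$ with $\mathcal I[u^*]=\inf_{u\in\mathcal U}\mathcal I[u]$.
   Context: Setting. $X$ is a real Banach space, $T>0$, $\alpha\ge0$, $I=[0,T]$, $x_0\in X$ is a fixed initial state, $U\subset\mathbb R^m$ is nonempty, compact and convex, and $\mathcal U=L^\infty(I;U)$ is the set of (classes of) measurable functions $I\to\mathbb R^m$ with values in $U$ a.e. The linear operator $A\colon D(A)\subset X\to X$ generates a $C_0$-semigroup $(S_t)_{t\ge0}$ on $X$. Maps $f\colon I\times X\to X$, $G\colon I\times X\to\mathcal L(\mathbb R^m;X)$ and $\ell\colon X\to\mathbb R$ are given. Measurability of Banach-space-valued maps on $I$ is in the strong (Bochner) sense. Assumption (A): for every $\mathrm x\in X$ the maps $t\mapsto f_t(\mathrm x)$ and $t\mapsto G_t(\mathrm x)$ are measurable, and there exist constants $M_f,M_G\ge0$ such that for all $\mathrm x,\mathrm y\in X$ and a.a. $t\in I$: $\|f_t(\mathrm x)-f_t(\mathrm y)\|_X\le M_f\|\mathrm x-\mathrm y\|_X$, $\|G_t(\mathrm x)-G_t(\mathrm y)\|_{\mathcal L(\mathbb R^m;X)}\le M_G\|\mathrm x-\mathrm y\|_X$, $\|f_t(0)\|_X\le M_f$, $\|G_t(0)\|_{\mathcal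 L(\mathbb R^m;X)}\le M_G$. Assumption (B): $\ell\colon X\to\mathbb R$ is lower semicontinuous. Assumption (C): $G_t(\mathrm x)\mathrm u=\sum_{j=1}^m\bigl(\mathrm u^Tg^j_t(\mathrm x)\bigr)h^j$ for $\mathrm u\in\mathbb R^m$, where $h^j\in X$ are fixed and the maps $g^j\colon I\times X\to\mathbb R^m$ satisfy the analogue of (A): $t\mapsto g^j_t(\mathrm x)$ is measurable for every $\mathrm x\in X$, and for some constant $M_g\ge0$, all $\mathrm x,\mathrm y\in X$ and a.a. $t\in I$, $|g^j_t(\mathrm x)-g^j_t(\mathrm y)|\le M_g\|\mathrm x-\mathrm y\|_X$ and $|g^j_t(0)|\le M_g$. State. For $u\in\mathcal U$, $x^u\in C(I;X)$ is the unique mild solution of $\dot x_t=Ax_t+f_t(x_t)+G_t(x_t)u(t)$ with initial state $x_0$, i.e. $x^u_t=S_tx_0+\int_0^tS_{t-\tau}\bigl(f_\tau(x^u_\tau)+G_\tau(x^u_\tau)u(\tau)\bigr)\,\mathrm d\tau$ for all $t\in I$ (existence and uniqueness hold under (A)). *)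

(* Defs.v *)
From HB Require Import structures.
From mathcomp Require Import all_boot all_order all_algebra.
From mathcomp Require Import all_classical all_reals all_analysis.
Set Implicit Arguments.
Unset Strict Implicit.
Unset Printing Implicit Defensive.
Import Order.TTheory GRing.Theory Num.Theory.
Import numFieldNormedType.Exports.
Local Open Scope classical_set_scope.
Local Open Scope ring_scope.

(* R^m is 'rV[R]_m; its library norm is the sup norm, which gives the usual
   topology, while [enorm] is used wherever the value of |.| matters. *)
Definition edot (R : realType) (m : nat) (u v : 'rV[R]_m) : R :=
  \sum_(i < m) u 0 i * v 0 i.

Definition enorm (R : realType) (m : nat) (u : 'rV[R]_m) : R :=
  Num.sqrt (edot u u).

(* L(R^m; X) is {linear 'rV[R]_m -> X}, linear maps on R^m being automatically
   continuous.  The supremum below is taken over a nonempty bounded set when A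
   is linear; the argument is a bare function so that it also applies to
   pointwise differences of linear maps. *)
Definition opnorm (R : realType) (m : nat) (X : normedModType R)
    (A : 'rV[R]_m -> X) : R :=
  sup [set `|A v| | v in [set v | enorm v <= 1]].

Definition opdist (R : realType) (m : nat) (X : normedModType R)
    (A B : {linear 'rV[R]_m -> X}) : R :=
  opnorm (fun v => A v - B v).

Definition normdist (R : realType) (V : normedModType R) (x y : V) : R :=
  `|x - y|.

Definition simple_function (R : realType) (V : Type) (s : R -> V) : Prop :=
  finite_set (range s) /\ forall v, measurable (s @^-1` [set v]).

(* Strong (Bochner) measurability on [a, b]: almost everywhere limit of simple
   functions.  The simple functions are Borel, but since the limit is only
   required almost everywhere this is measurability with respect to the
   Lebesgue sigma-algebra. *)
Definition strongly_measurable (R : realType) (V : Type) (dist : V -> V -> R)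
    (a b : R) (h : R -> V) : Prop :=
  exists s : nat -> R -> V, (forall n, simple_function (s n)) /\
    {ae @lebesgue_measure R, forall t, t \in `[a, b] ->
      (fun n => dist (h t) (s n t)) @ \oo --> (0 : R)}.

Definition simple_integral (R : realType) (V : normedModType R) (a b : R)
    (s : R -> V) : V :=
  \sum_(v \in range s)
    fine (@lebesgue_measure R (`[a, b] `&` s @^-1` [set v])) *: v.

(* "h is Bochner integrable on [a, b] with integral v". *)
Definition is_bochner_integral (R : realType) (V : normedModType R) (a b : R)
    (h : R -> V) (v : V) : Prop :=
  strongly_measurable (@normdist R V) a b h /\
  exists s : nat -> R -> V,
    [/\ forall n, simple_function (s n),
        (fun n => (\int[@lebesgue_measure R]_(t in `[a, b])
                     `|h t - s n t|%:E)%E) @ \oo --> 0%E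
      & (fun n => simple_integral a b (s n)) @ \oo --> v].

(* Only the values S t with 0 <= t matter. *)
Definition C0_semigroup (R : realType) (X : normedModType R)
    (S : R -> {linear X -> X}) : Prop :=
  [/\ forall t, 0 <= t -> continuous (S t),
      forall x, S 0 x = x,
      forall s t x, 0 <= s -> 0 <= t -> S (s + t) x = S s (S t x)
    & forall x, S t x @[t --> 0^'+] --> x].

(* An unbounded operator A : D(A) -> X is a total function whose values outside
   the domain DA are irrelevant. *)
Definition linear_operator (R : realType) (X : normedModType R)
    (DA : set X) (A : X -> X) : Prop :=
  DA 0 /\ forall (c : R) x y, DA x -> DA y ->
    DA (c *: x + y) /\ A (c *: x + y) = c *: A x + A y.

(* The graph of A is the graph of the infinitesimal generator of S. *)
Definition generates (R : realType) (X : normedModType R)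
    (DA : set X) (A : X -> X) (S : R -> {linear X -> X}) : Prop :=
  forall x y, (DA x /\ A x = y) <->
    h^-1 *: (S h x - x) @[h --> 0^'+] --> y.

(* In [assumption_A] and [assumption_C] the exceptional null set of times does
   not depend on the points x, y. *)
Definition assumption_A (R : realType) (X : normedModType R) (m : nat) (T : R)
    (f : R -> X -> X) (G : R -> X -> {linear 'rV[R]_m -> X}) : Prop :=
  [/\ forall x, strongly_measurable (@normdist R X) 0 T (fun t => f t x),
      forall x, strongly_measurable (@opdist R m X) 0 T (fun t => G t x)
    & exists Mf MG : R,
      [/\ 0 <= Mf, 0 <= MG
        & {ae @lebesgue_measure R, forall t, t \in `[0, T] ->
            [/\ forall x y, `|f t x - f t y| <= Mf * `|x - y|,
                forall x y, opdist (G t x) (G t y) <= MG * `|x - y|,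
                `|f t 0| <= Mf
              & opnorm (G t 0) <= MG]}]].

Definition assumption_B (R : realType) (X : normedModType R) (l : X -> R) :
    Prop :=
  lower_semicontinuous (fun x => (l x)%:E).

Definition assumption_C (R : realType) (X : normedModType R) (m : nat) (T : R)
    (G : R -> X -> {linear 'rV[R]_m -> X}) : Prop :=
  exists (h : 'I_m -> X) (g : 'I_m -> R -> X -> 'rV[R]_m),
    [/\ forall t x u, t \in `[0, T] ->
          G t x u = \sum_(j < m) edot u (g j t x) *: h j,
        forall j x,
          strongly_measurable (@normdist R 'rV[R]_m) 0 T (fun t => g j t x)
      & exists2 Mg : R, 0 <= Mg &
          {ae @lebesgue_measure R, forall t, t \in `[0, T] -> forall j,
            (forall x y, enorm (g j t x - g j t y) <= Mg * `|x - y|) /\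
            enorm (g j t 0) <= Mg}].

(* L^oo([0, T]; U), for bounded U, through representatives of the classes. *)
Definition admissible (R : realType) (m : nat) (T : R) (U : set 'rV[R]_m) :
    set (R -> 'rV[R]_m) :=
  [set u | strongly_measurable (@normdist R 'rV[R]_m) 0 T u /\
           {ae @lebesgue_measure R, forall t, t \in `[0, T] -> U (u t)}].

Definition mild_solution (R : realType) (X : normedModType R) (m : nat) (T : R)
    (S : R -> {linear X -> X}) (f : R -> X -> X)
    (G : R -> X -> {linear 'rV[R]_m -> X}) (x0 : X) (u : R -> 'rV[R]_m)
    (x : R -> X) : Prop :=
  {within `[0, T], continuous x} /\
  forall t, t \in `[0, T] ->
    exists2 v, is_bochner_integral 0 t
        (fun tau => S (t - tau) (f tau (x tau) + G tau (x tau) (u tau))) v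
      & x t = S t x0 + v.

(* x^u; its values are determined on [0, T] by uniqueness. *)
Definition state (R : realType) (X : normedModType R) (m : nat) (T : R)
    (S : R -> {linear X -> X}) (f : R -> X -> X)
    (G : R -> X -> {linear 'rV[R]_m -> X}) (x0 : X) (u : R -> 'rV[R]_m) :
    R -> X :=
  xget (fun=> 0) [set x | mild_solution T S f G x0 u x].

Definition cost (R : realType) (X : normedModType R) (m : nat) (T alpha : R)
    (S : R -> {linear X -> X}) (f : R -> X -> X)
    (G : R -> X -> {linear 'rV[R]_m -> X}) (l : X -> R) (x0 : X)
    (u : R -> 'rV[R]_m) : R :=
  l (state T S f G x0 u T) +
  alpha / 2 * \int[@lebesgue_measure R]_(t in `[0, T]) enorm (u t) ^+ 2.

(* Main.v *)
(* The direct method.  Along an ultrafilter F that contains all the sublevel sets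
   of the cost, the admissible controls have a weak limit v in L^2: F plays the
   role of a minimizing sequence.  The limit is obtained without any duality, as
   the strong limit of elements of almost minimal norm in the convex hulls of the
   members of F, which form a Cauchy sequence by the parallelogram identity; since
   these elements are convex combinations of admissible controls, v is admissible
   and its energy does not exceed the limit of the energies.  By (C) the control
   enters the mild formulation through finitely many scalar functions u . g^j(x)
   multiplying the fixed curves S_(t-s) h^j, so weak convergence of the controls
   makes the residual of x^v in the equation of x^u uniformly small, and a Gronwall
   argument gives x^u_T --> x^v_T in norm.  Lower semicontinuity of l concludes. *)
Require Import Defs.
From HB Require Import structures.
From mathcomp Require Import all_boot all_order all_algebra.
From mathcomp Require Import all_classical all_reals all_analysis.
From mathcomp Require Import measurable_realfun ring lra.
Import Order.TTheory GRing.Theory Num.Theory.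
Import numFieldNormedType.Exports.
Local Open Scope classical_set_scope.
Local Open Scope ring_scope.

Set Implicit Arguments.
Unset Strict Implicit.
Unset Printing Implicit Defensive.

(** * Simple functions *)

Section SimpleFunctions.
Variable R : realType.

(** Controls and integrands are Borel measurable only up to null sets, so that the library integral
    of such a function is merely a lower integral, which need not be additive. Hence an integral is
    built from uniformly bounded simple functions converging in measure. It agrees with
    [is_bochner_integral] and, for nonnegative real functions, with the library integral, which is
    all that the equation and the cost require. Convergence in measure also dictates the rates.
    Energies within [dyadic R n ^+ 3 / 64] of the limiting level make consecutive almost minimal
    elements [dyadic R n]-close off a set of measure [dyadic R n]; both are summable, so that the
    limit exists almost everywhere and inherits the constraint from the closed set [U]. Weak
    convergence controls one test function at a time, whereas the residual must be small for all
    times at once. Strong continuity of [S] repairs this: once the kernel is frozen on a grid that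
    does not depend on the time, finitely many truncated test functions decide, and finitely many
    members of the filter can be intersected. *)

Lemma simple_function_preimage (W : Type) (q : R -> W) (A : set W) :
  simple_function q -> measurable (q @^-1` A).
Proof.
move=> [fq mq].
have -> : q @^-1` A = \bigcup_(w in range q `&` A) q @^-1` [set w].
  apply/seteqP; split => t /=; first by move=> At; exists (q t).
  by move=> [w [_ Aw] /= ->].
by apply: fin_bigcup_measurable => //; exact: finite_setIl.
Qed.

Lemma simple_function_comp (W V : Type) (g : W -> V) (q : R -> W) :
  simple_function q -> simple_function (g \o q).
Proof.
move=> sq; split => [|v].
  by have [fq _] := sq; have := finite_image g fq; rewrite image_comp.
exact: (simple_function_preimage (g @^-1` [set v])).
Qed.

Lemma simple_function_pair (V W : Type) (s : R -> V) (q : R -> W) :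
  simple_function s -> simple_function q -> simple_function (fun t => (s t, q t)).
Proof.
move=> ss sq; split => [|[v w]].
  apply: (@sub_finite_set _ _ (range s `*` range q)).
    by move=> _ [t _ <-]; split; exists t.
  by apply: finite_setX; [case: ss|case: sq].
have -> : (fun t => (s t, q t)) @^-1` [set (v, w)] =
    s @^-1` [set v] `&` q @^-1` [set w].
  by apply/seteqP; split => t /= [-> ->].
by apply: measurableI; [case: ss|case: sq].
Qed.

Lemma simple_function_cst (V : Type) (v : V) : simple_function (fun _ : R => v).
Proof.
split => [|w]; first by apply: (sub_finite_set _ (finite_set1 v)) => _ [t _ <-].
have [->|vw] := pselect (v = w).
  by rewrite (_ : _ @^-1` _ = setT)//; apply/seteqP; split.
by rewrite (_ : _ @^-1` _ = set0)//; apply/seteqP; split.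
Qed.

Lemma simple_function_indic (A : set R) : measurable A ->
  simple_function (fun t => `[< A t >]).
Proof.
move=> mA; split; first exact: finite_finset.
case.
  rewrite (_ : _ @^-1` _ = A)//; apply/seteqP; split => t /=.
    by move/asboolP.
  by move/asboolP.
rewrite (_ : _ @^-1` _ = ~` A); first exact: measurableC.
apply/seteqP; split => t /=; first by move/asboolPn.
by move=> ?; apply/asboolPn.
Qed.

End SimpleFunctions.

(** * Integrals of simple functions over sets of finite measure *)

Section SimpleIntegral.
Variable R : realType.
Local Notation mu := (@lebesgue_measure R).

Definition finite_measurable (D : set R) := measurable D /\ (mu D < +oo)%E.

(** [simple_integral a b] is the case of a closed interval; half-open intervals are needed to split
    an integral at a point. *)
Definition simple_integral_on (V : normedModType R) (D : set R) (s : R -> V) : V :=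
  \sum_(v \in range s) fine (mu (D `&` s @^-1` [set v])) *: v.

Lemma finite_measurableI (D E : set R) :
  finite_measurable D -> measurable E -> finite_measurable (D `&` E).
Proof.
move=> [mD fD] mE; split; first exact: measurableI.
by apply: le_lt_trans fD; apply: le_measure; rewrite ?inE//; exact: measurableI.
Qed.

Lemma finite_measurable_fin (D : set R) : finite_measurable D -> mu D \is a fin_num.
Proof. by move=> [mD fD]; rewrite ge0_fin_numE. Qed.

(** Finite additivity over the fibres of [q], by induction on the list. The predicate [P] serves to
    regroup the fibres that a further map sends to the same value. *)
Lemma measure_partition_seq (W : eqType) (q : R -> W) (r : seq W) (P : pred W)
    (D : set R) : finite_measurable D -> (forall w, measurable (q @^-1` [set w])) ->
  uniq r ->
  fine (mu (D `&` [set t | (q t \in r) && P (q t)])) =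
  \sum_(w <- r | P w) fine (mu (D `&` q @^-1` [set w])).
Proof.
move=> fD mq; elim: r => [_|w r ih /= /andP[wr ur]].
  rewrite big_nil (_ : _ `&` _ = set0) ?measure0//.
  by apply/seteqP; split => t //= [].
have mr : measurable (D `&` [set t | (q t \in r) && P (q t)]).
  apply: measurableI; first by case: fD.
  have -> : [set t | (q t \in r) && P (q t)] =
      \bigcup_(w in [set` r] `&` [set w | P w]) q @^-1` [set w].
    apply/seteqP; split => t /=.
      by move=> /andP[? ?]; exists (q t).
    by move=> [v [vr Pv] /= ->]; rewrite vr.
  by apply: fin_bigcup_measurable => //; exact/finite_setIl/finite_seq.
rewrite big_cons -ih//; case: ifPn => Pw; last first.
  congr (fine (mu (_ `&` _))); apply/seteqP; split => t /=.
    by rewrite inE; case: eqP => [->|_] //=; rewrite (negbTE Pw) andbF.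
  by move=> /andP[qr Pq]; rewrite inE qr orbT.
rewrite -fineD; last 2 first.
- by apply/finite_measurable_fin/finite_measurableI.
- rewrite ge0_fin_numE//; case: fD => mD; apply: le_lt_trans.
  by apply: le_measure; rewrite ?inE.
rewrite -measureU//; last 2 first.
- by apply: measurableI; [exact: (proj1 fD)|exact: mq].
- apply/seteqP; split => t //= [[_ ->] [_]].
  by rewrite (negbTE wr).
congr (fine (mu _)); rewrite -setIUr; congr (_ `&` _).
apply/seteqP; split => t /=.
  rewrite inE => /andP[/orP[/eqP ->|qr] Pq]; first by left.
  by right; rewrite qr.
by rewrite inE => -[->|/andP[-> ->]]; rewrite ?eqxx ?Pw// orbT.
Qed.

Lemma measure_partition (W : eqType) (q : R -> W) (r : seq W) (D : set R) :
  finite_measurable D -> (forall w, measurable (q @^-1` [set w])) -> uniq r ->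
  range q `<=` [set` r] ->
  fine (mu D) = \sum_(w <- r) fine (mu (D `&` q @^-1` [set w])).
Proof.
move=> fD mq ur qr; rewrite -(@measure_partition_seq _ _ _ xpredT)//.
congr (fine (mu _)); apply/seteqP; split => t /=; last by case.
by move=> Dt; split => //; rewrite andbT; apply: qr; exists t.
Qed.

(** The sum over the values of [g \o q] is regrouped by the values of [q]; any duplicate-free list
    containing the range will do, since the other fibres are empty. Taking for [q] a pair of simple
    functions puts both over the same fibres: linearity and the distance estimate rest on this. *)
Lemma simple_integral_onE (V : normedModType R) (W : choiceType) (q : R -> W)
    (g : W -> V) (r : seq W) (D : set R) : finite_measurable D ->
  simple_function q -> uniq r -> range q `<=` [set` r] ->
  simple_integral_on D (g \o q) =
  \sum_(w <- r) fine (mu (D `&` q @^-1` [set w])) *: g w.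
Proof.
move=> fD sq ur qr; rewrite /simple_integral_on.
rewrite (fsbig_fwiden (undup (map g r)))//; last 3 first.
- move=> _ [t _ <-] /=; rewrite mem_undup; apply: map_f; apply: qr.
  by exists t.
- exact: undup_uniq.
- move=> v [_ nv] /=; rewrite (_ : _ `&` _ = set0) ?measure0 ?scale0r//.
  by apply/seteqP; split => // t /= [_ gv]; apply: nv; exists t.
have E v : fine (mu (D `&` (g \o q) @^-1` [set v])) =
    \sum_(w <- r | g w == v) fine (mu (D `&` q @^-1` [set w])).
  rewrite -measure_partition_seq//; last by case: sq.
  congr (fine (mu (_ `&` _))); apply/seteqP; split => t /=.
    by move=> ->; rewrite eqxx andbT; apply: qr; exists t.
  by move=> /andP[_ /eqP].
under eq_bigr do rewrite E scaler_suml big_mkcond.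
rewrite exchange_big/= !big_seq; apply: eq_bigr => w wr.
rewrite -big_mkcond/=.
under eq_bigr => v /eqP <- do over.
rewrite -big_filter (_ : [seq _ <- _ | _] = [:: g w]) ?big_seq1//.
rewrite (eq_filter (a2 := pred1 (g w))); last by move=> v /=; rewrite eq_sym.
by rewrite filter_pred1_uniq ?undup_uniq// mem_undup map_f.
Qed.

Lemma simple_function_range (W : choiceType) (q : R -> W) : simple_function q ->
  exists2 r : seq W, uniq r & range q `<=` [set` r].
Proof.
move=> [fq _]; exists (finmap.enum_fset (fset_set (range q))); first exact: finmap.fset_uniq.
by move=> w qw /=; rewrite in_fset_set// inE.
Qed.

End SimpleIntegral.

(** * Integrals of bounded strongly measurable functions *)

Section SimpleIntegralTheory.
Variable R : realType.
Local Notation mu := (@lebesgue_measure R).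
Local Notation len D := (fine (mu D)).

Lemma len_ge0 (D : set R) : 0 <= len D.
Proof. exact: fine_ge0. Qed.

Lemma len_le (D : set R) (e : R) : (mu D <= e%:E)%E -> len D <= e.
Proof.
move=> De; rewrite -lee_fin fineK// ge0_fin_numE//.
by apply: le_lt_trans De _; exact: ltry.
Qed.

Lemma simple_integral_on_lincomb (V : normedModType R) (D : set R) (c : R)
    (s s' : R -> V) : finite_measurable D ->
  simple_function s -> simple_function s' ->
  simple_integral_on D (fun t => c *: s t + s' t) =
  c *: simple_integral_on D s + simple_integral_on D s'.
Proof.
move=> fD ss ss'; have sq := simple_function_pair ss ss'.
have [r ur qr] := simple_function_range sq.
rewrite -[s in RHS]/(fst \o (fun t => (s t, s' t))).
rewrite -[s' in RHS]/(snd \o (fun t => (s t, s' t))).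
rewrite -[X in simple_integral_on D X = _]/((fun w : V * V => c *: w.1 + w.2) \o
  (fun t => (s t, s' t))).
rewrite !(simple_integral_onE _ fD sq ur qr) scaler_sumr -big_split/=.
by apply: eq_bigr => w _; rewrite scalerDr !scalerA mulrC.
Qed.

Lemma simple_integral_on_norm (V : normedModType R) (D : set R) (s : R -> V) :
  finite_measurable D -> simple_function s ->
  `|simple_integral_on D s| <= simple_integral_on D (fun t => `|s t| : R).
Proof.
move=> fD ss; have [r ur sr] := simple_function_range ss.
rewrite -[s in leLHS]/(id \o s).
rewrite (_ : (fun t => `|s t| : R) = (fun v : V => `|v| : R) \o s)//.
rewrite !(simple_integral_onE _ fD ss ur sr); apply: le_trans (ler_norm_sum _ _ _) _.
by apply: ler_sum => v _; rewrite normrZ ger0_norm ?len_ge0.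
Qed.

Lemma simple_integral_on_ge0 (D : set R) (s : R -> R) :
  finite_measurable D -> simple_function s -> (forall t, 0 <= s t) ->
  0 <= simple_integral_on D s.
Proof.
move=> fD ss s0; apply: fsumr_ge0 => _ [t _ <-].
by rewrite mulr_ge0 ?len_ge0 ?s0.
Qed.

Lemma simple_integral_on_cst (V : normedModType R) (D : set R) (v : V) :
  finite_measurable D -> simple_integral_on D (fun=> v) = len D *: v.
Proof.
move=> fD; have sc := simple_function_cst R v.
rewrite -[X in simple_integral_on D X]/(id \o (fun=> v)).
rewrite (simple_integral_onE _ fD sc (r := [:: v]))//; last first.
  by move=> _ [t _ <-] /=; rewrite inE.
rewrite big_seq1; congr (fine (mu _) *: _).
by apply/seteqP; split => t // [].
Qed.

Lemma simple_integral_on_setU (V : normedModType R) (D D' : set R) (s : R -> V) :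
  finite_measurable D -> finite_measurable D' -> D `&` D' = set0 ->
  finite_measurable (D `|` D') -> simple_function s ->
  simple_integral_on (D `|` D') s =
  simple_integral_on D s + simple_integral_on D' s.
Proof.
move=> fD fD' DD' fDD' ss; have [r ur sr] := simple_function_range ss.
rewrite -[s]/(id \o s) !(simple_integral_onE _ _ ss ur sr)//.
rewrite -big_split/=.
apply: eq_bigr => v _; rewrite -scalerDl; congr (_ *: _).
have ms : measurable (s @^-1` [set v]) by exact: (proj2 ss).
rewrite setIUl measureU ?fineD//.
- exact: (finite_measurable_fin (finite_measurableI fD ms)).
- exact: (finite_measurable_fin (finite_measurableI fD' ms)).
- exact: (proj1 (finite_measurableI fD ms)).
- exact: (proj1 (finite_measurableI fD' ms)).
- by rewrite setIACA DD' set0I.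
Qed.

Lemma simple_integral_on_dist (V : normedModType R) (D E : set R) (B B' e d : R)
    (s s' : R -> V) : finite_measurable D ->
  simple_function s -> simple_function s' ->
  (forall t, `|s t| <= B) -> (forall t, `|s' t| <= B') -> 0 <= e ->
  measurable E -> (mu E <= d%:E)%E ->
  (forall t, D t -> ~ E t -> `|s t - s' t| <= e) ->
  `|simple_integral_on D s - simple_integral_on D s'| <=
    e * len D + (B + B') * d.
Proof.
move=> fD ss ss' sB sB' e0 mE Ed sse; set q := fun t => (s t, s' t).
have sq : simple_function q := simple_function_pair ss ss'.
have [r ur qr] := simple_function_range sq.
have mq w : measurable (q @^-1` [set w]) by exact: (proj2 sq).
have fDE : finite_measurable (D `&` E) by exact: finite_measurableI.
rewrite -[s in X in X - _]/(fst \o q) -[s' in X in _ - X]/(snd \o q).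
rewrite !(simple_integral_onE _ fD sq ur qr) -sumrB.
apply: le_trans (ler_norm_sum _ _ _) _.
have BB0 : 0 <= B + B' by rewrite addr_ge0// (le_trans _ (sB 0), le_trans _ (sB' 0)).
apply: (@le_trans _ _ (\sum_(w <- r) (e * len (D `&` q @^-1` [set w]) +
    (B + B') * len (D `&` E `&` q @^-1` [set w])))); last first.
  rewrite big_split/= -!mulr_sumr -!(measure_partition _ mq ur qr)//.
  rewrite lerD2l ler_wpM2l//; apply: len_le; apply: le_trans Ed.
  apply: le_measure; [by rewrite inE; exact: (proj1 fDE)|by rewrite inE|by move=> t []].
apply: ler_sum => w _; rewrite -scalerBr normrZ ger0_norm ?len_ge0//.
(* On a joint fibre either the two values differ by at most [e], or the part of the fibre in [D]
   lies inside [E], where only the bound [B + B'] is available. *)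
have [we|we] := leP `|w.1 - w.2| e.
  rewrite -[leLHS]addr0 lerD//; first by rewrite mulrC ler_wpM2r ?len_ge0.
  by rewrite mulr_ge0 ?len_ge0.
rewrite -[leLHS]add0r lerD ?mulr_ge0 ?len_ge0//.
have DqE : D `&` q @^-1` [set w] = D `&` E `&` q @^-1` [set w].
  apply/seteqP; split => t /= [Dt qt]; last by split => //; case: Dt.
  split => //; split => //; apply: contrapT => nE.
  by move: we; rewrite -qt/= ltNge sse.
have [->|/set0P[t [Dt qt]]] := eqVneq (D `&` q @^-1` [set w]) set0.
  by rewrite measure0/= mul0r mulr_ge0 ?len_ge0.
rewrite mulrC -DqE ler_wpM2r ?len_ge0// -qt /=.
by apply: le_trans (ler_normB _ _) _; rewrite lerD.
Qed.

End SimpleIntegralTheory.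

(** * Approximation in measure and the integral it defines *)

Section BoundedIntegral.
Variable R : realType.
Local Notation mu := (@lebesgue_measure R).
Local Notation len D := (fine (mu D)).

(* Everything below is expressed through uniformly bounded simple functions that
   are close to [h] off a set of small measure: [h] itself is only measurable up
   to null sets, and no Lebesgue integral of [h] is needed. *)
Definition simple_approx (V : normedModType R) (D : set R) (B e : R)
    (h s : R -> V) : Prop :=
  [/\ simple_function s, forall t, `|s t| <= B & exists E : set R,
     [/\ measurable E, (mu E <= e%:E)%E &
         forall t, D t -> ~ E t -> `|h t - s t| <= e]].

(** Measurability and the bound come together: the approximants converge in measure, [e] controlling
    both the error and the exceptional set, and all of them obey the bound [B]. *)
Definition bounded_by (V : normedModType R) (D : set R) (B : R) (h : R -> V) :=
  forall e : R, 0 < e -> exists s, simple_approx D B e h s.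

Definition bounded_measurable (V : normedModType R) (D : set R) (h : R -> V) :=
  exists B : R, bounded_by D B h.

Definition has_integral (V : normedModType R) (D : set R) (h : R -> V) (v : V) :=
  exists B : R, forall e : R, 0 < e -> exists2 s : R -> V,
    simple_approx D B e h s & `|simple_integral_on D s - v| <= e.

(* The value is [0] when there is no integral. *)
Definition integral_on (V : normedModType R) (D : set R) (h : R -> V) : V :=
  xget 0 [set v | has_integral D h v].

Lemma simple_approx_ge0 (V : normedModType R) (D : set R) (B e : R)
    (h s : R -> V) : simple_approx D B e h s -> 0 <= B /\ 0 <= e.
Proof.
move=> [_ sB [E [mE Ee _]]]; split; first exact: le_trans (sB 0).
by rewrite -lee_fin (le_trans _ Ee).
Qed.

Lemma simple_approx_dist (V : normedModType R) (D : set R) (B B' e e' : R)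
    (h s s' : R -> V) : finite_measurable D ->
  simple_approx D B e h s -> simple_approx D B' e' h s' ->
  `|simple_integral_on D s - simple_integral_on D s'| <=
    (e + e') * (len D + B + B').
Proof.
move=> fD a a'.
have [B0 e0] := simple_approx_ge0 a; have [B'0 e'0] := simple_approx_ge0 a'.
move: a a' => [ss sB [E [mE Ee hs]]] [ss' sB' [E' [mE' Ee' hs']]].
have -> : (e + e') * (len D + B + B') = (e + e') * len D + (B + B') * (e + e').
  by ring.
apply: (@simple_integral_on_dist _ _ _ (E `|` E')) => //.
- exact: addr_ge0.
- exact: measurableU.
- have EE' : (mu (E `|` E') <= mu E + mu E')%E by exact: measureU2.
  by apply: (le_trans EE'); rewrite EFinD leeD.
move=> t Dt /not_orP[nE nE'].
rewrite -[s t - s' t](subrKA (h t)) (le_trans (ler_normD _ _))// lerD//.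
  by rewrite distrC hs.
exact: hs'.
Qed.

(** Estimates below carry an error [e * C] with [C] independent of [e], which this removes.
    Restricting to [e <= 1] lets bounds such as [B + e] be replaced by [B + 1]. *)
Lemma ler_eps (x y C : R) :
  (forall e : R, 0 < e -> e <= 1 -> x <= y + e * C) -> x <= y.
Proof.
move=> H; apply/ler_addgt0Pr => e e0.
have C1 : 0 < `|C| + 1 by rewrite ltr_wpDl.
pose d := Num.min 1 (e / (`|C| + 1)).
have d0 : 0 < d by rewrite /d lt_min ltr01 divr_gt0.
have d1 : d <= 1 by rewrite /d ge_min lexx.
apply: le_trans (H d d0 d1) _; rewrite lerD2l.
apply: (@le_trans _ _ (d * (`|C| + 1))).
  by rewrite ler_pM2l// (le_trans (ler_norm _))// lerDl.
by rewrite -ler_pdivlMr// /d ge_min lexx orbT.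
Qed.

Lemma norm_eps0 (V : normedModType R) (x y : V) (C : R) :
  (forall e : R, 0 < e -> e <= 1 -> `|x - y| <= e * C) -> x = y.
Proof.
move=> H; apply/eqP; rewrite -subr_eq0 -normr_le0; apply: (@ler_eps _ _ C).
by move=> e e0 e1; rewrite add0r H.
Qed.

Lemma has_integral_approx (V : normedModType R) (D : set R) (B e B' : R)
    (h s : R -> V) (v : V) : finite_measurable D ->
  (forall e : R, 0 < e -> exists2 s : R -> V,
    simple_approx D B e h s & `|simple_integral_on D s - v| <= e) ->
  simple_approx D B' e h s ->
  `|simple_integral_on D s - v| <= e * (len D + B + B').
Proof.
move=> fD H a; apply: (@ler_eps _ _ (len D + B + B' + 1)) => d d0 _.
have [s' a' s'v] := H d d0; have := simple_approx_dist fD a' a.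
rewrite distrC => ss'.
rewrite -[X in X <= _](_ : `|(simple_integral_on D s - simple_integral_on D s') +
  (simple_integral_on D s' - v)| = _); last by rewrite subrKA.
apply: le_trans (ler_normD _ _) _.
by rewrite [leRHS](_ : _ = (d + e) * (len D + B + B') + d) ?lerD//; ring.
Qed.

Lemma has_integral_uniq (V : normedModType R) (D : set R) (h : R -> V) (v w : V) :
  finite_measurable D -> has_integral D h v -> has_integral D h w -> v = w.
Proof.
move=> fD [B Hv] [B' Hw]; apply: (@norm_eps0 _ _ _ (len D + B + B' + 1)) => e e0 _.
have [s a sw] := Hw e e0; have sv := has_integral_approx fD Hv a.
rewrite -(subrKA (simple_integral_on D s)) (le_trans (ler_normD _ _))//.
by rewrite mulrDr mulr1 lerD// distrC.
Qed.

(** The integrals of approximants with a common bound form a Cauchy sequence by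
    [simple_approx_dist]. The conclusion keeps the bound [B], which [has_integral] would hide and
    which the explicit error estimates need. *)
Lemma has_integral_exists (X : completeNormedModType R) (D : set R) (B : R)
    (h : R -> X) : finite_measurable D -> bounded_by D B h ->
  exists v, forall e : R, 0 < e -> exists2 s : R -> X,
    simple_approx D B e h s & `|simple_integral_on D s - v| <= e.
Proof.
move=> fD bh.
have /choice[s sP] (n : nat) : exists s, simple_approx D B n.+1%:R^-1 h s.
  by apply: bh; rewrite invr_gt0.
have C0 : 0 <= len D + B + B.
  have [B0 _] := simple_approx_ge0 (sP 0%N).
  by rewrite !addr_ge0 ?len_ge0.
have cs : cvgn (fun n => simple_integral_on D (s n)).
  apply/cauchy_cvgP/cauchy_ballP => e e0; rewrite !near_simpl.
  have d0 : 0 < e / (2 * (len D + B + B + 1)).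
    by rewrite divr_gt0// mulr_gt0// ltr_wpDl.
  near=> n m; rewrite -ball_normE/=.
  apply: le_lt_trans (simple_approx_dist fD (sP _) (sP _)) _.
  have n1 : n.+1%:R^-1 < e / (2 * (len D + B + B + 1)).
    by near: n; exact: (near_infty_natSinv_lt (PosNum d0)).
  have m1 : m.+1%:R^-1 < e / (2 * (len D + B + B + 1)).
    by near: m; exact: (near_infty_natSinv_lt (PosNum d0)).
  apply: (@le_lt_trans _ _ ((n.+1%:R^-1 + m.+1%:R^-1) * (len D + B + B + 1))).
    by rewrite ler_wpM2l ?lerDl// addr_ge0// invr_ge0.
  rewrite -ltr_pdivlMr ?ltr_wpDl//.
  rewrite (_ : e / _ = e / (2 * (len D + B + B + 1)) + e / (2 * (len D + B + B + 1))).
    exact: ltrD.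
  by field; rewrite gt_eqF// ltr_wpDl.
exists (limn (fun n => simple_integral_on D (s n))) => e e0.
move/cvgrPdist_le : cs => /(_ e e0) cs.
have [N _ HN] := near_infty_natSinv_lt (PosNum e0).
have [M _ HM] := cs.
exists (s (maxn N M)); last by rewrite distrC; apply: HM; exact: leq_maxr.
have [ss sB [E [mE Ee hs]]] := sP (maxn N M).
have le : (maxn N M).+1%:R^-1 <= e by apply/ltW/HN/leq_maxl.
split => //; exists E; split => //; first by rewrite (le_trans Ee)// lee_fin.
by move=> t Dt nE; rewrite (le_trans (hs t Dt nE)).
Unshelve. all: by end_near. Qed.

Lemma integral_on_eq (V : normedModType R) (D : set R) (h : R -> V) (v : V) :
  finite_measurable D -> has_integral D h v -> integral_on D h = v.
Proof.
move=> fD hv; rewrite /integral_on; case: xgetP => [w _ hw|/(_ v)//].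
exact: has_integral_uniq hw hv.
Qed.

Lemma integral_on_approx (X : completeNormedModType R) (D : set R) (B B' e : R)
    (h s : R -> X) : finite_measurable D -> bounded_by D B h ->
  simple_approx D B' e h s ->
  `|simple_integral_on D s - integral_on D h| <= e * (len D + B + B').
Proof.
move=> fD bh a; have [v hv] := has_integral_exists fD bh.
have hv' : has_integral D h v by exists B.
by rewrite (integral_on_eq fD hv'); exact: has_integral_approx hv a.
Qed.

End BoundedIntegral.

(** * Stability of bounded measurability, and superposition *)

Section BoundedIntegralTheory.
Variable R : realType.
Local Notation mu := (@lebesgue_measure R).

(** The null set is explicit and measurable, so that it can be joined to the exceptional sets of
    [simple_approx]. *)
Definition ae_on (D : set R) (P : R -> Prop) : Prop :=
  exists N, [/\ measurable N, mu N = 0%E & forall t, D t -> ~ N t -> P t].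

Lemma ae_onT (D : set R) (P : R -> Prop) : (forall t, D t -> P t) -> ae_on D P.
Proof. by move=> DP; exists set0; rewrite measure0; split => // t /DP. Qed.

Lemma ae_onW (D D' : set R) (P Q : R -> Prop) : D' `<=` D ->
  (forall t, D' t -> P t -> Q t) -> ae_on D P -> ae_on D' Q.
Proof.
move=> D'D PQ [N [mN N0 NP]]; exists N; split => // t Dt nN.
by apply: PQ => //; apply: NP => //; exact: D'D.
Qed.

Lemma measureU2_le (A B : set R) (a b : R) : measurable A -> measurable B ->
  (mu A <= a%:E)%E -> (mu B <= b%:E)%E -> (mu (A `|` B) <= (a + b)%:E)%E.
Proof.
move=> mA mB Aa Bb.
have AB : (mu (A `|` B) <= mu A + mu B)%E by exact: measureU2.
by apply: (le_trans AB); rewrite EFinD leeD.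
Qed.

Lemma ae_on2 (D : set R) (P Q : R -> Prop) :
  ae_on D P -> ae_on D Q -> ae_on D (fun t => P t /\ Q t).
Proof.
move=> [N [mN N0 NP]] [N' [mN' N'0 NQ]]; exists (N `|` N'); split.
- exact: measurableU.
- apply/eqP; rewrite eq_le measure_ge0 andbT -(addr0 0).
  by apply: measureU2_le; rewrite ?N0 ?N'0.
- by move=> t Dt /not_orP[? ?]; split; [exact: NP|exact: NQ].
Qed.

Lemma ae_on_itv (i : interval R) (P : R -> Prop) :
  {ae mu, forall t, t \in i -> P t} -> ae_on [set` i] P.
Proof.
move=> [N [mN N0 NP]]; exists N; split => // t it nN.
by apply: contrapT => nP; apply: nN; apply: NP => /= /(_ it).
Qed.

Lemma ae_on_ae (i : interval R) (P : R -> Prop) :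
  ae_on [set` i] P -> {ae mu, forall t, t \in i -> P t}.
Proof.
move=> [N [mN N0 NP]]; exists N; split => // t /= nP.
by apply: contrapT => nN; apply: nP => it; exact: NP.
Qed.

Lemma simple_approxW (V : normedModType R) (D D' : set R) (B B' e e' : R)
    (h s : R -> V) : D' `<=` D -> B <= B' -> e <= e' ->
  simple_approx D B e h s -> simple_approx D' B' e' h s.
Proof.
move=> D'D BB' ee' [ss sB [E [mE Ee hs]]]; split => //.
  by move=> t; rewrite (le_trans (sB t)).
exists E; split => //; first by rewrite (le_trans Ee)// lee_fin.
by move=> t Dt nE; rewrite (le_trans (hs t _ nE))//; exact: D'D.
Qed.

Lemma bounded_byW (V : normedModType R) (D D' : set R) (B B' : R) (h : R -> V) :
  D' `<=` D -> B <= B' -> bounded_by D B h -> bounded_by D' B' h.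
Proof.
by move=> D'D BB' bh e /bh[s a]; exists s; exact: simple_approxW a.
Qed.

Lemma bounded_measurableW (V : normedModType R) (D D' : set R) (h : R -> V) :
  D' `<=` D -> bounded_measurable D h -> bounded_measurable D' h.
Proof. by move=> D'D [B bh]; exists B; exact: bounded_byW bh. Qed.

Lemma bounded_by_scaled (V : normedModType R) (D : set R) (B K : R) (h : R -> V) :
  (forall e, 0 < e -> e <= 1 -> exists s, simple_approx D B (K * e) h s) ->
  bounded_by D B h.
Proof.
move=> H e e0; have K1 : 0 < `|K| + 1 by rewrite ltr_wpDl.
pose d := Num.min 1 (e / (`|K| + 1)).
have d0 : 0 < d by rewrite /d lt_min ltr01 divr_gt0.
have d1 : d <= 1 by rewrite /d ge_min lexx.
have [s a] := H d d0 d1; exists s; apply: simple_approxW a => //.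
apply: (@le_trans _ _ ((`|K| + 1) * d)).
  by rewrite ler_wpM2r ?(ltW d0)// (le_trans (ler_norm _))// lerDl.
by rewrite mulrC -ler_pdivlMr// /d ge_min lexx orbT.
Qed.

Lemma bounded_by_ge0 (V : normedModType R) (D : set R) (B : R) (h : R -> V) :
  bounded_by D B h -> 0 <= B.
Proof. by move=> /(_ 1 ltr01)[s /simple_approx_ge0[]]. Qed.

Lemma bounded_by_simple (V : normedModType R) (D : set R) (B : R) (s : R -> V) :
  simple_function s -> (forall t, `|s t| <= B) -> bounded_by D B s.
Proof.
move=> ss sB e e0; exists s; split => //; exists set0.
rewrite measure0 lee_fin (ltW e0); split => // t _ _.
by rewrite subrr normr0 ltW.
Qed.

Lemma bounded_by_cst (V : normedModType R) (D : set R) (v : V) :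
  bounded_by D `|v| (fun=> v).
Proof. by apply: bounded_by_simple => //; exact: simple_function_cst. Qed.

Lemma bounded_by_limit (V : normedModType R) (D : set R) (B : R) (h : R -> V) :
  (forall e, 0 < e -> exists h' E, [/\ bounded_by D B h', measurable E,
     (mu E <= e%:E)%E & forall t, D t -> ~ E t -> `|h t - h' t| <= e]) ->
  bounded_by D B h.
Proof.
move=> H; apply: (@bounded_by_scaled _ _ _ 2) => e e0 _.
have [h' [E [bh' mE Ee hh']]] := H e e0.
have [s [ss sB [E' [mE' E'e hs]]]] := bh' e e0.
exists s; split => //; exists (E `|` E'); split; first exact: measurableU.
  by rewrite (_ : 2 * e = e + e) ?measureU2_le//; ring.
move=> t Dt /not_orP[nE nE'].
rewrite -(subrKA (h' t)) (_ : 2 * e = e + e); last by ring.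
by rewrite (le_trans (ler_normD _ _))// lerD ?hh' ?hs.
Qed.

Lemma bounded_by_ae_eq (V : normedModType R) (D : set R) (B : R) (h h' : R -> V) :
  ae_on D (fun t => h t = h' t) -> bounded_by D B h -> bounded_by D B h'.
Proof.
move=> [N [mN N0 hh']] bh; apply: bounded_by_limit => e e0.
exists h, N; rewrite N0 lee_fin (ltW e0); split => // t Dt nN.
by rewrite hh'// subrr normr0 ltW.
Qed.

(** Approximants without a bound are set to zero where they exceed [B + 1]. For [e <= 1] this
    changes nothing where [h] is bounded by [B] and the approximant is [e]-close; hence the [B + 1]
    that recurs below. *)
Lemma bounded_by_clip (V : normedModType R) (D : set R) (B : R) (h : R -> V) :
  0 <= B ->
  (forall e, 0 < e -> exists s, simple_function s /\ exists E, [/\ measurable E,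
     (mu E <= e%:E)%E & forall t, D t -> ~ E t -> `|h t - s t| <= e]) ->
  ae_on D (fun t => `|h t| <= B) -> bounded_by D (B + 1) h.
Proof.
move=> B0 H [N [mN N0 hB]]; apply: (@bounded_by_scaled _ _ _ 1) => e e0 e1.
rewrite mul1r.
have [s [ss [E [mE Ee hs]]]] := H e e0.
exists ((fun v => if `|v| <= B + 1 then v else 0) \o s); split.
- exact: simple_function_comp.
- by move=> t /=; case: ifPn => // _; rewrite normr0 addr_ge0.
exists (E `|` N); split; first exact: measurableU.
  by rewrite -(addr0 e) measureU2_le// N0.
move=> t Dt /not_orP[nE nN] /=; rewrite ifT ?hs//.
rewrite -[s t](subrK (h t)) (le_trans (ler_normD _ _))// addrC lerD ?hB//.
by rewrite distrC (le_trans _ e1)// hs.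
Qed.

Lemma bounded_by_improve (V : normedModType R) (D : set R) (B : R) (h : R -> V) :
  0 <= B -> bounded_measurable D h ->
  ae_on D (fun t => `|h t| <= B) -> bounded_by D (B + 1) h.
Proof.
move=> B0 [C bh]; apply: bounded_by_clip => // e /bh[s [ss _ [E Eh]]].
by exists s; split => //; exists E.
Qed.

Lemma bounded_by_lipschitz (V W : normedModType R) (D : set R) (B L : R)
    (g : V -> W) (h : R -> V) : 0 <= L ->
  (forall x y, `|g x - g y| <= L * `|x - y|) ->
  bounded_by D B h -> bounded_by D (`|g 0| + L * B) (g \o h).
Proof.
move=> L0 gL bh; apply: (@bounded_by_scaled _ _ _ (L + 1)) => e e0 _.
have [s [ss sB [E [mE Ee hs]]]] := bh e e0; exists (g \o s); split.
- exact: simple_function_comp.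
- move=> t /=; rewrite -[g (s t)](subrK (g 0)) (le_trans (ler_normD _ _))//.
  rewrite addrC lerD2l (le_trans (gL _ _))// subr0 ler_wpM2l//.
exists E; split => //.
  by rewrite (le_trans Ee)// lee_fin mulrDl mul1r lerDr mulr_ge0// ltW.
move=> t Dt nE /=; rewrite (le_trans (gL _ _))// mulrDl mul1r.
by rewrite ler_wpDr ?(ltW e0)// ler_wpM2l// hs.
Qed.

Lemma bounded_by_bilinear (V W X : normedModType R) (D : set R) (B C L : R)
    (b : V -> W -> X) (h : R -> V) (k : R -> W) : 0 <= L ->
  (forall x y, `|b x y| <= L * (`|x| * `|y|)) ->
  (forall x x' y y', `|b x y - b x' y'| <= L * (`|x - x'| * `|y| + `|x'| * `|y - y'|)) ->
  bounded_by D B h -> bounded_by D C k ->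
  bounded_by D (L * (B * C)) (fun t => b (h t) (k t)).
Proof.
move=> L0 bL bL' bh bk.
have B0 := bounded_by_ge0 bh; have C0 := bounded_by_ge0 bk.
apply: (@bounded_by_scaled _ _ _ (L * (C + 1 + B) + 2)) => e e0 e1.
have [s [ss sB [E [mE Ee hs]]]] := bh e e0.
have [r [sr rC [F [mF Fe kr]]]] := bk e e0.
exists ((fun w : V * W => b w.1 w.2) \o (fun t => (s t, r t))); split.
- exact/simple_function_comp/simple_function_pair.
- by move=> t /=; rewrite (le_trans (bL _ _))// ler_wpM2l// ler_pM.
exists (E `|` F); split; first exact: measurableU.
  apply: le_trans (measureU2_le mE mF Ee Fe) _; rewrite lee_fin.
  rewrite (_ : e + e = 2 * e); last by ring.
  by rewrite ler_wpM2r ?(ltW e0)// lerDr mulr_ge0// !addr_ge0.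
move=> t Dt /not_orP[nE nF] /=; rewrite (le_trans (bL' _ _ _ _))//.
have kC : `|k t| <= C + 1.
  rewrite -[k t](subrK (r t)) (le_trans (ler_normD _ _))// addrC lerD//.
  by rewrite (le_trans _ e1)// kr.
apply: (@le_trans _ _ (L * (e * (C + 1) + B * e))).
  by rewrite ler_wpM2l// lerD// ler_pM// ?hs ?kr.
by have -> : L * (e * (C + 1) + B * e) = L * (C + 1 + B) * e; [ring|
  rewrite ler_wpM2r ?(ltW e0)// lerDl].
Qed.

Lemma measure_seq_union (I : eqType) (r : seq I) (d : R) (E : I -> set R) :
  (forall i, i \in r -> measurable (E i) /\ (mu (E i) <= d%:E)%E) ->
  exists F, [/\ measurable F, (mu F <= ((size r)%:R * d)%:E)%E &
    forall t, ~ F t -> forall i, i \in r -> ~ E i t].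
Proof.
elim: r => [_|i r ih H]; first by exists set0; rewrite measure0 mul0r.
have [F [mF Fd FE]] : exists F, [/\ measurable F, (mu F <= ((size r)%:R * d)%:E)%E &
    forall t, ~ F t -> forall i, i \in r -> ~ E i t].
  by apply: ih => j jr; apply: H; rewrite inE jr orbT.
have [mi id] := H i (mem_head _ _).
exists (E i `|` F); split; first exact: measurableU.
  rewrite /= -natr1 mulrDl mul1r addrC; exact: measureU2_le.
move=> t /not_orP[nE nF] j; rewrite inE => /orP[/eqP -> //|]; exact: FE.
Qed.

(** Superposition of a Caratheodory function. A simple approximant of [h] takes finitely many values
    [y]; each [psi^~ y] is replaced by a simple function on the corresponding fibre, and the
    Lipschitz condition absorbs the error made on [h]. *)
Lemma bounded_by_caratheodory (V W : normedModType R) (D : set R) (B C L : R)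
    (psi : R -> V -> W) (h : R -> V) : 0 <= L ->
  (forall y, `|y| <= B -> bounded_by D C (psi^~ y)) ->
  ae_on D (fun t => forall x y, `|psi t x - psi t y| <= L * `|x - y|) ->
  bounded_by D B h -> bounded_by D C (fun t => psi t (h t)).
Proof.
move=> L0 bpsi [N [mN N0 psiL]] bh.
apply: (@bounded_by_scaled _ _ _ (L + 2)) => e e0 e1.
have [s [ss sB [E [mE Ee hs]]]] := bh e e0.
have [r ur sr] := simple_function_range ss.
(* One share for each value, so that the exceptional sets of all the [psi^~ y] together have measure
   at most [e]. *)
pose d := e / (size r).+1%:R.
have d0 : 0 < d by rewrite divr_gt0.
have /choice[sg sgP] (y : V) : exists sg : R -> W,
    `|y| <= B -> simple_approx D C d (psi^~ y) sg.
  have [yB|yB] := pselect (`|y| <= B); last by exists (fun=> 0).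
  by have [sg ?] := bpsi y yB d d0; exists sg.
have /choice[Ey EyP] (y : V) : exists Ey : set R, `|y| <= B ->
    [/\ measurable Ey, (mu Ey <= d%:E)%E &
      forall t, D t -> ~ Ey t -> `|psi t y - sg y t| <= d].
  have [yB|yB] := pselect (`|y| <= B); last by exists set0.
  by have [_ _ [Ey ?]] := sgP y yB; exists Ey.
pose r' := [seq y <- r | `|y| <= B].
have r'B y : y \in r' -> `|y| <= B by rewrite mem_filter => /andP[].
have sr' t : s t \in r' by rewrite mem_filter sB/=; apply: sr; exists t.
have [F [mF Fd FE]] := @measure_seq_union _ r' d Ey
  (fun y yr => let: And3 a b _ := EyP y (r'B y yr) in conj a b).
exists (fun t => sg (s t) t); split.
- split.
    apply: (@sub_finite_set _ _ (\bigcup_(y in [set` r']) range (sg y))).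
      by move=> _ [t _ <-]; exists (s t); [exact: sr'|exists t].
    apply: bigcup_finite; first exact: finite_seq.
    by move=> y /r'B yB; have [[fg _] _ _] := sgP y yB.
  move=> w.
  rewrite (_ : _ @^-1` _ = \bigcup_(y in [set` r'])
      (s @^-1` [set y] `&` sg y @^-1` [set w])); last first.
    apply/seteqP; split => t /=; first by move=> sw; exists (s t) => //; exact: sr'.
    by move=> [y _ /= [-> ->]].
  apply: fin_bigcup_measurable; first exact: finite_seq.
  move=> y /r'B yB; have [[_ mg] _ _] := sgP y yB.
  by apply: measurableI; [exact: (proj2 ss)|exact: mg].
- by move=> t; have [_ + _] := sgP (s t) (sB t); exact.
exists ((E `|` F) `|` N); split.
- by apply: measurableU => //; exact: measurableU.
- rewrite (_ : (L + 2) * e = (e + e) + L * e); last by ring.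
  apply: measureU2_le => //; [exact: measurableU| |]; last first.
    by rewrite N0 lee_fin mulr_ge0// ltW.
  apply: measureU2_le => //; apply: (le_trans Fd); rewrite lee_fin /d mulrCA.
  rewrite ler_piMr ?(ltW e0)// ler_pdivrMr// mul1r ler_nat size_filter.
  by rewrite (leq_trans (count_size _ _)).
move=> t Dt /not_orP[/not_orP[nE nF] nN].
rewrite -(subrKA (psi t (s t))) (le_trans (ler_normD _ _))//.
rewrite (_ : (L + 2) * e = L * e + 2 * e); last by ring.
rewrite lerD//; first by rewrite (le_trans (psiL t Dt nN _ _))// ler_wpM2l// hs.
have [_ _ H] := EyP (s t) (sB t).
rewrite (le_trans (H t Dt (FE t nF _ (sr' t))))// /d ler_pdivrMr//.
rewrite mulrAC ler_peMl ?(ltW e0)//.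
by rewrite -natrM ler1n.
Qed.

End BoundedIntegralTheory.

(** * Linearity, additivity and monotonicity of the integral *)

Section IntegralTheory.
Variable R : realType.
Local Notation mu := (@lebesgue_measure R).
Local Notation len D := (fine (mu D)).

Section Vector.
Variables (X : completeNormedModType R) (D : set R).
Hypothesis fD : finite_measurable D.
Implicit Types h k : R -> X.

Lemma simple_approx_lincomb (V : normedModType R) (D' : set R) (c B C e : R)
    (h s k r : R -> V) : simple_approx D' B e h s -> simple_approx D' C e k r ->
  simple_approx D' (`|c| * B + C) ((`|c| + 2) * e)
    (fun t => c *: h t + k t) (fun t => c *: s t + r t).
Proof.
move=> a b; have [_ e0] := simple_approx_ge0 a.
move: a b => [ss sB [E [mE Ee hs]]] [sr rC [F [mF Fe kr]]]; split.
- apply: (@simple_function_comp _ _ _ (fun w : V * V => c *: w.1 + w.2)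
    (fun t => (s t, r t))); exact: simple_function_pair.
- by move=> t; rewrite (le_trans (ler_normD _ _))// lerD// normrZ ler_wpM2l.
exists (E `|` F); split; first exact: measurableU.
  apply: le_trans (measureU2_le mE mF Ee Fe) _; rewrite lee_fin.
  rewrite (_ : e + e = 2 * e); last by ring.
  by rewrite ler_wpM2r// lerDr.
move=> t Dt /not_orP[nE nF].
rewrite opprD addrACA -scalerBr (le_trans (ler_normD _ _))// normrZ.
rewrite mulrDl lerD//; first by rewrite ler_wpM2l// hs.
by rewrite (le_trans (kr _ _ _))// ler_peMl// ler1n.
Qed.

Lemma bounded_by_lincomb (V : normedModType R) (D' : set R) (c B C : R) (h k : R -> V) :
  bounded_by D' B h -> bounded_by D' C k ->
  bounded_by D' (`|c| * B + C) (fun t => c *: h t + k t).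
Proof.
move=> bh bk; apply: (@bounded_by_scaled _ _ _ _ (`|c| + 2)) => e e0 _.
have [s a] := bh e e0; have [r b] := bk e e0.
by exists (fun t => c *: s t + r t); exact: simple_approx_lincomb.
Qed.

Lemma bounded_measurable_lincomb (V : normedModType R) (D' : set R) (c : R) (h k : R -> V) :
  bounded_measurable D' h -> bounded_measurable D' k ->
  bounded_measurable D' (fun t => c *: h t + k t).
Proof.
by move=> [B bh] [C bk]; exists (`|c| * B + C); exact: bounded_by_lincomb.
Qed.

Lemma bounded_measurable_cst (V : normedModType R) (D' : set R) (v : V) :
  bounded_measurable D' (fun=> v).
Proof. by exists `|v|; exact: bounded_by_cst. Qed.

Lemma bounded_measurableZ (V : normedModType R) (D' : set R) (c : R) (h : R -> V) :
  bounded_measurable D' h -> bounded_measurable D' (fun t => c *: h t).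
Proof.
move=> bh; have := bounded_measurable_lincomb c bh (bounded_measurable_cst D' (0 : V)).
by under eq_fun do rewrite addr0.
Qed.

Lemma bounded_measurableD (V : normedModType R) (D' : set R) (h k : R -> V) :
  bounded_measurable D' h -> bounded_measurable D' k ->
  bounded_measurable D' (fun t => h t + k t).
Proof.
move=> bh bk; have := bounded_measurable_lincomb 1 bh bk.
by under eq_fun do rewrite scale1r.
Qed.

Lemma bounded_measurableB (V : normedModType R) (D' : set R) (h k : R -> V) :
  bounded_measurable D' h -> bounded_measurable D' k ->
  bounded_measurable D' (fun t => h t - k t).
Proof.
move=> bh bk; have := bounded_measurable_lincomb (-1) bk bh.
by under eq_fun do rewrite scaleN1r addrC.
Qed.

Lemma integral_on_lincomb (c : R) h k :
  bounded_measurable D h -> bounded_measurable D k ->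
  integral_on D (fun t => c *: h t + k t) = c *: integral_on D h + integral_on D k.
Proof.
move=> [B bh] [C bk]; have bl := bounded_by_lincomb c bh bk.
apply: (@norm_eps0 _ _ _ _
  ((`|c| + 2) * (len D + (`|c| * B + C) + (`|c| * B + C)) +
   (`|c| * (len D + B + B) + (len D + C + C)))) => e e0 _.
have [s a] := bh e e0; have [r b] := bk e e0.
have al := simple_approx_lincomb c a b.
have [ss _ _] := a; have [sr _ _] := b.
have := integral_on_approx fD bl al.
rewrite simple_integral_on_lincomb// => H.
have Hs := integral_on_approx fD bh a; have Hr := integral_on_approx fD bk b.
rewrite -(subrKA (c *: simple_integral_on D s + simple_integral_on D r)).
rewrite (le_trans (ler_normD _ _))// mulrDr lerD//.
  by rewrite distrC (le_trans H)// mulrCA mulrA.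
rewrite opprD addrACA -scalerBr (le_trans (ler_normD _ _))// normrZ.
by rewrite mulrDr lerD// mulrCA ler_wpM2l.
Qed.

Lemma integral_on_cst (v : X) : integral_on D (fun=> v) = len D *: v.
Proof.
apply: integral_on_eq => //; exists `|v| => e e0; exists (fun=> v).
  split=> //; first exact: simple_function_cst.
  exists set0; rewrite measure0 lee_fin (ltW e0); split => // t _ _.
  by rewrite subrr normr0 ltW.
by rewrite simple_integral_on_cst// subrr normr0 ltW.
Qed.

Lemma integral_on_cst0 : integral_on D (fun=> 0 : X) = 0.
Proof. by rewrite integral_on_cst scaler0. Qed.

Lemma integral_onZ (c : R) h : bounded_measurable D h ->
  integral_on D (fun t => c *: h t) = c *: integral_on D h.
Proof.
move=> bh; have := integral_on_lincomb c bh (bounded_measurable_cst D (0 : X)).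
by under eq_fun do rewrite addr0; rewrite integral_on_cst0 addr0.
Qed.

Lemma integral_onD h k : bounded_measurable D h -> bounded_measurable D k ->
  integral_on D (fun t => h t + k t) = integral_on D h + integral_on D k.
Proof.
move=> bh bk; have := integral_on_lincomb 1 bh bk.
by under eq_fun do rewrite scale1r; rewrite scale1r.
Qed.

Lemma integral_onB h k : bounded_measurable D h -> bounded_measurable D k ->
  integral_on D (fun t => h t - k t) = integral_on D h - integral_on D k.
Proof.
move=> bh bk; have := integral_on_lincomb (-1) bk bh.
by under eq_fun do rewrite scaleN1r addrC; rewrite scaleN1r addrC.
Qed.

Lemma integral_on_dist (B C e d : R) (E : set R) h k :
  bounded_by D B h -> bounded_by D C k -> 0 <= e ->
  measurable E -> (mu E <= d%:E)%E ->
  (forall t, D t -> ~ E t -> `|h t - k t| <= e) ->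
  `|integral_on D h - integral_on D k| <= e * len D + (B + C) * d.
Proof.
move=> bh bk e0 mE Ed hk.
apply: (@ler_eps _ _ _ (2 * len D + (B + C) * 2 + (len D + B + B) +
  (len D + C + C))) => n n0 _.
have [s a] := bh n n0; have [r b] := bk n n0.
have Hs := integral_on_approx fD bh a; have Hr := integral_on_approx fD bk b.
move: a b => [ss sB [F [mF Fn hs]]] [sr rC [G [mG Gn kr]]].
have mEF : measurable (E `|` F) by exact: measurableU.
have sr' : `|simple_integral_on D s - simple_integral_on D r| <=
    (e + n + n) * len D + (B + C) * (d + n + n).
  apply: (@simple_integral_on_dist _ _ _ ((E `|` F) `|` G)) => //.
  - by rewrite !addr_ge0// ltW.
  - exact: measurableU.
  - by apply: measureU2_le => //; exact: measureU2_le.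
  move=> t Dt /not_orP[/not_orP[nE nF] nG].
  rewrite -(subrKA (h t)) -(subrKA (k t) (h t)) addrA.
  rewrite (le_trans (ler_normD _ _))// lerD ?kr//.
  rewrite (le_trans (ler_normD _ _))// addrC lerD ?hk//.
  by rewrite distrC hs.
rewrite -(subrKA (simple_integral_on D s)).
rewrite -(subrKA (simple_integral_on D r) (simple_integral_on D s)).
rewrite (le_trans (ler_normD _ _))// distrC.
apply: le_trans (lerD Hs (le_trans (ler_normD _ _) (lerD sr' Hr))) _.
by rewrite le_eqVlt; apply/orP; left; apply/eqP; ring.
Qed.

Lemma integral_on_ae_eq h k : bounded_measurable D h ->
  ae_on D (fun t => h t = k t) -> integral_on D h = integral_on D k.
Proof.
move=> [B bh] hk; have bk := bounded_by_ae_eq hk bh.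
have [N [mN N0 NP]] := hk.
apply: (@norm_eps0 _ _ _ _ 0) => e _ _.
rewrite mulr0; apply: le_trans (@integral_on_dist B B 0 0 N h k bh bk (lexx 0) mN _ _) _.
- by rewrite N0.
- by move=> t Dt nN; rewrite NP// subrr normr0.
by rewrite mul0r mulr0 addr0.
Qed.

End Vector.

Lemma integral_on_setU (X : completeNormedModType R) (D D' : set R) (h : R -> X) :
  finite_measurable D -> finite_measurable D' -> D `&` D' = set0 ->
  bounded_measurable (D `|` D') h ->
  integral_on (D `|` D') h = integral_on D h + integral_on D' h.
Proof.
move=> fD fD' DD' [B bh].
have fU : finite_measurable (D `|` D').
  have [mD _] := fD; have [mD' _] := fD'.
  split; first exact: measurableU.
  have le : (mu (D `|` D') <= (len D + len D')%:E)%E.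
    by apply: measureU2_le => //; rewrite fineK//; exact: finite_measurable_fin.
  by apply: le_lt_trans le _; exact: ltry.
apply: (@norm_eps0 _ _ _ _ ((len (D `|` D') + B + B) + (len D + B + B) +
  (len D' + B + B))) => e e0 _.
have [s a] := bh e e0.
have bD : bounded_by D B h by apply: bounded_byW bh.
have bD' : bounded_by D' B h by apply: bounded_byW bh.
have aD : simple_approx D B e h s by apply: simple_approxW a.
have aD' : simple_approx D' B e h s by apply: simple_approxW a.
have H := integral_on_approx fU bh a.
have H1 := integral_on_approx fD bD aD; have H2 := integral_on_approx fD' bD' aD'.
rewrite -(subrKA (simple_integral_on (D `|` D') s)).
rewrite (le_trans (ler_normD _ _))// -addrA mulrDr lerD//; first by rewrite distrC.
rewrite simple_integral_on_setU//; last by case: a.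
by rewrite opprD addrACA mulrDr (le_trans (ler_normD _ _))// lerD.
Qed.

Section Real.
Variable D : set R.
Hypothesis fD : finite_measurable D.

Lemma bounded_by_norm (V : normedModType R) (D' : set R) (B : R) (h : R -> V) :
  bounded_by D' B h -> bounded_by D' B (fun t => `|h t| : R).
Proof.
move=> bh; have := @bounded_by_lipschitz _ V R D' B 1 (fun v => `|v|) h ler01 _ bh.
rewrite normr0 normr0 add0r mul1r; apply => x y.
by rewrite mul1r; exact: ler_dist_dist.
Qed.

Lemma integral_on_ge0 (h : R -> R) : bounded_measurable D h ->
  ae_on D (fun t => 0 <= h t) -> 0 <= integral_on D h.
Proof.
move=> [B bh] [N [mN N0 NP]]; have B0 := bounded_by_ge0 bh.
apply: (@ler_eps _ _ _ (len D + B + B)) => e e0 _.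
have [s [ss sB [E [mE Ee hs]]]] := bh e e0.
(* Since [h] is nonnegative almost everywhere, truncating its approximant at zero does not spoil the
   approximation. *)
pose s' := (Num.max 0) \o s.
have a : simple_approx D B e h s'.
  split.
  - exact: simple_function_comp.
  - move=> t /=; rewrite /s' /=; by case: (leP 0 (s t)) => ?; rewrite ?normr0 ?sB.
  exists (E `|` N); split; first exact: measurableU.
    by rewrite -(addr0 e) measureU2_le// N0.
  move=> t Dt /not_orP[nE nN].
  have h0 := NP t Dt nN; have := hs t Dt nE; rewrite /s' /=.
  case: (leP 0 (s t)) => // st0; rewrite subr0 (ger0_norm h0).
  by apply: le_trans; rewrite (le_trans _ (ler_norm _))// lerDl oppr_ge0 ltW.
have := integral_on_approx fD bh a; rewrite ler_norml => /andP[_].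
rewrite lerBlDl => /(le_trans _) ->//.
apply: simple_integral_on_ge0 => //; first by case: a.
by move=> t; rewrite /s' /= le_max lexx.
Qed.

Lemma integral_on_le (h k : R -> R) : bounded_measurable D h ->
  bounded_measurable D k -> ae_on D (fun t => h t <= k t) ->
  integral_on D h <= integral_on D k.
Proof.
move=> bh bk hk; rewrite -subr_ge0 -integral_onB//.
apply: integral_on_ge0; first exact: bounded_measurableB.
by apply: ae_onW hk => // t _; rewrite subr_ge0.
Qed.

Lemma integral_on_norm (X : completeNormedModType R) (h : R -> X) :
  bounded_measurable D h ->
  `|integral_on D h| <= integral_on D (fun t => `|h t|).
Proof.
move=> [B bh]; have bn := bounded_by_norm bh.
apply: (@ler_eps _ _ _ ((len D + B + B) + (len D + B + B))) => e e0 _.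
have [s a] := bh e e0; have H := integral_on_approx fD bh a.
have [ss sB [E [mE Ee hs]]] := a.
have an : simple_approx D B e (fun t => `|h t| : R) (fun t => `|s t| : R).
  split.
  - exact: (@simple_function_comp _ _ _ (fun v : X => `|v| : R)).
  - by move=> t; rewrite normr_id.
  exists E; split => // t Dt nE.
  by apply: le_trans (ler_dist_dist _ _) _; exact: hs.
have := integral_on_approx fD bn an; rewrite ler_norml => /andP[_ Hn].
have I := simple_integral_on_norm fD ss.
rewrite -[integral_on D h](subrK (simple_integral_on D s)).
rewrite (le_trans (ler_normD _ _))// distrC.
have {}Hn : simple_integral_on D (fun t => `|s t| : R) <=
    integral_on D (fun t => `|h t| : R) + e * (len D + B + B).
  by move: Hn; rewrite lerBlDl.
apply: le_trans (lerD H (le_trans I Hn)) _.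
by rewrite le_eqVlt; apply/orP; left; apply/eqP; ring.
Qed.

Lemma integral_on_norm_le (X : completeNormedModType R) (h : R -> X) (k : R -> R) :
  bounded_measurable D h -> bounded_measurable D k ->
  ae_on D (fun t => `|h t| <= k t) -> `|integral_on D h| <= integral_on D k.
Proof.
move=> bh bk hk; apply: le_trans (integral_on_norm bh) _.
apply: integral_on_le => //.
by case: bh => B /bounded_by_norm bn; exists B.
Qed.

Lemma integral_on_norm_bound (X : completeNormedModType R) (h : R -> X) (C : R) :
  bounded_measurable D h -> ae_on D (fun t => `|h t| <= C) ->
  `|integral_on D h| <= C * len D.
Proof.
move=> bh hC; rewrite mulrC -[len D * C](@integral_on_cst R D fD C).
by apply: integral_on_norm_le => //; exact: bounded_measurable_cst.
Qed.

End Real.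

End IntegralTheory.

(** * Comparison with strong measurability and the Lebesgue integral *)

Section Measurability.
Variable R : realType.
Local Notation mu := (@lebesgue_measure R).

Lemma lebesgue_measure_le (A B : set R) : measurable A -> measurable B ->
  A `<=` B -> (mu A <= mu B)%E.
Proof. by move=> mA mB AB; apply: le_measure; rewrite ?inE. Qed.

(** Written in the form of [epsilon_trick0], which bounds the sum of the series by one. *)
Definition dyadic (n : nat) : R := 1 / (2 ^ n.+1)%:R.

Lemma dyadic_gt0 n : 0 < dyadic n.
Proof. by rewrite divr_gt0// ltr0n expn_gt0. Qed.

Lemma dyadic_lt n : dyadic n < n.+1%:R^-1.
Proof.
rewrite /dyadic div1r ltf_pV2 ?posrE ?ltr0n ?expn_gt0// ltr_nat.
exact: ltn_expl.
Qed.

Lemma dyadic_small (e : R) : 0 < e -> exists n, forall k, (n <= k)%N -> dyadic k <= e.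
Proof.
move=> e0; have [N _ HN] := near_infty_natSinv_lt (PosNum e0).
by exists N => k Nk; rewrite (le_trans (ltW (dyadic_lt k)))// ltW// HN.
Qed.

Lemma borel_cantelli_dyadic (E : nat -> set R) :
  (forall n, measurable (E n)) -> (forall n, (mu (E n) <= (dyadic n)%:E)%E) ->
  exists N, [/\ measurable N, mu N = 0%E &
    forall t, ~ N t -> exists n, forall k, (n <= k)%N -> ~ E k t].
Proof.
move=> mE Ed; exists (lim_sup_set E); split.
- by apply: bigcap_measurable => // n _; apply: bigcup_measurable => k _; exact: mE.
- apply: lim_sup_set_cvg0 => //.
  apply: (@le_lt_trans _ _ 1%:E%E); last exact: ltry.
  apply: le_trans (epsilon_trick0 xpredT (@ler01 R)).
  by apply: lee_nneseries => // n _; exact: Ed.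
move=> t nN; apply: contrapT => /forallNP H; apply: nN => n _.
have /existsNP[k /not_implyP[nk /contrapT Ek]] := H n.
by exists k.
Qed.

(** Errors and exceptional sets are summable together, so Borel-Cantelli upgrades approximation in
    measure to approximation almost everywhere, with a rate. *)
Lemma bounded_by_sequence (V : normedModType R) (D : set R) (B : R) (h : R -> V) :
  bounded_by D B h -> exists s : nat -> R -> V,
    (forall n, simple_approx D B (dyadic n) h (s n)) /\
    ae_on D (fun t => exists n, forall k, (n <= k)%N -> `|h t - s k t| <= dyadic k).
Proof.
move=> bh; have /choice[s sP] n := bh (dyadic n) (dyadic_gt0 n).
exists s; split => //.
have /choice[E EP] (n : nat) : exists E, [/\ measurable E, (mu E <= (dyadic n)%:E)%E &
    forall t, D t -> ~ E t -> `|h t - s n t| <= dyadic n] by case: (sP n).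
have [||N [mN N0 NE]] := @borel_cantelli_dyadic E.
- by move=> n; have [] := EP n.
- by move=> n; have [] := EP n.
exists N; split => // t Dt /NE[n H]; exists n => k nk.
by have [_ _] := EP k; apply => //; exact: H.
Qed.

Lemma bounded_by_ae (V : normedModType R) (D : set R) (B : R) (h : R -> V) :
  bounded_by D B h -> ae_on D (fun t => `|h t| <= B).
Proof.
move=> bh; have [s [sP hs]] := bounded_by_sequence bh.
apply: ae_onW hs => // t Dt [n H]; apply/ler_addgt0Pr => e e0.
have [k ke] := dyadic_small e0.
pose j := maxn n k; have [_ sB _] := sP j.
rewrite -[h t](subrK (s j t)) (le_trans (ler_normD _ _))// addrC lerD//.
by rewrite (le_trans (H j (leq_maxl _ _)))// ke// leq_maxr.
Qed.

Lemma bounded_by_strongly_measurable (V : normedModType R) (a b B : R) (h : R -> V) :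
  bounded_by `[a, b] B h -> strongly_measurable (@normdist R V) a b h.
Proof.
move=> bh; have [s [sP hs]] := bounded_by_sequence bh.
exists s; split; first by move=> n; case: (sP n).
apply: ae_on_ae; apply: ae_onW hs => // t _ [n H].
apply/cvgrPdist_le => e e0; have [k ke] := dyadic_small e0.
exists (maxn n k) => // j /=; rewrite geq_max => /andP[nj kj].
by rewrite sub0r normrN /normdist normr_id (le_trans (H j nj))// ke.
Qed.

(* Egorov's argument. *)
Lemma strongly_measurable_bounded_by (V : normedModType R) (a b B : R) (h : R -> V) :
  0 <= B -> strongly_measurable (@normdist R V) a b h ->
  ae_on `[a, b] (fun t => `|h t| <= B) -> bounded_by `[a, b] (B + 1) h.
Proof.
move=> B0 [s [ss /ae_on_itv hs]] hB; apply: bounded_by_clip => // e e0.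
have [N [mN N0 NP]] := hs.
(* The approximants are compared with each other and not with [h], which makes [G n] measurable.
   These sets decrease, and their intersection lies in the null set where convergence may fail. *)
pose G n := `[a, b]%classic `&` \bigcup_(k in [set k | (n <= k)%N])
  \bigcup_(l in [set l | (n <= l)%N]) [set t | e < `|s k t - s l t|].
have mskl k l : measurable [set t | e < `|s k t - s l t|].
  rewrite (_ : [set _ | _] = (fun t => (s k t, s l t)) @^-1`
    [set w | e < `|w.1 - w.2|])//.
  by apply: simple_function_preimage; exact: simple_function_pair.
have mG n : measurable (G n).
  apply: measurableI => //; apply: bigcup_measurable => k _.
  by apply: bigcup_measurable => l _; exact: mskl.
have fab : (mu `[a, b] < +oo)%E.
  by rewrite lebesgue_measure_itv/=; case: ifP => _; rewrite -?EFinB ltry.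
have mGi : measurable (\bigcap_n G n).
  by apply: bigcap_measurable => // n _; exact: mG.
have G0 : mu (\bigcap_n G n) = 0%E.
  apply/eqP; rewrite eq_le measure_ge0 andbT -N0.
  apply: lebesgue_measure_le => // t Gt.
  apply: contrapT => nN.
  have tab : `[a, b]%classic t by case: (Gt 0%N I).
  have /cvgrPdist_le/(_ (e / 2)) := NP t tab nN.
  have e20 : 0 < e / 2 by rewrite divr_gt0.
  move=> /(_ e20)[n _ Hn].
  have [_ [k nk [l nl /= ekl]]] := Gt n I.
  have := Hn k nk; have := Hn l nl; rewrite /= !sub0r !normrN !normr_id => hl hk.
  move: ekl; rewrite ltNge => /negP; apply.
  rewrite -(subrKA (h t)) (le_trans (ler_normD _ _))// [e]splitr lerD//.
  by rewrite distrC.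
have cG : (mu \o G) n @[n --> \oo] --> (0 : \bar R).
  rewrite -G0; apply: nonincreasing_cvg_mu => //.
  - by apply: le_lt_trans fab; apply: lebesgue_measure_le => // t [].
  move=> n m nm; apply/subsetPset => t [tab [k mk [l ml ekl]]]; split => //.
  by exists k; [exact: leq_trans mk|exists l => //; exact: leq_trans ml].
have [n Gn] : exists n, (mu (G n) <= e%:E)%E.
  have fG n : mu (G n) \is a fin_num.
    rewrite ge0_fin_numE//; apply: le_lt_trans fab.
    by apply: lebesgue_measure_le => // t [].
  have cfG : (fine \o (mu \o G)) n @[n --> \oo] --> (0 : R) by exact: fine_cvg.
  move: cfG => /cvgrPdist_le/(_ e e0)[n _ Hn]; exists n.
  have := Hn n (leqnn n); rewrite /= sub0r normrN ger0_norm ?fine_ge0//.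
  by move=> H; rewrite -(fineK (fG n)) lee_fin.
exists (s n); split => //; exists (G n `|` N); split.
- by apply: measurableU => //; exact: mG.
- by rewrite -(addr0 e); apply: measureU2_le => //; rewrite N0.
move=> t tab /not_orP[nG nN].
have /cvgrPdist_le H := NP t tab nN.
apply/ler_addgt0Pr => d d0; have [k _ Hk] := H d d0.
pose j := maxn n k.
have := Hk j (leq_maxr _ _); rewrite /= sub0r normrN normr_id => hj.
rewrite -(subrKA (s j t)) (le_trans (ler_normD _ _))// addrC lerD//.
rewrite leNgt; apply/negP => ej; apply: nG; split => //.
by exists j; [exact: leq_maxl|exists n => //=].
Qed.

End Measurability.

(** * Lower integrals of nonnegative functions *)

Section LebesgueIntegral.
Variable R : realType.
Local Notation mu := (@lebesgue_measure R).
Local Notation len D := (fine (mu D)).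
Variable D : set R.
Hypothesis fD : finite_measurable D.

Let mD : measurable D. Proof. exact: (proj1 fD). Qed.

(* For a nonnegative function that is not Borel measurable, the library integral
   is the supremum of the integrals of the simple functions below it; the
   comparisons below need no measurability of [f]. *)
Lemma le_lower_integral (f g : R -> \bar R) :
  (forall t, D t -> (0 <= f t <= g t)%E) ->
  (\int[mu]_(t in D) f t <= \int[mu]_(t in D) g t)%E.
Proof.
move=> fg; rewrite !ge0_integralE; last 2 first.
- by move=> t /fg/andP[f0 ?]; exact: le_trans f0 _.
- by move=> t /fg/andP[].
apply: ge_ereal_sup => _ [s /= sf <-]; apply: ereal_sup_ubound; exists s => // t.
apply: le_trans (sf t) _; rewrite /patch; case: ifPn => //.
by rewrite inE => /fg/andP[].
Qed.

Lemma simple_function_measurable (s : R -> R) : simple_function s ->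
  measurable_fun setT s.
Proof. by move=> ss _ Y mY; rewrite setTI; exact: simple_function_preimage. Qed.

Lemma integral_simple (s : R -> R) : simple_function s -> (forall t, 0 <= s t) ->
  (\int[mu]_(t in D) (s t)%:E = (simple_integral_on D s)%:E)%E.
Proof.
move=> ss s0; have [r ur sr] := simple_function_range ss.
(* The absolute value makes every term nonnegative, also for listed values that [s] does not attain;
   the fibre of a negative [v] is empty. *)
pose f (v : R) (t : R) := (`|v|%:E * (\1_(s @^-1` [set v]) t)%:E)%E.
have mv v : measurable (s @^-1` [set v]) by exact: (proj2 ss).
have -> : (\int[mu]_(t in D) (s t)%:E = \int[mu]_(t in D) (\sum_(v <- r) f v t))%E.
  apply: eq_integral => t _; have str : s t \in r by apply: sr; exists t.
  rewrite (bigD1_seq (s t) str ur)/=.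
  rewrite big1 => [|v vs]; last first.
    rewrite /f indicE memNset ?mule0// => /= stv.
    by rewrite stv eqxx in vs.
  by rewrite adde0 /f indicE mem_set// mule1 ger0_norm.
rewrite ge0_integral_sum//; last 2 first.
- move=> v; apply: emeasurable_funM; first exact: measurable_cst.
  by apply/measurable_EFinP/measurable_indic; exact: mv.
- by move=> v t _; rewrite /f mule_ge0// lee_fin.
rewrite -[s in RHS]/(id \o s) (simple_integral_onE _ fD ss ur sr) -sumEFin.
apply: eq_bigr => v _; rewrite /f ge0_integralZl//; last first.
  by apply/measurable_EFinP/measurable_indic; exact: mv.
rewrite integral_indic//; last exact: mv.
have [v0|v0] := leP 0 v.
  rewrite setIC ger0_norm// EFinM fineK 1?muleC//.
  exact: (finite_measurable_fin (finite_measurableI fD (mv v))).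
rewrite (_ : s @^-1` [set v] = set0) ?set0I ?setI0 ?measure0 ?mule0 ?scale0r//.
by apply/seteqP; split => // t /= stv; move: v0; rewrite -stv ltNge s0.
Qed.

(** A term equal to [+oo] on the exceptional null set makes the inequality hold everywhere on [D]
    and contributes nothing to the integral. *)
Lemma lower_integral_le (f : R -> \bar R) (s : R -> R) :
  simple_function s -> (forall t, 0 <= s t) -> (forall t, D t -> (0 <= f t)%E) ->
  ae_on D (fun t => (f t <= (s t)%:E)%E) ->
  (\int[mu]_(t in D) f t <= (simple_integral_on D s)%:E)%E.
Proof.
move=> ss s0 f0 [N [mN N0 NP]].
have s0' t : (0 <= (s t)%:E)%E by rewrite lee_fin.
have i0 t : (0 <= +oo * (\1_N t)%:E :> \bar R)%E by rewrite mule_ge0// lee_fin.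
apply: (@le_trans _ _ (\int[mu]_(t in D) ((s t)%:E + +oo * (\1_N t)%:E))%E).
  apply: le_lower_integral => t Dt; rewrite f0//=.
  have [Nt|Nt] := pselect (N t).
    by rewrite indicE mem_set// mule1 addey ?leey// -ltNye ltNyr.
  by rewrite (le_trans (NP t Dt Nt))// leeDl.
have mi : measurable_fun D (fun t => (\1_N t : R)%:E).
  by apply/measurable_EFinP/measurable_indic.
rewrite ge0_integralD//; last 2 first.
- by apply/measurable_EFinP; apply: measurable_funTS; exact: simple_function_measurable.
- by apply: emeasurable_funM => //; exact: measurable_cst.
rewrite integral_simple// ge0_integralZl//.
have ND : mu (N `&` D) = 0%E.
  apply/eqP; rewrite eq_le measure_ge0 andbT -N0.
  by apply: lebesgue_measure_le => //; exact: measurableI.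
rewrite integral_indic//.
apply: (@le_trans _ _ ((simple_integral_on D s)%:E + +oo * mu (N `&` D))%E) => //.
by rewrite ND mule0 adde0.
Qed.

(** Setting [s] to zero on [E] yields a simple function below [f] on all of [D], and lowers the
    integral by at most [(B + B) * d]. *)
Lemma lower_integral_ge (f : R -> \bar R) (s : R -> R) (B d : R) (E : set R) :
  simple_function s -> (forall t, 0 <= s t <= B) -> (forall t, D t -> (0 <= f t)%E) ->
  measurable E -> (mu E <= d%:E)%E ->
  (forall t, D t -> ~ E t -> ((s t)%:E <= f t)%E) ->
  ((simple_integral_on D s - (B + B) * d)%:E <= \int[mu]_(t in D) f t)%E.
Proof.
move=> ss sB f0 mE Ed sf.
pose s' := (fun w : R * bool => if w.2 then 0 else w.1) \o (fun t => (s t, `[< E t >])).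
have ss' : simple_function s'.
  by apply/simple_function_comp/simple_function_pair => //; exact: simple_function_indic.
have s'B t : 0 <= s' t <= B.
  by rewrite /s' /=; case: ifP => // _; have /andP[s0 /(le_trans s0)->] := sB t; rewrite lexx.
have H : `|simple_integral_on D s - simple_integral_on D s'| <= (B + B) * d.
  rewrite -[leRHS]add0r -{1}(mul0r (len D)).
  apply: (@simple_integral_on_dist _ _ _ E) => //.
  - by move=> t; have /andP[s0 ?] := sB t; rewrite ger0_norm.
  - by move=> t; have /andP[s0 ?] := s'B t; rewrite ger0_norm.
  by move=> t Dt nE; rewrite /s' /= ifF ?subrr ?normr0//; apply/asboolPn.
apply: (@le_trans _ _ (simple_integral_on D s')%:E).
  by rewrite lee_fin lerBlDl; move: H; rewrite ler_norml => /andP[_]; rewrite lerBlDl addrC.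
rewrite -integral_simple//; last by move=> t; have /andP[] := s'B t.
apply: le_lower_integral => t Dt; rewrite lee_fin; have /andP[-> _ /=] := s'B t.
rewrite /s' /=; case: ifPn => [_|/asboolPn nE]; first exact: f0.
exact: sf.
Qed.

End LebesgueIntegral.

(** * Agreement with Bochner integrals and with the library integral *)

Section BochnerIntegral.
Variable R : realType.
Local Notation mu := (@lebesgue_measure R).
Local Notation len D := (fine (mu D)).

Lemma finite_measurable_itv (a b : R) : finite_measurable `[a, b].
Proof.
split; first exact: measurable_itv.
by rewrite lebesgue_measure_itv/=; case: ifP => _; rewrite -?EFinB ltry.
Qed.

Lemma finite_measurable_itvoc (a b : R) : finite_measurable `]a, b].
Proof.
split; first exact: measurable_itv.
by rewrite lebesgue_measure_itv/=; case: ifP => _; rewrite -?EFinB ltry.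
Qed.

Lemma cvg_dyadic (V : normedModType R) (u : nat -> V) (v : V) (C : R) :
  (forall n, `|u n - v| <= dyadic R n * C) -> u n @[n --> \oo] --> v.
Proof.
move=> uv; apply/cvgrPdist_le => e e0.
have C1 : 0 < `|C| + 1 by rewrite ltr_wpDl.
have [N HN] := @dyadic_small R (e / (`|C| + 1)) (divr_gt0 e0 C1).
exists N => // n /= Nn; rewrite distrC (le_trans (uv n))//.
apply: (@le_trans _ _ (dyadic R n * (`|C| + 1))).
  by rewrite ler_pM2l ?dyadic_gt0// (le_trans (ler_norm _))// lerDl.
by rewrite -ler_pdivlMr// HN.
Qed.

Lemma dyadic_le1 n : dyadic R n <= 1.
Proof. by rewrite (le_trans (ltW (dyadic_lt _ _)))// invf_le1// ler1n. Qed.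

Lemma integral_on_simple (V : normedModType R) (D : set R) (B : R) (s : R -> V) :
  finite_measurable D -> simple_function s -> (forall t, `|s t| <= B) ->
  integral_on D s = simple_integral_on D s.
Proof.
move=> fD ss sB; apply: integral_on_eq => //; exists B => e e0; exists s.
  split=> //; exists set0; rewrite measure0 lee_fin (ltW e0); split => // t _ _.
  by rewrite subrr normr0 ltW.
by rewrite subrr normr0 ltW.
Qed.

Lemma simple_function_bounded (V : normedModType R) (s : R -> V) :
  simple_function s -> exists B : R, forall t, `|s t| <= B.
Proof.
move=> ss; have [r ur sr] := simple_function_range ss.
exists (\sum_(v <- r) `|v|) => t.
have str : s t \in r by apply: sr; exists t.
by rewrite (bigD1_seq (s t) str ur)/= lerDl sumr_ge0.
Qed.

Lemma is_bochner_integral_on (X : completeNormedModType R) (a b : R) (h : R -> X) :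
  bounded_measurable `[a, b] h -> is_bochner_integral a b h (integral_on `[a, b] h).
Proof.
move=> [B bh]; have fD := finite_measurable_itv a b.
split; first exact: bounded_by_strongly_measurable bh.
have /choice[s sP] n := bh (dyadic R n) (dyadic_gt0 R n).
have B0 := bounded_by_ge0 bh.
exists s; split; first by move=> n; case: (sP n).
- pose C := len (`[a, b]%classic) + (1 + 2 * B).
  have H n : (0 <= \int[mu]_(t in `[a, b]) `|h t - s n t|%:E <=
      (dyadic R n * C)%:E)%E.
    rewrite integral_ge0/=; last by move=> t _; rewrite lee_fin.
    have [ss sB [E [mE Ed hs]]] := sP n.
    have d0 := dyadic_gt0 R n; have d1 := dyadic_le1 n.
    (* A simple function that dominates the norm of [h - s n] almost everywhere: the approximation
       error off [E], increased on [E] by the crude bound [2 * B]. *)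
    pose psi := (fun x : bool => if x then dyadic R n + 2 * B else dyadic R n) \o
      (fun t => `[< E t >]).
    have spsi : simple_function psi.
      by apply: simple_function_comp; exact: simple_function_indic.
    have psi0 t : 0 <= psi t.
      by rewrite /psi /=; case: ifP => _; rewrite ?addr_ge0 ?mulr_ge0 ?(ltW d0).
    apply: (@le_trans _ _ (simple_integral_on `[a, b] psi)%:E).
      apply: lower_integral_le => //.
      apply: ae_onW (bounded_by_ae bh) => // t tab htB; rewrite lee_fin /psi /=.
      case: ifPn => [_|/asboolPn nE]; last exact: hs.
      rewrite (le_trans (ler_normB _ _))// ler_wpDl ?(ltW d0)//.
      by rewrite mulr_natl mulr2n lerD.
    rewrite lee_fin.
    have := @simple_integral_on_dist R R `[a, b] E (dyadic R n + 2 * B) 0 (dyadic R n)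
      (dyadic R n) psi (fun=> 0) fD spsi (simple_function_cst R (0 : R)).
    rewrite simple_integral_on_cst// scaler0 subr0 addr0 => /(_ _ _ _ mE Ed _) Hd.
    apply: le_trans (ler_norm _) (le_trans (Hd _ _ _ _) _).
    + move=> t; rewrite ger0_norm// /psi /=; case: ifP => // _.
      by rewrite lerDl mulr_ge0.
    + by move=> t; rewrite normr0.
    + exact: ltW.
    + move=> t _ nE; rewrite subr0 ger0_norm// /psi /= ifF//.
      exact/asboolPn.
    rewrite mulrC [X in _ + X]mulrC [X in X + _]mulrC -mulrDr ler_pM2l//.
    by rewrite lerD2l lerD2r.
  have F n : (\int[mu]_(t in `[a, b]) `|h t - s n t|%:E)%E \is a fin_num.
    have /andP[H1 H2] := H n.
    by rewrite ge0_fin_numE// (le_lt_trans H2)// ltry.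
  apply/fine_cvgP; split; first exact: nearW.
  apply: (@cvg_dyadic _ _ _ C) => n /=; have /andP[H1 H2] := H n.
  by rewrite subr0 ger0_norm ?fine_ge0// -lee_fin fineK.
apply: (@cvg_dyadic _ _ _ (len (`[a, b]%classic) + B + B)) => n.
exact: integral_on_approx bh (sP n).
Qed.

(** This gives uniqueness of the Bochner integral: the simple functions in its definition carry no
    common bound, and are only known to be close to [h] in the lower integral. With [s'] an
    approximant of [h], the positive part of the norm of [s - s'] minus [e] lies below the norm of
    [h - s] off a small set, so its integral is controlled. *)
Lemma simple_integral_le_lower (X : completeNormedModType R) (D : set R)
    (h s : R -> X) : finite_measurable D -> bounded_measurable D h ->
  simple_function s ->
  ((`|simple_integral_on D s - integral_on D h|)%:E <=
    \int[mu]_(t in D) `|h t - s t|%:E)%E.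
Proof.
move=> fD [B bh] ss; have [C sC] := simple_function_bounded ss.
have C0 : 0 <= C by exact: le_trans (sC 0).
have B0 := bounded_by_ge0 bh.
have int0 : (0 <= \int[mu]_(t in D) `|h t - s t|%:E)%E.
  by apply: integral_ge0 => t _; rewrite lee_fin.
case E : (\int[mu]_(t in D) `|h t - s t|%:E)%E => [K| |]; last 2 first.
- exact: leey.
- by move: int0; rewrite E.
rewrite lee_fin.
apply: (@ler_eps _ _ _ ((C + B + (C + B)) + len D + (len D + B + B))) => e e0 e1.
have [s' a] := bh e e0; have [ss' sB [F [mF Fe hs]]] := a.
pose del := (fun w : X * X => `|w.1 - w.2|) \o (fun t => (s t, s' t)).
pose psi := (fun x : R => Num.max 0 (x - e)) \o del.
have sdel : simple_function del by exact/simple_function_comp/simple_function_pair.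
have spsi : simple_function psi by exact: simple_function_comp.
have delCB t : 0 <= del t <= C + B.
  by rewrite /del /= normr_ge0 (le_trans (ler_normB _ _))// lerD.
have psiCB t : 0 <= psi t <= C + B.
  rewrite /psi /= le_max lexx/= ge_max addr_ge0//=.
  by have /andP[_ d1] := delCB t; rewrite (le_trans _ d1)// lerBlDr lerDl ltW.
have K1 : simple_integral_on D psi - (C + B + (C + B)) * e <= K.
  rewrite -lee_fin -E; apply: (@lower_integral_ge _ _ _ _ _ _ _ F) => // t Dt nF.
  rewrite lee_fin /psi /= ge_max normr_ge0/= lerBlDr.
  rewrite /del /= -(subrKA (h t)) (le_trans (ler_normD _ _))// lerD ?hs//.
  by rewrite distrC.
have K2 : simple_integral_on D del <= simple_integral_on D psi + e * len D.
  have := @simple_integral_on_dist R R D set0 (C + B) (C + B) e 0 del psi fD sdel spsi.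
  rewrite mulr0 addr0 measure0 => H.
  rewrite -lerBlDl (le_trans (ler_norm _))// H//.
  - by move=> t; have /andP[? ?] := delCB t; rewrite ger0_norm.
  - by move=> t; have /andP[? ?] := psiCB t; rewrite ger0_norm.
  - exact: ltW.
  move=> t _ _; have /andP[d0 _] := delCB t; rewrite /psi /=.
  case: (leP 0 (del t - e)) => de.
    by rewrite opprB addrC subrK ger0_norm ?(ltW e0).
  by rewrite subr0 ger0_norm// ltW// -subr_lt0.
have K3 : `|simple_integral_on D s - simple_integral_on D s'| <= simple_integral_on D del.
  have -> : simple_integral_on D s - simple_integral_on D s' =
      simple_integral_on D (fun t => -1 *: s' t + s t).
    by rewrite simple_integral_on_lincomb// scaleN1r addrC.
  have := @simple_integral_on_norm R X D (fun t => -1 *: s' t + s t) fD.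
  rewrite (_ : (fun t => `| -1 *: s' t + s t|) = del); last first.
    by apply/funext => t; rewrite /del /= scaleN1r addrC.
  apply; apply: (@simple_function_comp _ _ _ (fun w : X * X => -1 *: w.2 + w.1)
    (fun t => (s t, s' t))); exact: simple_function_pair.
have K4 := integral_on_approx fD bh a.
rewrite -(subrKA (simple_integral_on D s')) (le_trans (ler_normD _ _))//.
rewrite (_ : K + _ = K + (C + B + (C + B)) * e + e * len D +
  e * (len D + B + B)); last by ring.
apply: lerD K4; apply: (le_trans K3); apply: (le_trans K2).
by rewrite lerD2r -lerBlDr.
Qed.

Lemma is_bochner_integral_uniq (X : completeNormedModType R) (a b : R)
    (h : R -> X) (v : X) :
  bounded_measurable `[a, b] h -> is_bochner_integral a b h v ->
  v = integral_on `[a, b] h.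
Proof.
move=> bh [_ [s [ss hs sv]]].
apply: (@norm_eps0 _ _ _ _ 2) => e e0 _.
move/fine_cvgP : hs => [[N1 _ H1] /cvgrPdist_le/(_ e e0)[N2 _ H2]].
move/cvgrPdist_le : sv => /(_ e e0)[N3 _ H3].
pose n := maxn N1 (maxn N2 N3).
have En : `|v - simple_integral_on `[a, b] (s n)| <= e.
  by apply: H3; rewrite /= /n !leq_max leqnn !orbT.
have Fn : (\int[mu]_(t in `[a, b]) `|h t - s n t|%:E \is a fin_num)%E.
  by apply: H1; rewrite /= /n leq_maxl.
have Hn : `|0 - fine (\int[mu]_(t in `[a, b]) `|h t - s n t|%:E)%E| <= e.
  by apply: H2; rewrite /= /n !leq_max leqnn !orbT.
have := simple_integral_le_lower (finite_measurable_itv a b) bh (ss n).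
rewrite -(fineK Fn) lee_fin => le.
rewrite -(subrKA (simple_integral_on `[a, b] (s n))) (le_trans (ler_normD _ _))//.
rewrite mulr_natr mulr2n lerD// (le_trans le)// (le_trans (ler_norm _))//.
by rewrite -normrN -sub0r.
Qed.

(** The running cost is a library integral of a function that need not be Borel. It is squeezed
    between simple functions: above by [|s| + e], increased by [B] on the exceptional set; below by
    the positive part of [|s| - e], with the exceptional set discarded. *)
Lemma integral_on_Rintegral (D : set R) (h : R -> R) : finite_measurable D ->
  bounded_measurable D h -> (forall t, D t -> 0 <= h t) ->
  \int[mu]_(t in D) h t = integral_on D h.
Proof.
move=> fD [B bh] h0; have B0 := bounded_by_ge0 bh.
have f0 t : D t -> (0 <= (h t)%:E)%E by rewrite lee_fin; exact: h0.
have int0 : (0 <= \int[mu]_(t in D) (h t)%:E)%E by exact: integral_ge0.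
pose C := 2 * len D + (B + (B + 1 + B)) + (B + B).
have upper e : 0 < e -> e <= 1 ->
    (\int[mu]_(t in D) (h t)%:E <= (integral_on D h + e * C)%:E)%E.
  move=> e0 e1; have [s [ss sB [E [mE Ee hs]]]] := bh e e0.
  pose psi := (fun w : R * bool => if w.2 then B + `|w.1| + e else `|w.1| + e) \o
    (fun t => (s t, `[< E t >])).
  have spsi : simple_function psi.
    by apply/simple_function_comp/simple_function_pair => //; exact: simple_function_indic.
  have psi0 t : 0 <= psi t.
    by rewrite /psi /=; case: ifP => _; rewrite !addr_ge0// ltW.
  have psiB t : `|psi t| <= B + 1 + B.
    rewrite ger0_norm// /psi /=; have := sB t; case: ifP => _ stB; lra.
  apply: (@le_trans _ _ (simple_integral_on D psi)%:E).
    apply: lower_integral_le => //; apply: ae_onW (bounded_by_ae bh) => // t Dt htB.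
    rewrite lee_fin /psi /=; case: ifPn => [_|/asboolPn nE].
      by rewrite (le_trans (ler_norm _))// (le_trans htB)// -addrA lerDl addr_ge0// ltW.
    have := hs t Dt nE; have := ler_norm (s t); have := ler_norm (h t - s t); lra.
  rewrite lee_fin -(integral_on_simple fD spsi psiB).
  have := @integral_on_dist R R D fD (B + 1 + B) B (2 * e) e E psi h
    (bounded_by_simple D spsi psiB) bh _ mE Ee _.
  rewrite mulr_ge0 ?(ltW e0)// => /(_ isT) H.
  rewrite -lerBlDl (le_trans (ler_norm _))// (le_trans (H _))//.
    move=> t Dt nE; rewrite /psi /= ifF; last exact/asboolPn.
    have := ler_dist_dist (s t) (h t); rewrite (distrC (s t)) (ger0_norm (h0 t Dt)).
    move=> /le_trans/(_ (hs t Dt nE)); rewrite !ler_norml => /andP[? ?].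
    by apply/andP; split; lra.
  rewrite /C; nra.
have lower e : 0 < e -> e <= 1 ->
    ((integral_on D h - e * C)%:E <= \int[mu]_(t in D) (h t)%:E)%E.
  move=> e0 e1; have [s [ss sB [E [mE Ee hs]]]] := bh e e0.
  pose psi := (fun x : R => Num.max 0 (`|x| - e)) \o s.
  have spsi : simple_function psi by exact: simple_function_comp.
  have psiB t : 0 <= psi t <= B.
    rewrite /psi /= le_max lexx/= ge_max B0/=; have := sB t; lra.
  have psiB' t : `|psi t| <= B.
    by have /andP[? ?] := psiB t; rewrite ger0_norm.
  have psih t : D t -> ~ E t -> psi t <= h t /\ `|psi t - h t| <= 2 * e.
    move=> Dt nE; have ht0 := h0 t Dt; have := hs t Dt nE.
    have := ler_dist_dist (h t) (s t); rewrite (ger0_norm ht0) => H1 H2.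
    have := le_trans H1 H2; rewrite ler_norml => /andP[H3 H4]; rewrite /psi /=.
    case: (leP 0 (`|s t| - e)) => H5.
      by split; [lra|rewrite ler_norml; apply/andP; split; lra].
    by split => //; rewrite ler_norml; apply/andP; split; lra.
  have := @lower_integral_ge R D fD (fun t => (h t)%:E) psi B e E spsi psiB f0 mE Ee.
  move=> /(_ (fun t Dt nE => (psih t Dt nE).1)); apply: le_trans.
  rewrite lee_fin -(integral_on_simple fD spsi psiB').
  have := @integral_on_dist R R D fD B B (2 * e) e E psi h
    (bounded_by_simple D spsi psiB') bh _ mE Ee (fun t Dt nE => (psih t Dt nE).2).
  rewrite mulr_ge0 ?(ltW e0)// => /(_ isT); rewrite ler_norml => /andP[+ _].
  rewrite /C; nra.
have fin : (\int[mu]_(t in D) (h t)%:E \is a fin_num)%E.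
  by rewrite ge0_fin_numE// (le_lt_trans (upper 1 ltr01 (lexx 1)))// ltry.
apply/eqP; rewrite eq_le; apply/andP; split; apply: (@ler_eps _ _ _ C) => e e0 e1.
  by rewrite -lee_fin fineK// upper.
by rewrite -lerBlDr -lee_fin fineK// lower.
Qed.

End BochnerIntegral.

(** * Uniformly continuous functions and semigroups *)

Section UniformContinuity.
Variable R : realType.
Local Notation mu := (@lebesgue_measure R).
Local Notation len D := (fine (mu D)).

Definition uniformly_continuous_on (V : normedModType R) (T : R) (x : R -> V) :=
  forall e : R, 0 < e -> exists2 d : R, 0 < d & forall s t, 0 <= s <= T -> 0 <= t <= T ->
    `|s - t| <= d -> `|x s - x t| <= e.

Lemma within_continuous_uniform (V : normedModType R) (T : R) (x : R -> V) :
  {within `[0, T], continuous x} -> uniformly_continuous_on T x.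
Proof.
move=> /subspace_continuousP cx e e0.
have /compact_near_coveringP/(_ nat \oo (fun n s => forall t, 0 <= s <= T ->
    0 <= t <= T -> `|s - t| <= n.+1%:R^-1 -> `|x s - x t| <= e)) :=
  @segment_compact R 0 T.
move=> /(_ _ _)[|N _ HN]; last first.
  exists N.+1%:R^-1; first by rewrite invr_gt0.
  move=> s t s0T t0T st; apply: (HN N) => //=.
move=> s sT.
have := cx s sT; move=> /cvgrPdist_le/(_ (e / 2)).
have e20 : 0 < e / 2 by rewrite divr_gt0.
move=> /(_ e20)/nbhs_ballP[d /= d0 Hd].
have d20 : 0 < d / 2 by rewrite divr_gt0.
exists (ball s (d / 2), [set n | n.+1%:R^-1 < d / 2]).
  split; first exact: nbhsx_ballx.
  exact: (near_infty_natSinv_lt (PosNum d20)).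
move=> [s' n] /= [] /=; rewrite -ball_normE /= => ss' nd t s'T tT s't.
rewrite -(subrKA (x s)) (le_trans (ler_normD _ _))// [e]splitr lerD//.
  rewrite distrC; apply: Hd; last by rewrite /= in_itv.
  by rewrite -ball_normE /=; apply: lt_trans ss' _; rewrite [ltRHS]splitr ltrDl.
apply: Hd; last by rewrite /= in_itv.
rewrite -ball_normE /= -(subrKA s') (le_lt_trans (ler_normD _ _))//.
by rewrite [ltRHS]splitr ltrD// (le_lt_trans s't).
Qed.

Lemma uniform_within_continuous (V : normedModType R) (T : R) (x : R -> V) :
  uniformly_continuous_on T x -> {within `[0, T], continuous x}.
Proof.
move=> ux; apply/subspace_continuousP => s sT; apply/cvgrPdist_le => e e0.
have [d d0 Hd] := ux e e0.
apply/nbhs_ballP; exists d => //= t; rewrite -ball_normE /= => st tT.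
by apply: Hd; [move: sT; rewrite /= in_itv|move: tT; rewrite in_itv|exact: ltW].
Qed.

(** Sampling on the grid of multiples of the modulus [d]. As all values of the step function are
    values of [x] on [[0, T]], a bound for [x] there bounds the step function everywhere. *)
Lemma uniform_step_approx (V : normedModType R) (T e : R) (x : R -> V) :
  0 <= T -> uniformly_continuous_on T x -> 0 < e -> exists s : R -> V,
  [/\ simple_function s, forall t, 0 <= t <= T -> `|x t - s t| <= e &
      forall t, exists2 r, 0 <= r <= T & s t = x r].
Proof.
move=> T0 ux e0; have [d d0 Hd] := ux e e0.
(* The default [0] outside [[0, T]] makes the step function equal to [x 0] there. *)
pose q (t : R) : nat := if 0 <= t <= T then Num.truncn (t / d) else 0%N.
have qP t : 0 <= t <= T -> d * (q t)%:R <= t < d * (q t).+1%:R.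
  move=> tT; have /andP[t0 _] := tT; rewrite /q tT.
  have /andP[H1 H2] := truncn_itv (divr_ge0 t0 (ltW d0)).
  by rewrite ![d * _]mulrC -ler_pdivlMr// -ltr_pdivrMr// H1.
have q0 t : 0 <= d * (q t)%:R <= T.
  rewrite mulr_ge0 ?(ltW d0)//=; have [tT|tT] := boolP (0 <= t <= T).
    by have /andP[H _] := qP t tT; have /andP[_] := tT; exact: le_trans.
  by rewrite /q (negbTE tT) mulr0.
have sq : simple_function q.
  split.
    apply: (@sub_finite_set _ _ `I_(Num.truncn (T / d)).+1); last exact: finite_II.
    move=> _ [t _ <-] /=; rewrite ltnS truncn_ge_nat ?divr_ge0 ?(ltW d0)//.
    by rewrite ler_pdivlMr// mulrC; have /andP[] := q0 t.
  move=> k; rewrite (_ : _ @^-1` _ =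
    (`[0, T] `&` `[d * k%:R, d * k.+1%:R[) `|`
    (if k == 0%N then ~` `[0, T] else set0)); last first.
    apply/seteqP; split => t /=.
      move=> <-; have [tT|tT] := boolP (0 <= t <= T).
        by left; rewrite !in_itv /=; split => //; exact: qP.
      by right; rewrite /q (negbTE tT) /= in_itv /=; exact/negP.
    move=> [[]|]; rewrite ?in_itv /=.
      move=> tT; have := qP t tT => /andP[H1 H2] /andP[H3 H4].
      apply/eqP; rewrite eqn_leq; apply/andP; split.
        by rewrite -ltnS -(ltr_nat R) -(ltr_pM2l d0) (le_lt_trans H1).
      by rewrite -ltnS -(ltr_nat R) -(ltr_pM2l d0) (le_lt_trans H3).
    case: eqP => // -> /=; rewrite in_itv /= /q.
    by case: ifP.
  apply: measurableU; first exact: measurableI.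
  by case: ifP => _ //; exact: measurableC.
exists ((fun k => x (d * k%:R)) \o q); split.
- exact: simple_function_comp.
- move=> t tT /=; apply: Hd => //; have /andP[H1 H2] := qP t tT.
  by rewrite ger0_norm ?subr_ge0// lerBlDl ltW// -[X in _ + X]mulr1 -mulrDr natr1.
- by move=> t; exists (d * (q t)%:R).
Qed.

Lemma uniform_bounded_on (V : normedModType R) (T : R) (x : R -> V) :
  0 <= T -> uniformly_continuous_on T x ->
  exists2 B : R, 0 <= B & forall t, 0 <= t <= T -> `|x t| <= B.
Proof.
move=> T0 ux; have [s [ss xs _]] := uniform_step_approx T0 ux ltr01.
have [B sB] := simple_function_bounded ss.
have B0 : 0 <= B by exact: le_trans (sB 0).
exists (B + 1); first by rewrite addr_ge0.
move=> t tT; rewrite -[x t](subrK (s t)) (le_trans (ler_normD _ _))// addrC lerD//.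
exact: xs.
Qed.

Lemma uniform_bounded_by (V : normedModType R) (T B : R) (x : R -> V) :
  0 <= T -> uniformly_continuous_on T x ->
  (forall t, 0 <= t <= T -> `|x t| <= B) -> bounded_by `[0, T] B x.
Proof.
move=> T0 ux xB e e0; have [s [ss xs sx]] := uniform_step_approx T0 ux e0.
exists s; split => //; first by move=> t; have [r rT ->] := sx t; exact: xB.
exists set0; rewrite measure0 lee_fin (ltW e0); split => // t tT _.
by apply: xs; move: tT; rewrite /= in_itv.
Qed.

Lemma uniform_bounded_measurable (V : normedModType R) (T : R) (x : R -> V) :
  0 <= T -> uniformly_continuous_on T x -> bounded_measurable `[0, T] x.
Proof.
move=> T0 ux; have [B _ xB] := uniform_bounded_on T0 ux.
by exists B; exact: uniform_bounded_by.
Qed.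

Lemma len_itv (a b : R) : a <= b -> len `[a, b] = b - a.
Proof.
rewrite lebesgue_measure_itv /= lte_fin le_eqVlt => /orP[/eqP ->|->//].
by rewrite ltxx /= subrr.
Qed.

Lemma expR_uniform (T c l : R) :
  uniformly_continuous_on T (fun t => c * expR (l * t)).
Proof.
apply: within_continuous_uniform; apply: continuous_subspaceT => t.
apply: cvgM; first exact: cvg_cst.
apply: (@continuous_comp _ _ _ (fun t => l * t) expR).
  by apply: cvgM; [exact: cvg_cst|exact: cvg_id].
exact: continuous_expR.
Qed.

Lemma integral_expR (t c l : R) : 0 <= t -> 0 < l -> 0 <= c ->
  integral_on `[0, t] (fun s => c * expR (l * s)) <= c / l * expR (l * t).
Proof.
move=> t0 l0 c0.
have fD := finite_measurable_itv 0 t.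
have bm := uniform_bounded_measurable t0 (expR_uniform t c l).
have [t_gt0|] := ltP 0 t; last first.
  move=> t_le0; have -> : t = 0 by apply/eqP; rewrite eq_le t_le0.
  have bm0 : bounded_measurable `[0, 0] (fun s : R => c * expR (l * s)).
    exact: (uniform_bounded_measurable (lexx 0) (expR_uniform 0 c l)).
  have fD0 := finite_measurable_itv (0 : R) 0.
  apply: le_trans (ler_norm _) _.
  apply: (@le_trans _ _ (c * expR (l * 0) * len `[0, 0])).
    apply: integral_on_norm_bound => //; apply: ae_onT => s.
    rewrite /= in_itv /= => /andP[s0 s0'].
    rewrite (_ : s = 0); last by apply/eqP; rewrite eq_le s0 s0'.
    by rewrite ger0_norm// mulr_ge0// expR_ge0.
  by rewrite len_itv// subrr mulr0 mulr_ge0 ?expR_ge0// divr_ge0// ltW.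
rewrite -integral_on_Rintegral//; last by move=> s _; rewrite mulr_ge0// expR_ge0.
pose F s := c / l * expR (l * s).
have dF (s : R) : is_derive s 1 F (c * expR (l * s)).
  rewrite /F; apply: is_derive_eq.
  by rewrite /GRing.scale /= mulr1; field; rewrite gt_eqF.
rewrite /Rintegral (@continuous_FTC2 _ (fun s => c * expR (l * s)) F 0 t)//.
- by rewrite -EFinB /= /F gerBl// mulr_ge0 ?expR_ge0// divr_ge0// ltW.
- exact/uniform_within_continuous/expR_uniform.
- have cF : continuous F.
    move=> s; apply: differentiable_continuous; apply/derivable1_diffP.
    by have [] := dF s.
  split.
  + by move=> s _; have [] := dF s.
  + exact/cvg_at_right_filter/cF.
  + exact/cvg_at_left_filter/cF.
- by move=> s _; rewrite derive1E; apply: derive_val.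
Qed.

Lemma integral_on_expR_bound (X : completeNormedModType R) (t c l : R) (h : R -> X) :
  0 <= t -> 0 < l -> 0 <= c -> bounded_measurable `[0, t] h ->
  ae_on `[0, t] (fun s => `|h s| <= c * expR (l * s)) ->
  `|integral_on `[0, t] h| <= c / l * expR (l * t).
Proof.
move=> t0 l0 c0 bh hc; apply: le_trans (integral_expR t0 l0 c0).
apply: integral_on_norm_le => //; first exact: finite_measurable_itv.
exact: (uniform_bounded_measurable t0 (expR_uniform t c l)).
Qed.

End UniformContinuity.

(** * Local bounds and strong continuity of semigroups *)

Section Semigroup.
Variables (R : realType) (X : completeNormedModType R) (S : R -> {linear X -> X}).
Hypothesis hS : C0_semigroup S.

Lemma semigroup_linear_bound (t : R) : 0 <= t ->
  exists2 r : R, 0 <= r & forall x, `|S t x| <= r * `|x|.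
Proof.
move=> t0; have [cS _ _ _] := hS.
have /linear_bounded_continuous/linear_boundedP[M [Mr H]] := cS t t0.
exists (`|M| + 1); first by rewrite addr_ge0.
by move=> x; apply: H; rewrite (le_lt_trans (ler_norm _))// ltrDl.
Qed.

(** Otherwise there are times [t n <= 1 / (n + 1)] at which the norm of [S (t n)] exceeds [n + 1].
    Strong continuity at zero makes this family pointwise bounded, which contradicts the uniform
    boundedness principle. *)
Lemma semigroup_bound_near0 : exists d K : R, [/\ 0 < d, 1 <= K &
  forall t x, 0 <= t <= d -> `|S t x| <= K * `|x|].
Proof.
have [cS S0 _ Sc] := hS.
apply: contrapT => H.
have /choice[t tP] (n : nat) : exists t : R,
    0 <= t <= n.+1%:R^-1 /\ exists x, n.+1%:R * `|x| < `|S t x|.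
  apply: contrapT => /forallNP Hn; apply: H; exists n.+1%:R^-1, n.+1%:R.
  split; rewrite ?invr_gt0 ?ler1n// => t x tn.
  rewrite leNgt; apply/negP => lt; apply: (Hn t); split => //.
  by exists x.
have t0 n : 0 <= t n by have [/andP[]] := tP n.
pose F : set (X -> X) := [set f : X -> X | exists n, f = (S (t n) : X -> X)].
have Fb f : F f -> bounded_fun_norm f /\ linear f.
  move=> [n ->]; split; last by move=> a u v; rewrite linearP.
  move=> r; have [k k0 kP] := semigroup_linear_bound (t0 n).
  by exists (k * r) => x xr; rewrite (le_trans (kP x))// ler_wpM2l.
have pF : pointwise_bounded F.
  move=> x; have /cvgrPdist_le/(_ 1 ltr01) := Sc x.
  move=> /nbhs_ballP[e /= e0 He].
  have [N _ HN] := near_infty_natSinv_lt (PosNum e0).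
  (* The sum bounds the first [N] terms; the later ones are within distance one of [x]. *)
  exists (\sum_(n < N) `|S (t n) x| + (`|x| + 1)) => _ [n ->].
  have [nN|Nn] := ltnP n N.
    by rewrite (bigD1 (Ordinal nN))//= -addrA lerDl !addr_ge0// sumr_ge0.
  rewrite (@le_trans _ _ (`|x| + 1))//; last by rewrite lerDr sumr_ge0.
  have [/andP[tn0 tn] _] := tP n.
  move: tn0; rewrite le_eqVlt => /orP[/eqP <-|tn0]; first by rewrite S0 lerDl.
  rewrite -[S _ x](subrK x) (le_trans (ler_normD _ _))// addrC lerD//.
  rewrite distrC; apply: He => //; rewrite -ball_normE /= sub0r normrN ger0_norm//.
  by rewrite (le_lt_trans tn)//; exact: HN.
have [M HM] := Banach_Steinhauss Fb pF 1.
have {}HM n x : `|S (t n) x| <= M * `|x|.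
  have [->|x0] := eqVneq x 0; first by rewrite linear0 normr0 mulr0.
  have nx0 : 0 < `|x| by rewrite normr_gt0.
  have := HM _ (ex_intro _ n erefl) (`|x|^-1 *: x).
  rewrite normrZ ger0_norm ?invr_ge0// mulVf ?gt_eqF// => /(_ (lexx _)).
  by rewrite linearZ normrZ ger0_norm ?invr_ge0// mulrC ler_pdivrMr.
have [n nM] : exists n : nat, M <= n.+1%:R.
  exists (Num.truncn `|M|); rewrite (le_trans (ler_norm _))// ltW//.
  by have /andP[] := truncn_itv (normr_ge0 M).
have [_ [x]] := tP n; rewrite ltNge => /negP; apply.
by rewrite (le_trans (HM n x))// ler_wpM2r.
Qed.

(** Powers of the bound near zero, through the semigroup law: times up to [n * d] cost at most
    [n + 1] factors. *)
Lemma semigroup_bound (T : R) : exists2 K : R, 1 <= K &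
  forall t x, 0 <= t <= T -> `|S t x| <= K * `|x|.
Proof.
have [_ _ SD _] := hS.
have [d [K [d0 K1 dK]]] := semigroup_bound_near0.
have Hn n : forall t x, 0 <= t <= n%:R * d -> `|S t x| <= K ^+ n.+1 * `|x|.
  elim: n => [|n ih] t x.
    rewrite mul0r expr1 => /andP[t0 t0']; apply: dK.
    by rewrite t0 (le_trans t0')// ltW.
  move=> /andP[t0 tn]; have [td|td] := leP t d.
    apply: (le_trans (dK _ _ _)); first by rewrite t0.
    by rewrite ler_wpM2r// exprS ler_peMr ?exprn_ege1// (le_trans ler01).
  have td0 : 0 <= t - d by rewrite subr_ge0 ltW.
  rewrite -(subrK d t) addrC SD ?(ltW d0)//.
  rewrite (le_trans (dK _ _ _))//; first by rewrite (ltW d0) lexx.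
  rewrite exprS -mulrA ler_wpM2l ?(le_trans ler01)// ih// td0/=.
  by rewrite lerBlDr -[X in _ + X]mul1r -mulrDl natr1.
exists (K ^+ (Num.truncn (`|T| / d)).+2); first exact: exprn_ege1.
move=> t x /andP[t0 tT]; apply: Hn; rewrite t0/= (le_trans tT)//.
rewrite (le_trans (ler_norm _))// -ler_pdivrMr// ltW//.
by have /andP[] := truncn_itv (divr_ge0 (normr_ge0 T) (ltW d0)).
Qed.

Lemma semigroup_near0 (x : X) (e : R) : 0 < e ->
  exists2 d : R, 0 < d & forall t, 0 <= t <= d -> `|S t x - x| <= e.
Proof.
move=> e0; have [_ S0 _ Sc] := hS.
have /cvgrPdist_le/(_ e e0)/nbhs_ballP[d /= d0 Hd] := Sc x.
exists (d / 2); first by rewrite divr_gt0.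
move=> t /andP[t0 td]; move: t0; rewrite le_eqVlt => /orP[/eqP <-|t0].
  by rewrite S0 subrr normr0 ltW.
rewrite distrC; apply: Hd => //; rewrite -ball_normE /= sub0r normrN ger0_norm ?ltW//.
by rewrite (le_lt_trans td)// ltr_pdivrMr// ltr_pMr// ltr1n.
Qed.

Lemma semigroup_uniform (T : R) (x : X) : uniformly_continuous_on T (fun t => S t x).
Proof.
have [_ _ SD _] := hS.
move=> e e0; have [K K1 KP] := semigroup_bound T.
have K0 : 0 < K by rewrite (lt_le_trans ltr01).
have [d d0 Hd] := semigroup_near0 x (divr_gt0 e0 K0).
exists d => //.
have W s t : 0 <= s -> s <= t -> t <= T -> t - s <= d -> `|S s x - S t x| <= e.
  move=> s0 st tT tsd; have ts0 : 0 <= t - s by rewrite subr_ge0.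
  have -> : S t x = S s (S (t - s) x) by rewrite -SD// addrC subrK.
  rewrite distrC -linearB.
  rewrite (le_trans (KP _ _ _)) ?s0 ?(le_trans st)//.
  by rewrite mulrC -ler_pdivlMr// Hd// ts0.
move=> s t /andP[s0 sT] /andP[t0 tT]; have [st|ts] := leP s t.
  by rewrite distrC ger0_norm ?subr_ge0// => ?; exact: W.
have st0 : 0 <= s - t by rewrite subr_ge0 ltW.
by rewrite (ger0_norm st0) => std; rewrite distrC; apply: W => //; exact: ltW.
Qed.

Lemma orbit_uniform (t : R) (x : X) : uniformly_continuous_on t (fun s => S (t - s) x).
Proof.
move=> e e0; have [d d0 Hd] := semigroup_uniform t x e0.
exists d => // r s rt st rs; apply: Hd; try lra.
by rewrite opprB addrC addrA subrK distrC.
Qed.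

(** A superposition: [S (t - s) x] is measurable in [s] by strong continuity, and Lipschitz in [x]
    with constant [K]. *)
Lemma convolution_bounded_by (T t B K : R) (h : R -> X) : 0 <= t <= T ->
  0 <= K -> (forall t x, 0 <= t <= T -> `|S t x| <= K * `|x|) ->
  bounded_by `[0, t] B h -> bounded_by `[0, t] (K * B) (fun s => S (t - s) (h s)).
Proof.
move=> /andP[t0 tT] K0 KP bh; have B0 := bounded_by_ge0 bh.
have tsT s : 0 <= s <= t -> 0 <= t - s <= T by lra.
apply: (@bounded_by_caratheodory _ _ _ _ B _ K (fun s x => S (t - s) x)) => //.
- move=> y yB; apply: uniform_bounded_by => //; first exact: orbit_uniform.
  by move=> s st; rewrite (le_trans (KP _ _ (tsT _ st)))// ler_wpM2l.
apply: ae_onT => s; rewrite /= in_itv /= => st x y.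
by rewrite -linearB KP// tsT.
Qed.

End Semigroup.

(** * Sequences with dyadic increments *)

Section Dyadic.
Variable R : realType.

Lemma dyadicS n : dyadic R n.+1 = dyadic R n / 2.
Proof.
rewrite /dyadic expnS natrM; field.
by rewrite pnatr_eq0 -lt0n expn_gt0.
Qed.

Lemma dyadic_small_mul (C e : R) : 0 < e ->
  exists n, forall k, (n <= k)%N -> dyadic R k * C <= e.
Proof.
move=> e0; have C1 : 0 < `|C| + 1 by rewrite ltr_wpDl.
have [n Hn] := dyadic_small (divr_gt0 e0 C1).
exists n => k nk; apply: (@le_trans _ _ (dyadic R k * (`|C| + 1))).
  by rewrite ler_pM2l ?dyadic_gt0// (le_trans (ler_norm _))// lerDl.
by rewrite -ler_pdivlMr// Hn.
Qed.

Lemma dyadic_cauchy (V : normedModType R) (u : nat -> V) (C : R) n k :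
  (forall j, (n <= j)%N -> `|u j.+1 - u j| <= dyadic R j * C) ->
  `|u (n + k)%N - u n| <= 2 * (dyadic R n - dyadic R (n + k)) * C.
Proof.
move=> uC; elim: k => [|k ih]; first by rewrite addn0 !subrr normr0 mulr0 mul0r.
rewrite addnS -(subrKA (u (n + k)%N)) (le_trans (ler_normD _ _))//.
apply: le_trans (lerD (uC _ (leq_addr _ _)) ih) _; rewrite dyadicS.
by rewrite le_eqVlt; apply/orP; left; apply/eqP; field.
Qed.

Lemma dyadic_limit (V : completeNormedModType R) (u : nat -> V) (C : R) n :
  (forall j, (n <= j)%N -> `|u j.+1 - u j| <= dyadic R j * C) ->
  forall j, (n <= j)%N -> `|u j - limn u| <= dyadic R j * (2 * C).
Proof.
move=> uC.
have C0 : 0 <= C.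
  by have := le_trans (normr_ge0 _) (uC n (leqnn n)); rewrite pmulr_rge0 ?dyadic_gt0.
have uH j k : (n <= j)%N -> `|u (j + k)%N - u j| <= dyadic R j * (2 * C).
  move=> nj; apply: le_trans (dyadic_cauchy _ (fun i ji => uC i (leq_trans nj ji))) _.
  rewrite mulrA [dyadic R j * 2]mulrC ler_wpM2r// ler_wpM2l//.
  by rewrite gerBl ltW// dyadic_gt0.
have cu : cvgn u.
  apply/cauchy_cvgP/cauchy_ballP => e e0; rewrite !near_simpl.
  have e4 : 0 < e / 4 by rewrite divr_gt0.
  have [M HM] := dyadic_small_mul (2 * C) e4.
  pose N := maxn n M.
  exists ([set n | (N <= n)%N], [set n | (N <= n)%N]); first by split; exists N.
  move=> [i k] /= [Ni Nk]; rewrite -ball_normE /=.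
  have := uH N (i - N)%N (leq_maxl _ _); have := uH N (k - N)%N (leq_maxl _ _).
  rewrite !subnKC// => Hk Hi; have HNN := HM N (leq_maxr _ _).
  rewrite -(subrKA (u N)) (le_lt_trans (ler_normD _ _))// [X in _ + X]distrC.
  have := le_trans Hk HNN; have := le_trans Hi HNN; lra.
move=> j nj; apply/ler_addgt0Pr => e e0.
move/cvgrPdist_le : cu => /(_ e e0)[N _ HN].
have := HN (j + N)%N (leq_addl _ _); have := uH j N nj => H1 H2.
rewrite -(subrKA (u (j + N)%N)) (le_trans (ler_normD _ _))// lerD//.
  by rewrite distrC.
by rewrite distrC.
Qed.

End Dyadic.

(** * Mild solutions *)

Section MildSolutions.
Variables (R : realType) (X : completeNormedModType R) (S : R -> {linear X -> X}).
Hypothesis hS : C0_semigroup S.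
Variables (T : R) (x0 : X) (K : R).
Hypothesis T0 : 0 <= T.
Hypothesis K1 : 1 <= K.
Hypothesis KP : forall t x, 0 <= t <= T -> `|S t x| <= K * `|x|.
Local Notation mu := (@lebesgue_measure R).
Local Notation len D := (fine (mu D)).

Let K0 : 0 <= K. Proof. exact: le_trans K1. Qed.

(** Common format for [f], the [g j] and the controlled right-hand side. Measurability in time is
    asked at fixed points; superposition provides it along curves. *)
Definition lipschitz_field (V : normedModType R) (M : R) (F : R -> X -> V) : Prop :=
  [/\ 0 <= M, forall y, bounded_measurable `[0, T] (F^~ y) &
      ae_on `[0, T] (fun s => (forall x y, `|F s x - F s y| <= M * `|x - y|) /\
                              `|F s 0| <= M)].

Lemma itv_sub (t t' : R) : t <= t' -> `[0, t]%classic `<=` `[0, t'].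
Proof.
move=> tt' s; rewrite /= !in_itv /= => /andP[-> st] /=.
exact: le_trans tt'.
Qed.

Lemma field_bounded_by (V : normedModType R) (M B : R) (F : R -> X -> V) (x : R -> X) :
  lipschitz_field M F -> bounded_by `[0, T] B x ->
  bounded_by `[0, T] (M * (1 + B) + 1) (fun s => F s (x s)).
Proof.
move=> [M0 bF aF] bx; have B0 := bounded_by_ge0 bx.
apply: (@bounded_by_caratheodory _ _ _ _ B _ M F) => //; last first.
  by apply: ae_onW aF => // t _ [].
move=> y yB; apply: bounded_by_improve => //.
  by rewrite mulr_ge0// addr_ge0.
apply: ae_onW aF => // t _ [FL F0].
rewrite -[F t y](subrK (F t 0)) (le_trans (ler_normD _ _))// addrC mulrDr mulr1.
by rewrite lerD// (le_trans (FL _ _))// subr0 ler_wpM2l.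
Qed.

Lemma convolution_measurable (t : R) (g : R -> X) : 0 <= t <= T ->
  bounded_measurable `[0, t] g ->
  bounded_measurable `[0, t] (fun s => S (t - s) (g s)).
Proof.
by move=> tT [B bg]; exists (K * B); exact: convolution_bounded_by tT K0 KP bg.
Qed.

Lemma integral_on_split (s t : R) (h : R -> X) : 0 <= s <= t ->
  bounded_measurable `[0, t] h ->
  integral_on `[0, t] h = integral_on `[0, s] h + integral_on `]s, t] h.
Proof.
move=> /andP[s0 st] bh.
have E : `[0, t]%classic = `[0, s]%classic `|` `]s, t]%classic.
  apply/seteqP; split => r /=; rewrite !in_itv /=.
    by move=> /andP[-> ->]; case: (leP r s); [left|right].
  move=> [/andP[-> /le_trans]|/andP[/ltW sr ->]]; first exact.
  by rewrite (le_trans s0).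
rewrite E integral_on_setU//; last by rewrite -E.
- exact: finite_measurable_itv.
- exact: finite_measurable_itvoc.
- apply/seteqP; split => r //= []; rewrite !in_itv /= => /andP[_ rs] /andP[sr _].
  by move: rs; rewrite leNgt sr.
Qed.

Lemma len_itvoc (a b : R) : a <= b -> len `]a, b] = b - a.
Proof.
rewrite lebesgue_measure_itv /= lte_fin le_eqVlt => /orP[/eqP ->|->//].
by rewrite ltxx /= subrr.
Qed.

Lemma semigroup_near0_seq (r : seq X) (e : R) : 0 < e ->
  exists2 d : R, 0 < d & forall v, v \in r -> forall t, 0 <= t <= d -> `|S t v - v| <= e.
Proof.
move=> e0; elim: r => [|v r [d d0 Hd]]; first by exists 1.
have [d' d'0 Hd'] := semigroup_near0 hS v e0.
exists (Num.min d d'); first by rewrite lt_min d0.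
move=> w; rewrite inE => /orP[/eqP -> |wr] t /andP[t0]; rewrite le_min => /andP[td td'].
  by apply: Hd'; rewrite t0.
by apply: Hd => //; rewrite t0.
Qed.

(** For [s <= t] the difference consists of the integral over []s, t]], bounded by its length, and
    of the change of kernel on [[0, s]]. For the latter [g] is replaced by a simple function: it has
    finitely many values, on which strong continuity is uniform. *)
Lemma convolution_uniform (B : R) (g : R -> X) : bounded_by `[0, T] B g ->
  uniformly_continuous_on T
    (fun t => integral_on `[0, t] (fun s => S (t - s) (g s))).
Proof.
move=> bg e e0; have B0 := bounded_by_ge0 bg.
(* Off [E] the difference of the integrands is at most [3 * K * n]; on [E], of measure at most [n],
   it is at most [2 * K * B]. Together this costs at most [e / 2]. *)
pose n := e / 2 / (3 * K * T + 2 * K * B + 1).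
have C0 : 0 < 3 * K * T + 2 * K * B + 1.
  by rewrite ltr_wpDl// addr_ge0// !mulr_ge0.
have n0 : 0 < n by rewrite !divr_gt0.
have [q [sq qB [E [mE En gq]]]] := bg n n0.
have [r ur qr] := simple_function_range sq.
have [d d0 Hd] := semigroup_near0_seq r n0.
have KB1 : 0 < K * B + 1 by rewrite ltr_wpDl// mulr_ge0.
pose d' := Num.min d (e / 2 / (K * B + 1)).
have d'0 : 0 < d' by rewrite lt_min d0 !divr_gt0.
suff W s t : 0 <= s -> s <= t -> t <= T -> t - s <= d' ->
    `|integral_on `[0, t] (fun r => S (t - r) (g r)) -
      integral_on `[0, s] (fun r => S (s - r) (g r))| <= e.
  exists d' => // s t /andP[s0 sT] /andP[t0 tT]; have [st|ts] := leP s t.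
    by rewrite distrC ger0_norm ?subr_ge0// => ?; rewrite distrC; exact: W.
  have st0 : 0 <= s - t by rewrite subr_ge0 ltW.
  by rewrite (ger0_norm st0) => std; apply: W => //; exact: ltW.
move=> s0 st tT; rewrite le_min => /andP[tsd tsd'].
have bgt : bounded_by `[0, t] B g by apply: bounded_byW bg => //; exact: itv_sub.
have bgs : bounded_by `[0, s] B g by apply: bounded_byW bgt => //; exact: itv_sub.
have t0 : 0 <= t by rewrite (le_trans s0).
have b1 : bounded_by `[0, t] (K * B) (fun r => S (t - r) (g r)).
  by apply: convolution_bounded_by K0 KP bgt; rewrite ?t0.
have b2 : bounded_by `[0, s] (K * B) (fun r => S (s - r) (g r)).
  by apply: convolution_bounded_by K0 KP bgs; rewrite ?s0 ?(le_trans st).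
rewrite (@integral_on_split s t) ?s0//; last by exists (K * B).
rewrite addrAC (le_trans (ler_normD _ _))// [leRHS]splitr lerD//; last first.
  have b3 : bounded_by `]s, t] (K * B) (fun r => S (t - r) (g r)).
    apply: bounded_byW b1 => // r'; rewrite /= !in_itv /= => /andP[/ltW sr ->].
    by rewrite (le_trans s0).
  apply: (@le_trans _ _ (K * B * len `]s, t])).
    apply: integral_on_norm_bound; [|by exists (K * B)|exact: bounded_by_ae].
    exact: finite_measurable_itvoc.
  rewrite len_itvoc//; move: tsd'; rewrite ler_pdivlMr// mulrC; apply: le_trans.
  by rewrite ler_wpM2r ?subr_ge0// lerDl.
have fs := finite_measurable_itv 0 s.
have b1s : bounded_by `[0, s] (K * B) (fun r => S (t - r) (g r)).
  by apply: bounded_byW b1 => //; exact: itv_sub.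
apply: le_trans (@integral_on_dist R X `[0, s] fs (K * B) (K * B) (3 * K * n) n E _ _
  b1s b2 _ mE En _) _.
- by rewrite mulr_ge0 ?(ltW n0)// mulr_ge0.
- move=> p; rewrite /= in_itv /= => /andP[p0 ps] nE.
  have pT : `[0, T]%classic p by rewrite /= in_itv /= p0 (le_trans ps)// (le_trans st).
  have tpT : 0 <= t - p <= T by lra.
  have spT : 0 <= s - p <= T by lra.
  have H : `|S (t - p) (q p) - S (s - p) (q p)| <= K * n.
    have [_ _ SD _] := hS.
    have -> : S (t - p) (q p) = S (s - p) (S (t - s) (q p)).
      rewrite -SD ?subr_ge0//; congr (S _ _); ring.
    rewrite -linearB (le_trans (KP _ spT))// ler_wpM2l// Hd ?subr_ge0 ?st//.
    by apply: qr; exists p.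
  have gqp := gq p pT nE.
  rewrite -(subrKA (S (t - p) (q p))) (le_trans (ler_normD _ _))//.
  rewrite -(subrKA (S (s - p) (q p)) (S (t - p) (q p))).
  rewrite (_ : 3 * K * n = K * n + (K * n + K * n)); last by ring.
  rewrite lerD//.
    by rewrite -linearB (le_trans (KP _ tpT))// ler_wpM2l.
  rewrite (le_trans (ler_normD _ _))// lerD//.
  by rewrite -linearB (le_trans (KP _ spT))// ler_wpM2l// distrC.
rewrite len_itv// subr0.
apply: (@le_trans _ _ (n * (3 * K * T + 2 * K * B + 1))).
  have : K * n * s <= K * n * T.
    have sT : s <= T by exact: le_trans tT.
    by have Kn0 := mulr_ge0 K0 (ltW n0); rewrite ler_wpM2l.
  by nra.
by rewrite /n divfK// gt_eqF.
Qed.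

Definition picard (F : R -> X -> X) (x : R -> X) (t : R) : X :=
  S t x0 + integral_on `[0, t] (fun s => S (t - s) (F s (x s))).

Lemma uniformly_continuousD (x y : R -> X) : uniformly_continuous_on T x ->
  uniformly_continuous_on T y -> uniformly_continuous_on T (fun t => x t + y t).
Proof.
move=> ux uy e e0; have e2 : 0 < e / 2 by rewrite divr_gt0.
have [d d0 Hd] := ux _ e2; have [d' d'0 Hd'] := uy _ e2.
exists (Num.min d d'); first by rewrite lt_min d0.
move=> s t sT tT; rewrite le_min => /andP[sd sd'].
rewrite opprD addrACA (le_trans (ler_normD _ _))// [leRHS]splitr lerD//.
  exact: Hd.
exact: Hd'.
Qed.

Lemma picard_uniform (M : R) (F : R -> X -> X) (x : R -> X) :
  lipschitz_field M F -> bounded_measurable `[0, T] x ->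
  uniformly_continuous_on T (picard F x).
Proof.
move=> LF [B bx]; apply: uniformly_continuousD; first exact: semigroup_uniform.
exact: convolution_uniform (field_bounded_by LF bx).
Qed.

Lemma integrand_measurable (M t : R) (F : R -> X -> X) (x : R -> X) :
  lipschitz_field M F -> bounded_measurable `[0, T] x -> 0 <= t <= T ->
  bounded_measurable `[0, t] (fun s => S (t - s) (F s (x s))).
Proof.
move=> LF [B bx] /andP[t0 tT]; apply: convolution_measurable; first by rewrite t0.
exists (M * (1 + B) + 1).
by apply: bounded_byW (field_bounded_by LF bx) => //; exact: itv_sub.
Qed.

(* The weight [expR (l * t)] makes the Picard map a contraction with factor 1/2
   on all of [0, T]. *)
Lemma picard_contraction (M c : R) (F : R -> X -> X) (x y : R -> X) :
  let l := 2 * K * M + 1 in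
  lipschitz_field M F -> bounded_measurable `[0, T] x -> bounded_measurable `[0, T] y ->
  0 <= c -> (forall t, 0 <= t <= T -> `|x t - y t| <= c * expR (l * t)) ->
  forall t, 0 <= t <= T -> `|picard F x t - picard F y t| <= c / 2 * expR (l * t).
Proof.
move=> l LF bx byy c0 xy t /andP[t0 tT].
have [M0 _ aF] := LF.
have KM0 : 0 <= K * M by rewrite mulr_ge0.
have l0 : 0 < l by rewrite /l ltr_wpDl// -mulrA mulr_ge0.
have tT' : 0 <= t <= T by rewrite t0.
have b1 := integrand_measurable LF bx tT'; have b2 := integrand_measurable LF byy tT'.
rewrite /picard opprD addrACA subrr add0r -integral_onB//; last exact: finite_measurable_itv.
have KMc0 : 0 <= K * M * c by rewrite mulr_ge0.
apply: (le_trans (integral_on_expR_bound t0 l0 KMc0 _ _)).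
- exact: bounded_measurableB.
- apply: ae_onW aF; first exact: itv_sub.
  move=> s; rewrite /= in_itv /= => /andP[s0 st] [FL _].
  have tsT : 0 <= t - s <= T by lra.
  have sT : 0 <= s <= T by lra.
  rewrite -linearB (le_trans (KP _ tsT))// -!mulrA ler_wpM2l//.
  by rewrite (le_trans (FL _ _))// ler_wpM2l// xy.
(* Integrating the exponential gains a factor [1 / l], and [l] is at least [2 * K * M]; the [+ 1]
   keeps [l] positive. *)
rewrite ler_wpM2r ?expR_ge0// ler_pdivrMr// /l.
nra.
Qed.

(** Picard iterates from zero. In the weighted norm their increments halve, so they converge
    uniformly on [[0, T]]; the limit is taken pointwise and inherits uniform continuity. *)
Lemma picard_fixpoint (M : R) (F : R -> X -> X) : lipschitz_field M F ->
  exists2 x, uniformly_continuous_on T x & forall t, 0 <= t <= T -> x t = picard F x t.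
Proof.
move=> LF; pose l := 2 * K * M + 1.
have [M0 _ aF] := LF.
have l0 : 0 < l by rewrite /l ltr_wpDl// !mulr_ge0.
pose u n := iter n (picard F) (fun=> 0).
have bu n : bounded_measurable `[0, T] (u n).
  elim: n => [|n ih]; first exact: bounded_measurable_cst.
  exact/uniform_bounded_measurable/(picard_uniform LF).
have [c c0 Hc] := uniform_bounded_on T0 (picard_uniform LF (bu 0%N)).
have e1 t : 0 <= t -> 1 <= expR (l * t).
  by move=> t0; rewrite -expR0 ler_expR mulr_ge0 ?(ltW l0).
(* The factor is [2 * c] because [dyadic R 0] is one half. *)
have H n : forall t, 0 <= t <= T ->
    `|u n.+1 t - u n t| <= dyadic R n * (2 * c) * expR (l * t).
  elim: n => [|n ih] t tT.
    have /andP[t0 _] := tT.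
    have -> : dyadic R 0 * (2 * c) = c by rewrite /dyadic expn1; field.
    by rewrite /u /= subr0 (le_trans (Hc t tT))// ler_peMr// e1.
  have d0 : 0 <= dyadic R n * (2 * c) by rewrite !mulr_ge0// ltW// dyadic_gt0.
  have := picard_contraction LF (bu n.+1) (bu n) d0 ih tT.
  rewrite (_ : dyadic R n * (2 * c) / 2 = dyadic R n.+1 * (2 * c))//.
  by rewrite dyadicS; field.
pose C := 2 * c * expR (l * T).
have HC n t : 0 <= t <= T -> `|u n.+1 t - u n t| <= dyadic R n * C.
  move=> tT; apply: le_trans (H n t tT) _; rewrite /C [leRHS]mulrA.
  rewrite ler_wpM2l ?mulr_ge0// ?(ltW (dyadic_gt0 _ _))//.
  by rewrite ler_expR ler_pM2l//; case/andP: tT.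
have /choice[x xP] (t : R) : exists y : X, 0 <= t <= T ->
    forall n, `|u n t - y| <= dyadic R n * (2 * C).
  have [tT|] := pselect (0 <= t <= T); last by exists 0.
  exists (limn (fun n => u n t)) => _ n.
  exact: (@dyadic_limit R X (fun n => u n t) C 0 (fun n _ => HC n t tT)).
have C0 : 0 <= C by rewrite /C !mulr_ge0// expR_ge0.
have uu n : uniformly_continuous_on T (u n.+1) by exact: picard_uniform LF (bu n).
have ux : uniformly_continuous_on T x.
  move=> e e0; have e3 : 0 < e / 3 by rewrite divr_gt0.
  have [n Hn] := dyadic_small_mul (2 * C) e3.
  have [d d0 Hd] := uu n _ e3.
  exists d => // s t sT tT st.
  have H1 := le_trans (xP s sT n.+1) (Hn _ (leqnSn n)).
  have H2 := le_trans (xP t tT n.+1) (Hn _ (leqnSn n)).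
  have H3 := Hd s t sT tT st.
  rewrite -(subrKA (u n.+1 s)) (le_trans (ler_normD _ _))// distrC.
  rewrite -(subrKA (u n.+1 t) (u n.+1 s) (- x t)).
  rewrite (_ : e = e / 3 + (e / 3 + e / 3)); last by field.
  by rewrite lerD// (le_trans (ler_normD _ _))// lerD.
exists x => // t tT.
have bx := uniform_bounded_measurable T0 ux.
apply: (@norm_eps0 _ _ _ _ 1) => e e0 _; rewrite mulr1.
have e2 : 0 < e / 2 by rewrite divr_gt0.
have [n Hn] := dyadic_small_mul (2 * C) e2.
have [m Hm] := dyadic_small_mul (2 * C * expR (l * t)) e2.
pose k := maxn n m.
have H1 := le_trans (xP t tT k.+1) (Hn _ (leq_trans (leq_maxl n m) (leqnSn _))).
have d0 : 0 <= dyadic R k * (2 * C) by rewrite !mulr_ge0// ltW// dyadic_gt0.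
have H2 s : 0 <= s <= T -> `|u k s - x s| <= dyadic R k * (2 * C) * expR (l * s).
  move=> sT; rewrite (le_trans (xP s sT k))// ler_peMr// e1//.
  by case/andP: sT.
have H3 := picard_contraction LF (bu k) bx d0 H2 tT.
rewrite -(subrKA (u k.+1 t)) (le_trans (ler_normD _ _))// [leRHS]splitr lerD//.
  by rewrite distrC.
apply: le_trans H3 _; apply: le_trans (Hm k (leq_maxr _ _)).
rewrite [leRHS]mulrA ler_wpM2r ?expR_ge0// ler_pdivrMr// ler_peMr//.
by rewrite ler1n.
Qed.

(** Existence and uniqueness of Bochner integrals turn the relational definition into a fixed point
    equation for [picard]. *)
Lemma mild_solutionP (m : nat) (M : R) (f : R -> X -> X)
    (G : R -> X -> {linear 'rV[R]_m -> X}) (u : R -> 'rV[R]_m) (x : R -> X) :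
  let F := fun s y => f s y + G s y (u s) in lipschitz_field M F ->
  mild_solution T S f G x0 u x <->
  uniformly_continuous_on T x /\ forall t, 0 <= t <= T -> x t = picard F x t.
Proof.
move=> F LF; split => [[/within_continuous_uniform ux H]|[ux H]].
  split => // t tT; have bx := uniform_bounded_measurable T0 ux.
  have [|v hv ->] := H t; first by rewrite in_itv.
  rewrite /picard; congr (_ + _).
  exact: is_bochner_integral_uniq (integrand_measurable LF bx tT) hv.
split; first exact: uniform_within_continuous.
move=> t; rewrite in_itv /= => tT; have bx := uniform_bounded_measurable T0 ux.
exists (integral_on `[0, t] (fun s => S (t - s) (F s (x s)))).
  exact: is_bochner_integral_on (integrand_measurable LF bx tT).
exact: H.
Qed.

End MildSolutions.

(** * Weak compactness of the set of controls *)

Section Edot.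
Variables (R : realType) (m : nat).
Implicit Types x y z : 'rV[R]_m.

Lemma norm_coord x i : `|x 0 i| <= `|x|.
Proof.
rewrite [leRHS]/Num.norm /= mx_normrE; apply/bigmax_geP; right => /=.
by exists (0, i).
Qed.

Lemma norm_coord_le x (d : R) : 0 <= d -> (forall i, `|x 0 i| <= d) -> `|x| <= d.
Proof.
move=> d0 H; rewrite [leLHS]/Num.norm /= mx_normrE; apply/bigmax_leP.
by split => // -[i j] _ /=; rewrite ord1.
Qed.

Lemma edotC x y : edot x y = edot y x.
Proof. by apply: eq_bigr => i _; rewrite mulrC. Qed.

Lemma edot_lincomb (a b : R) x y z :
  edot (a *: x + b *: y) z = a * edot x z + b * edot y z.
Proof.
rewrite /edot !mulr_sumr -big_split /=; apply: eq_bigr => i _.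
by rewrite !mxE mulrDl !mulrA.
Qed.

Lemma edotBl x y z : edot (x - y) z = edot x z - edot y z.
Proof. by rewrite -{1}(scale1r x) -scaleN1r edot_lincomb mul1r mulN1r. Qed.

Lemma edot_ge0 x : 0 <= edot x x.
Proof. by apply: sumr_ge0 => i _; rewrite -expr2 sqr_ge0. Qed.

Lemma edot_norm x y : `|edot x y| <= m%:R * (`|x| * `|y|).
Proof.
rewrite (le_trans (ler_norm_sum _ _ _))// mulr_natl.
rewrite -[X in _ *+ X](card_ord m) -sumr_const ler_sum// => i _.
by rewrite normrM ler_pM// norm_coord.
Qed.

Lemma edot_dist x x' y y' : `|edot x y - edot x' y'| <=
  m%:R * (`|x - x'| * `|y| + `|x'| * `|y - y'|).
Proof.
have -> : edot x y - edot x' y' = edot (x - x') y + edot x' (y - y').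
  by rewrite edotBl [edot x' (y - y')]edotC edotBl ![edot _ x']edotC subrKA.
by rewrite (le_trans (ler_normD _ _))// mulrDr lerD// edot_norm.
Qed.

Lemma norm_edot x (d : R) : 0 <= d -> edot x x <= d ^+ 2 -> `|x| <= d.
Proof.
move=> d0 H; apply: norm_coord_le => // i.
rewrite -[leRHS]ger0_norm// -ler_sqr ?nnegrE// !real_normK ?num_real//.
apply: le_trans H; rewrite /edot (bigD1 i)//= expr2 lerDl sumr_ge0// => j _.
by rewrite -expr2 sqr_ge0.
Qed.

Lemma enorm_sqr x : enorm x ^+ 2 = edot x x.
Proof. by rewrite /enorm sqr_sqrtr// edot_ge0. Qed.

Lemma edot_young x y (n : R) : 0 < n ->
  edot x y <= (2 * n)^-1 * edot x x + n / 2 * edot y y.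
Proof.
move=> n0; rewrite /edot !mulr_sumr -big_split ler_sum//= => i _.
rewrite -subr_ge0.
have -> : (2 * n)^-1 * (x 0 i * x 0 i) + n / 2 * (y 0 i * y 0 i) - x 0 i * y 0 i =
    (2 * n)^-1 * (x 0 i - n * y 0 i) ^+ 2 by field; rewrite gt_eqF.
by rewrite mulr_ge0 ?sqr_ge0// invr_ge0 mulr_ge0// ltW.
Qed.

End Edot.

(** * The L2 pairing of controls *)

Section Pairing.
Variables (R : realType) (m : nat).
Local Notation mu := (@lebesgue_measure R).
Local Notation len D := (fine (mu D)).
Local Notation W := (R -> 'rV[R]_m).

Implicit Types u v p : W.

Definition pairing (D : set R) (u p : W) : R := integral_on D (fun t => edot (u t) (p t)).

Lemma bounded_by_edot (D : set R) (B C : R) (u p : W) : bounded_by D B u ->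
  bounded_by D C p -> bounded_by D (m%:R * (B * C)) (fun t => edot (u t) (p t)).
Proof.
by apply: bounded_by_bilinear => //; [exact: edot_norm|exact: edot_dist].
Qed.

Lemma bounded_measurable_edot (D : set R) (u p : W) : bounded_measurable D u ->
  bounded_measurable D p -> bounded_measurable D (fun t => edot (u t) (p t)).
Proof. by move=> [B bu] [C bp]; exists (m%:R * (B * C)); exact: bounded_by_edot. Qed.

Lemma pairingC (D : set R) u p : pairing D u p = pairing D p u.
Proof. by congr integral_on; apply/funext => t; rewrite edotC. Qed.

Lemma pairing_lincomb (D : set R) (a b : R) u v p : finite_measurable D ->
  bounded_measurable D u -> bounded_measurable D v -> bounded_measurable D p ->
  pairing D (fun t => a *: u t + b *: v t) p = a * pairing D u p + b * pairing D v p.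
Proof.
move=> fD bu bv bp; rewrite /pairing.
rewrite (_ : (fun t => edot (a *: u t + b *: v t) (p t)) =
  fun t => a *: edot (u t) (p t) + b *: edot (v t) (p t)); last first.
  by apply/funext => t; rewrite edot_lincomb.
by rewrite integral_on_lincomb ?integral_onZ//;
  [exact: bounded_measurable_edot|exact: bounded_measurable_edot|
   apply: bounded_measurableZ; exact: bounded_measurable_edot].
Qed.

Lemma pairing_ge0 (D : set R) u : finite_measurable D -> bounded_measurable D u ->
  0 <= pairing D u u.
Proof.
move=> fD bu; apply: integral_on_ge0 => //; first exact: bounded_measurable_edot.
by apply: ae_onT => t _; exact: edot_ge0.
Qed.

Definition midpoint (u v : W) : W := fun t => 2^-1 *: u t + 2^-1 *: v t.

Lemma bounded_measurable_lin (D : set R) (a b : R) u v : bounded_measurable D u ->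
  bounded_measurable D v -> bounded_measurable D (fun t => a *: u t + b *: v t).
Proof.
by move=> bu bv; apply: bounded_measurableD; exact: bounded_measurableZ.
Qed.

Lemma parallelogram (D : set R) u v : finite_measurable D ->
  bounded_measurable D u -> bounded_measurable D v ->
  let w := fun t => 1 *: u t + (-1) *: v t in
  pairing D w w = 2 * pairing D u u + 2 * pairing D v v -
    4 * pairing D (midpoint u v) (midpoint u v).
Proof.
move=> fD bu bv w.
have E a b : pairing D (fun t => a *: u t + b *: v t) (fun t => a *: u t + b *: v t) =
    a ^+ 2 * pairing D u u + 2 * a * b * pairing D u v + b ^+ 2 * pairing D v v.
  have bl := bounded_measurable_lin a b bu bv.
  rewrite pairing_lincomb// (pairingC D u) (pairingC D v) !pairing_lincomb//.
  by rewrite (pairingC D v u); ring.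
by rewrite /w /midpoint !E; field.
Qed.

(** Stands in for the Cauchy-Schwarz inequality: with the free weight [n] no square roots of
    energies appear. *)
Lemma pairing_young (D : set R) (n : R) u p : finite_measurable D ->
  bounded_measurable D u -> bounded_measurable D p -> 0 < n ->
  pairing D u p <= (2 * n)^-1 * pairing D u u + n / 2 * pairing D p p.
Proof.
move=> fD bu bp n0.
have b1 := bounded_measurable_edot bu bu; have b2 := bounded_measurable_edot bp bp.
rewrite -[(2 * n)^-1 * _](integral_onZ fD _ b1).
rewrite -[n / 2 * _](integral_onZ fD _ b2) -integral_onD//; last 2 first.
- exact: bounded_measurableZ.
- exact: bounded_measurableZ.
apply: integral_on_le => //.
- exact: bounded_measurable_edot.
- by apply: bounded_measurableD; exact: bounded_measurableZ.
by apply: ae_onT => t _; exact: edot_young.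
Qed.

Lemma pairing_dist (D : set R) (B C d : R) (E : set R) u v p : finite_measurable D ->
  bounded_by D B u -> bounded_by D B v -> bounded_by D C p ->
  0 <= d -> measurable E -> (mu E <= d%:E)%E ->
  (forall t, D t -> ~ E t -> `|u t - v t| <= d) ->
  `|pairing D u p - pairing D v p| <= d * (m%:R * C * len D + 2 * m%:R * B * C).
Proof.
move=> fD bu bv bp d0 mE Ed uv.
have [N [mN N0 NP]] := bounded_by_ae bp.
have C0 := bounded_by_ge0 bp.
apply: le_trans (@integral_on_dist R R D fD _ _ (m%:R * (d * C)) d (E `|` N) _ _
  (bounded_by_edot bu bp) (bounded_by_edot bv bp) _ _ _ _) _.
- by rewrite !mulr_ge0.
- exact: measurableU.
- by rewrite -(addr0 d); apply: measureU2_le => //; rewrite N0.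
- move=> t Dt /not_orP[nE nN]; rewrite -edotBl (le_trans (edot_norm _ _))//.
  by rewrite ler_wpM2l// ler_pM// ?uv ?NP.
rewrite le_eqVlt; apply/orP; left; apply/eqP; ring.
Qed.

End Pairing.

(** * From small integrals to small values *)

Section Chebyshev.
Variable R : realType.
Local Notation mu := (@lebesgue_measure R).
Local Notation len D := (fine (mu D)).

(** Chebyshev's inequality at level [d ^+ 2]. The level set is that of a simple approximant, since
    those of [k] need not be measurable. *)
Lemma chebyshev_small (D : set R) (k : R -> R) (d : R) : finite_measurable D ->
  bounded_measurable D k -> (forall t, D t -> 0 <= k t) -> 0 < d -> d <= 1 ->
  integral_on D k <= d ^+ 3 / 8 ->
  exists E, [/\ measurable E, (mu E <= d%:E)%E &
    forall t, D t -> ~ E t -> k t <= d ^+ 2].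
Proof.
move=> fD [B bk] k0 d0 d1 kd; have B0 := bounded_by_ge0 bk.
pose C := len D + B + B.
have C0 : 0 <= C by rewrite !addr_ge0// len_ge0.
have C1 : 0 < 8 * (C + 1) by rewrite mulr_gt0// ltr_wpDl.
(* The approximant has integral at most [d ^+ 3 / 8 + n * C <= d ^+ 3 / 4] and is cut at the level
   [d ^+ 2 - n >= d ^+ 2 / 2]: the level set has measure at most [d / 2], and the exceptional set
   takes the other half. *)
pose n := Num.min (d ^+ 2 / 2) (d ^+ 3 / (8 * (C + 1))).
have n0 : 0 < n by rewrite lt_min !divr_gt0// exprn_gt0.
have nd2 : n <= d ^+ 2 / 2 by rewrite /n ge_min lexx.
have nC : n * C <= d ^+ 3 / 8.
  have : n <= d ^+ 3 / (8 * (C + 1)) by rewrite /n ge_min lexx orbT.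
  by rewrite ler_pdivlMr//; nra.
have nd : n <= d / 2 by nra.
have [s [ss sB [F [mF Fn ks]]]] := bk n n0.
pose s' := Num.max 0 \o s.
have ss' : simple_function s' by exact: simple_function_comp.
have s'B t : `|s' t| <= B.
  by rewrite /s' /=; case: (leP 0 (s t)) => ?; rewrite ?normr0 ?sB.
have ks' t : D t -> ~ F t -> `|k t - s' t| <= n.
  move=> Dt nF; have kt0 := k0 t Dt; have := ks t Dt nF; rewrite /s' /=.
  case: (leP 0 (s t)) => // st0; rewrite subr0 (ger0_norm kt0).
  by apply: le_trans; rewrite (le_trans _ (ler_norm _))// lerDl oppr_ge0 ltW.
have a : simple_approx D B n k s' by split => //; exists F.
have Is' : simple_integral_on D s' <= d ^+ 3 / 4.
  have := integral_on_approx fD bk a; rewrite ler_norml => /andP[_].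
  rewrite -/C; lra.
pose thr := d ^+ 2 - n.
have thr0 : d ^+ 2 / 2 <= thr by rewrite /thr; lra.
have d2 : 0 < d ^+ 2 by rewrite exprn_gt0.
pose q t := `[< thr < s t >].
have sq : simple_function q.
  by apply: (@simple_function_comp _ _ _ (fun x => `[< thr < x >]) s).
pose psi := (fun b : bool => if b then thr else 0) \o q.
have spsi : simple_function psi by exact: simple_function_comp.
have Ipsi : simple_integral_on D psi = len (D `&` [set t | thr < s t]) * thr.
  rewrite (simple_integral_onE _ fD sq (r := [:: true; false]))//; last first.
    by move=> b _ /=; rewrite !inE; case: b.
  rewrite big_cons big_seq1 scaler0 addr0; congr (fine (mu (_ `&` _)) * _).
  by apply/seteqP; split => t /=; rewrite /q; [move/asboolP|move=> ?; apply/asboolP].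
have psiB t : `|psi t| <= thr.
  by rewrite /psi /=; case: ifP => _; rewrite ?normr0 ?ger0_norm//; lra.
have le : simple_integral_on D psi <= simple_integral_on D s'.
  rewrite -(integral_on_simple fD spsi psiB) -(integral_on_simple fD ss' s'B).
  apply: integral_on_le => //.
  - by exists thr; exact: bounded_by_simple.
  - by exists B; exact: bounded_by_simple.
  apply: ae_onT => t _; rewrite /psi /s' /= /q.
  by case: ifPn => [/asboolP st|_]; rewrite le_max ?lexx// (ltW st) orbT.
have mG : measurable [set t | thr < s t].
  exact: (simple_function_preimage [set x | thr < x] ss).
have mDG : measurable (D `&` [set t | thr < s t]).
  exact: (proj1 (finite_measurableI fD mG)).
exists (F `|` (D `&` [set t | thr < s t])); split.
- exact: measurableU.
- rewrite (_ : d = d / 2 + d / 2); last by field.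
  apply: measureU2_le => //; first by rewrite (le_trans Fn)// lee_fin.
  rewrite -[leLHS]fineK; last exact: (finite_measurable_fin (finite_measurableI fD mG)).
  rewrite lee_fin; have := le_trans le Is'; rewrite Ipsi => H.
  have {}H : len (D `&` [set t | thr < s t]) * (d ^+ 2 / 2) <= d ^+ 3 / 4.
    by rewrite (le_trans _ H)// ler_wpM2l// len_ge0.
  have : 0 < d ^+ 2 / 2 by rewrite divr_gt0.
  move=> d22; rewrite -(ler_pM2r d22) (le_trans H)//.
  by rewrite le_eqVlt; apply/orP; left; apply/eqP; field.
move=> t Dt /not_orP[nF nG].
have st : s t <= thr by rewrite leNgt; apply/negP => ?; apply: nG.
have := ks t Dt nF; have := ler_norm (k t - s t); rewrite /thr in st; lra.
Qed.

End Chebyshev.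

(** * Weak limits of controls along an ultrafilter *)

Section WeakCompactness.
Variables (R : realType) (m : nat) (T : R) (U : set 'rV[R]_m).
Hypothesis hUcompact : compact U.
Hypothesis hUconvex : convex_set (U : set (convex_lmodType 'rV[R]_m)).
Local Notation mu := (@lebesgue_measure R).
Local Notation len D := (fine (mu D)).
Local Notation I := (`[0, T]%classic : set R).
Local Notation W := (R -> 'rV[R]_m).
Local Notation Q u := (pairing I u u).
Implicit Types u v p : W.

Let fI : finite_measurable I. Proof. exact: finite_measurable_itv. Qed.

Lemma compact_norm_bound : exists2 B : R, 0 <= B & forall x, U x -> `|x| <= B.
Proof.
have [M [_ HM]] := compact_bounded hUcompact.
exists (`|M| + 1); first by rewrite addr_ge0.
by move=> x Ux; apply: (HM (`|M| + 1)) => //; rewrite (le_lt_trans (ler_norm _))// ltrDl.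
Qed.

Lemma convex_mid x y : U x -> U y -> U (2^-1 *: x + 2^-1 *: y).
Proof.
move=> Ux Uy; have H : 0 <= (2^-1 : R) <= 1 by lra.
have := hUconvex (Itv01 (proj1 (andP H)) (proj2 (andP H))) (mem_set Ux) (mem_set Uy).
rewrite inE /conv /= (_ : unstable.onem 2^-1 = 2^-1)// /unstable.onem.
by field.
Qed.

Lemma admissible_bounded (B : R) u : 0 <= B -> (forall x, U x -> `|x| <= B) ->
  admissible T U u -> bounded_by I (B + 1) u.
Proof.
move=> B0 UB [su /ae_on_itv uU]; apply: strongly_measurable_bounded_by => //.
by apply: ae_onW uU => // t _; exact: UB.
Qed.

Lemma admissible_bounded_measurable u : admissible T U u -> bounded_measurable I u.
Proof.
have [B B0 UB] := compact_norm_bound.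
by move=> au; exists (B + 1); exact: admissible_bounded.
Qed.

Lemma admissible_mid u v : admissible T U u -> admissible T U v ->
  admissible T U (midpoint u v).
Proof.
move=> au av; split.
  have [B bB] : bounded_measurable I (midpoint u v).
    by apply: bounded_measurable_lin; exact: admissible_bounded_measurable.
  exact: bounded_by_strongly_measurable bB.
have [_ /ae_on_itv uU] := au; have [_ /ae_on_itv vU] := av.
apply: ae_on_ae; apply: ae_onW (ae_on2 uU vU) => // t _ [Ut Vt].
exact: convex_mid.
Qed.

(* Iterated midpoints play the role of convex combinations: the parallelogram
   identity uses nothing else. *)
Inductive midpoint_hull (A : set W) : W -> Prop :=
| midpoint_hull_in u : A u -> midpoint_hull A u
| midpoint_hull_mid u v : midpoint_hull A u -> midpoint_hull A v ->
    midpoint_hull A (midpoint u v).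

Lemma midpoint_hullS (A B : set W) : A `<=` B -> midpoint_hull A `<=` midpoint_hull B.
Proof.
move=> AB u; elim=> [v Av|v w _ hv _ hw]; first by apply: midpoint_hull_in; exact: AB.
exact: midpoint_hull_mid.
Qed.

Lemma midpoint_hull_admissible (A : set W) : A `<=` admissible T U ->
  midpoint_hull A `<=` admissible T U.
Proof.
move=> AU u; elim=> [v /AU//|v w _ hv _ hw]; exact: admissible_mid.
Qed.

Lemma midpoint_hull_pairing (A : set W) p (c : R) : A `<=` admissible T U ->
  bounded_measurable I p -> (forall u, A u -> c <= pairing I u p) ->
  forall u, midpoint_hull A u -> c <= pairing I u p.
Proof.
move=> AU bp Ac u; elim=> [v /Ac//|v w hv iv hw iw].
have bv := admissible_bounded_measurable (midpoint_hull_admissible AU hv).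
have bw := admissible_bounded_measurable (midpoint_hull_admissible AU hw).
rewrite /midpoint pairing_lincomb//; lra.
Qed.

(** The midpoint stays in the hull, so the parallelogram identity gives [2 * (c + e) + 2 * (c + e) -
    4 * (c - e) = 8 * e]. *)
Lemma hull_distance (A : set W) (c e : R) u v : A `<=` admissible T U ->
  (forall w, midpoint_hull A w -> c - e <= Q w) ->
  midpoint_hull A u -> midpoint_hull A v -> Q u <= c + e -> Q v <= c + e ->
  pairing I (fun t => 1 *: u t + (-1) *: v t) (fun t => 1 *: u t + (-1) *: v t) <= 8 * e.
Proof.
move=> AU Ac hu hv Qu Qv.
have bu := admissible_bounded_measurable (midpoint_hull_admissible AU hu).
have bv := admissible_bounded_measurable (midpoint_hull_admissible AU hv).
have Qm := Ac _ (midpoint_hull_mid hu hv).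
rewrite (parallelogram fI bu bv); lra.
Qed.

Lemma ae_on_forall (D : set R) (P : nat -> R -> Prop) :
  (forall n, ae_on D (P n)) -> ae_on D (fun t => forall n, P n t).
Proof.
move=> /choice[N NP].
have [] : (mu).-negligible (\bigcup_n N n).
  apply: negligible_bigcup => n; have [mN N0 _] := NP n.
  by exists (N n); split; [exact: mN|exact: N0|].
move=> M [mM M0 NM]; exists M; split => // t Dt nM n.
have [_ _] := NP n; apply => // Nt; apply: nM; apply: NM.
by exists n.
Qed.

Variable F : set_system W.
Hypothesis UF : UltraFilter F.
Hypothesis Fadm : F (admissible T U).

Lemma energy_bound : exists C : R, forall u, admissible T U u -> Q u <= C.
Proof.
have [B B0 UB] := compact_norm_bound.
exists (m%:R * ((B + 1) * (B + 1)) * len I) => u au.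
have bu := admissible_bounded B0 UB au.
have be := bounded_by_edot bu bu.
apply: le_trans (ler_norm _) _; apply: integral_on_norm_bound => //.
  by exists (m%:R * ((B + 1) * (B + 1))).
exact: bounded_by_ae.
Qed.

(* [c] is the supremum over [A] in the ultrafilter of the infimum of the energy
   over the hull of [A]; almost minimal elements of the hulls form a Cauchy net. *)
Lemma hull_energy : exists c : R,
  (forall e, 0 < e -> exists A, [/\ F A, A `<=` admissible T U &
     forall v, midpoint_hull A v -> c - e <= Q v]) /\
  (forall A e, F A -> A `<=` admissible T U -> 0 < e ->
     exists2 v, midpoint_hull A v & Q v <= c + e).
Proof.
pose L := [set r : R | exists A, [/\ F A, A `<=` admissible T U &
     forall v, midpoint_hull A v -> r <= Q v]].
have [C HC] := energy_bound.
have L0 : L 0.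
  exists (admissible T U); split => // v hv.
  apply: pairing_ge0 => //; apply: admissible_bounded_measurable.
  exact: midpoint_hull_admissible hv.
have ubL : ubound L C.
  move=> r [A [FA AU Ar]]; have [u Au] := filter_ex FA.
  by rewrite (le_trans (Ar u (midpoint_hull_in Au)))// HC//; exact: AU.
have hsL : has_sup L by split; [exists 0|exists C].
exists (sup L); split.
  move=> e e0; have [r [A [FA AU Ar]] Lr] := sup_adherent e0 hsL.
  by exists A; split => // v /Ar; apply: le_trans; exact: ltW.
move=> A e FA AU e0; apply: contrapT => H.
have : L (sup L + e).
  exists A; split => // v hv; rewrite leNgt; apply/negP => lt.
  by apply: H; exists v => //; exact: ltW.
move/(ub_le_sup (ex_intro _ C ubL)); lra.
Qed.

(** The factor 8 of [hull_distance] turns this into [dyadic R n ^+ 3 / 8], the threshold of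
    [chebyshev_small] for [d = dyadic R n]. *)
Definition dyadic_cube (n : nat) : R := dyadic R n ^+ 3 / 64.

Lemma dyadic_cube_gt0 n : 0 < dyadic_cube n.
Proof. by rewrite divr_gt0// exprn_gt0// dyadic_gt0. Qed.

Lemma dyadic_cubeS n : dyadic_cube n.+1 <= dyadic_cube n.
Proof.
rewrite /dyadic_cube ler_pM2r// lerXn2r ?nnegrE ?(ltW (dyadic_gt0 _ _))//.
by rewrite dyadicS ler_pdivrMr// ler_peMr ?ler1n// ltW// dyadic_gt0.
Qed.

(** Each [v n] is taken in the hull of [A n] intersected with [A n.+1], so that [v n] and [v n.+1]
    both lie in the hull of [A n.+1] and can be compared there. *)
Lemma minimizing_sequence : exists (c : R) (A : nat -> set W) (v : nat -> W),
  (forall A e, F A -> A `<=` admissible T U -> 0 < e ->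
     exists2 v, midpoint_hull A v & Q v <= c + e) /\ forall n,
  [/\ F (A n), A n `<=` admissible T U,
      forall w, midpoint_hull (A n) w -> c - dyadic_cube n <= Q w,
      Q (v n) <= c + dyadic_cube n &
      midpoint_hull (A n) (v n) /\ midpoint_hull (A n.+1) (v n)].
Proof.
have [c [Hlow Hup]] := hull_energy; exists c.
have /choice[A AP] n := Hlow _ (dyadic_cube_gt0 n); exists A.
have /choice[v vP] n : exists v, midpoint_hull (A n `&` A n.+1) v /\ Q v <= c + dyadic_cube n.
  have [FA AU _] := AP n; have [FA' _ _] := AP n.+1.
  have [|v hv Qv] := Hup (A n `&` A n.+1) _ (filterI FA FA') _ (dyadic_cube_gt0 n).
    by move=> w [/AU].
  by exists v.
exists v; split => // n; have [FA AU Ac] := AP n; have [hv Qv] := vP n.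
split => //; split; apply: midpoint_hullS hv; by move=> w [].
Qed.

(** By Chebyshev consecutive terms are [dyadic R n]-close off a set of measure [dyadic R n]. Summing
    the tails gives the factor 2, and Borel-Cantelli gives convergence almost everywhere. *)
Lemma strong_limit (v : nat -> W) : (forall n, admissible T U (v n)) ->
  (forall n, pairing I (fun t => 1 *: v n.+1 t + (-1) *: v n t)
                       (fun t => 1 *: v n.+1 t + (-1) *: v n t) <= dyadic R n ^+ 3 / 8) ->
  exists2 u, admissible T U u & forall n, exists E, [/\ measurable E,
    (mu E <= (dyadic R n * 2)%:E)%E &
    forall t, I t -> ~ E t -> `|v n t - u t| <= dyadic R n * 2].
Proof.
move=> av vd; have bv n := admissible_bounded_measurable (av n).
have /choice[E EP] n : exists E, [/\ measurable E, (mu E <= (dyadic R n)%:E)%E &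
    forall t, I t -> ~ E t -> `|v n.+1 t - v n t| <= dyadic R n].
  have bw : bounded_measurable I (fun t => 1 *: v n.+1 t + (-1) *: v n t).
    exact: bounded_measurable_lin.
  have [|E [mE Ed HE]] := chebyshev_small fI (bounded_measurable_edot bw bw) _
    (dyadic_gt0 R n) (dyadic_le1 R n) (vd n).
    by move=> t _; exact: edot_ge0.
  exists E; split => // t It nE; apply: norm_edot; first exact/ltW/dyadic_gt0.
  by have := HE t It nE; rewrite scale1r scaleN1r.
have mE n : measurable (E n) by have [] := EP n.
have Ed n : (mu (E n) <= (dyadic R n)%:E)%E by have [] := EP n.
(* The limit is taken coordinate by coordinate; its value where the sequence diverges is irrelevant,
   as this happens in [[0, T]] on a null set only. *)
pose u (t : R) : 'rV[R]_m := \row_i limn (fun n => v n t 0 i).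
have uP t n : I t -> (forall k, (n <= k)%N -> ~ E k t) ->
    forall k, (n <= k)%N -> `|v k t - u t| <= dyadic R k * 2.
  move=> It nE k nk; apply: norm_coord_le; first by rewrite mulr_ge0// ltW// dyadic_gt0.
  move=> i; rewrite !mxE -{1}[2]mulr1.
  apply: (@dyadic_limit R R (fun k => v k t 0 i) 1 n _ k nk) => j nj.
  have [_ _ /(_ t It (nE j nj))] := EP j; rewrite mulr1; apply: le_trans.
  by have := norm_coord (v j.+1 t - v j t) i; rewrite !mxE.
have tail n : exists G, [/\ measurable G, (mu G <= (dyadic R n * 2)%:E)%E &
    forall t, I t -> ~ G t -> `|v n t - u t| <= dyadic R n * 2].
  pose G := \bigcup_k E (n + k)%N.
  have mG : measurable G by apply: bigcup_measurable => k _; exact: mE.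
  exists G; split => //.
    apply: (@le_trans _ _ (\sum_(k <oo) mu (E (n + k)%N))%E).
      by apply: measure_sigma_subadditive.
    apply: (@le_trans _ _ (\sum_(k <oo) (dyadic R n * 2 / (2 ^ k.+1)%:R)%:E)%E).
      apply: lee_nneseries => // k _; apply: le_trans (Ed _) _.
      rewrite lee_fin /dyadic -addnS expnD natrM invfM mulrA ler_wpM2r ?invr_ge0//.
      by rewrite expnS natrM invfM; lra.
    by apply: epsilon_trick0; rewrite mulr_ge0// ltW// dyadic_gt0.
  move=> t It nG; apply: (uP t n) => // k nk Ek; apply: nG; exists (k - n)%N => //.
  by rewrite subnKC.
have [B B0 UB] := compact_norm_bound.
have bu : bounded_by I (B + 1) u.
  apply: bounded_by_limit => e e0.
  have [n Hn] := dyadic_small_mul 2 e0.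
  have [G [mG Gd HG]] := tail n; exists (v n), G; split => //.
  - exact: admissible_bounded.
  - by rewrite (le_trans Gd)// lee_fin Hn.
  by move=> t It nG; rewrite distrC (le_trans (HG t It nG))// Hn.
exists u => //; split; first exact: bounded_by_strongly_measurable bu.
have [N [mN N0 HN]] := borel_cantelli_dyadic mE Ed.
have aU : ae_on I (fun t => forall n, U (v n t)).
  by apply: ae_on_forall => n; have [_ /ae_on_itv] := av n.
have aN : ae_on I (fun t => exists n, forall k, (n <= k)%N -> ~ E k t).
  by exists N; split => // t _; exact: HN.
apply: ae_on_ae; apply: ae_onW (ae_on2 aU aN) => // t It [vU [n nE]].
(* Closedness of [U] passes the constraint on to the almost everywhere limit. *)
have cU : closed U by apply: compact_closed => //; exact: norm_hausdorff.
apply: (@closed_cvg _ _ \oo _ (fun k => v k t) U cU).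
  exact: nearW.
apply/cvgrPdist_le => e e0; have [k Hk] := dyadic_small_mul 2 e0.
exists (maxn n k) => // j /=; rewrite geq_max => /andP[nj kj].
by rewrite distrC (le_trans (uP t n It nE j nj))// Hk.
Qed.

Lemma pairing_cvg (v : nat -> W) u p : (forall n, admissible T U (v n)) ->
  admissible T U u -> bounded_measurable I p ->
  (forall n, exists E, [/\ measurable E, (mu E <= (dyadic R n * 2)%:E)%E &
    forall t, I t -> ~ E t -> `|v n t - u t| <= dyadic R n * 2]) ->
  exists K : R, forall n, `|pairing I (v n) p - pairing I u p| <= dyadic R n * K.
Proof.
move=> av au [C bp] vu; have [B B0 UB] := compact_norm_bound.
exists (2 * (m%:R * C * len I + 2 * m%:R * (B + 1) * C)) => n.
have [E [mE Ed HE]] := vu n; rewrite mulrA.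
apply: (pairing_dist fI (admissible_bounded B0 UB (av n)) (admissible_bounded B0 UB au)
  bp _ mE Ed HE).
by rewrite mulr_ge0// ltW// dyadic_gt0.
Qed.

(** The energy of the limit is at most the level [c], whereas members of [A n] have energy at least
    [c - dyadic_cube n]: this is lower semicontinuity along [F]. Weak convergence holds against
    every [p], although the [v n] were chosen without reference to [p]. *)
Lemma weak_limit : exists2 u, admissible T U u &
  (forall e, 0 < e -> F [set w | Q u - e <= Q w]) /\
  (forall p e, bounded_measurable I p -> 0 < e ->
    F [set w | `|pairing I w p - pairing I u p| <= e]).
Proof.
have [c [A [v [Hup H]]]] := minimizing_sequence.
have av n : admissible T U (v n).
  by have [_ AU _ _ [hv _]] := H n; exact: midpoint_hull_admissible hv.
have vd n : pairing I (fun t => 1 *: v n.+1 t + (-1) *: v n t)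
    (fun t => 1 *: v n.+1 t + (-1) *: v n t) <= dyadic R n ^+ 3 / 8.
  have [_ AU Ac Qv [hv hv']] := H n; have [_ AU' Ac' Qv' [hw _]] := H n.+1.
  have d := dyadic_cubeS n.
  have := @hull_distance (A n.+1) c (dyadic_cube n) (v n.+1) (v n) AU' _ hw hv' _ Qv.
  rewrite [X in _ -> _ -> _ <= X](_ : _ = dyadic R n ^+ 3 / 8); last first.
    by rewrite /dyadic_cube; field.
  apply; last by rewrite (le_trans Qv')// lerD2l.
  by move=> w /Ac'; apply: le_trans; rewrite lerD2l lerN2.
have [u au vu] := strong_limit av vd; exists u => //.
(* Strong convergence is used in one factor at a time: [Q u] is compared with [pairing I (v n) u],
   and this with [Q (v n)]. *)
have Qu : Q u <= c.
  have [K HK] := pairing_cvg av au (admissible_bounded_measurable au) vu.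
  have [B B0 UB] := compact_norm_bound.
  have bv n := admissible_bounded B0 UB (av n).
  have bu := admissible_bounded B0 UB au.
  have K' n : Q (v n) - pairing I u (v n) >=
      - (dyadic R n * (2 * (m%:R * (B + 1) * len I + 2 * m%:R * (B + 1) * (B + 1)))).
    have [E [mE Ed HE]] := vu n.
    have d0 : 0 <= dyadic R n * 2 by rewrite mulr_ge0// ltW// dyadic_gt0.
    have := pairing_dist fI (bv n) bu (bv n) d0 mE Ed HE.
    by rewrite ler_norml -mulrA => /andP[].
  apply/ler_addgt0Pr => e e0.
  set K2 := 2 * _ in K'.
  have [n1 Hn1] := dyadic_small_mul (`|K| + `|K2| + 1) e0.
  have := Hn1 n1 (leqnn n1).
  have [_ _ _ Qv _] := H n1.
  have h1 : Q u <= pairing I (v n1) u + dyadic R n1 * K.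
    by have := HK n1; rewrite ler_norml => /andP[]; lra.
  have h2 : pairing I (v n1) u <= Q (v n1) + dyadic R n1 * K2.
    by have := K' n1; rewrite (pairingC _ u); lra.
  have d0 := dyadic_gt0 R n1; have d1 := dyadic_le1 R n1.
  have hK : dyadic R n1 * K <= dyadic R n1 * `|K| by rewrite ler_pM2l// ler_norm.
  have hK2 : dyadic R n1 * K2 <= dyadic R n1 * `|K2| by rewrite ler_pM2l// ler_norm.
  have hc : dyadic_cube n1 <= dyadic R n1.
    rewrite /dyadic_cube ler_pdivrMr// exprS ler_pM2l//.
    by apply: (@le_trans _ _ 1); [rewrite exprn_ile1// ltW|rewrite ler1n].
  rewrite !mulrDr mulr1; lra.
split.
  move=> e e0; have [n Hn] := dyadic_small e0.
  have [FA AU Ac Qv _] := H n; apply: filterS FA => w Aw /=.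
  have := Ac w (midpoint_hull_in Aw).
  suff : dyadic_cube n <= e by lra.
  rewrite (le_trans _ (Hn n (leqnn n)))// /dyadic_cube ler_pdivrMr// exprS.
  rewrite ler_pM2l ?dyadic_gt0//; apply: (@le_trans _ _ 1); last by rewrite ler1n.
  by rewrite exprn_ile1 ?dyadic_le1// ltW// dyadic_gt0.
(* Otherwise the half space [w | <u, p> + e <= <w, p>], which is stable under
   midpoints, would contain almost minimal elements, and these are L2-close to
   [v n], hence to [u]. *)
have one_sided p e : bounded_measurable I p -> 0 < e ->
    ~ F [set w | pairing I u p + e <= pairing I w p].
  move=> bp e0 FB.
  have [K HK] := pairing_cvg av au bp vu.
  have Qp0 : 0 <= Q p by exact: pairing_ge0.
  have e2 : 0 < e / 2 by rewrite divr_gt0.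
  have [n Hn] := dyadic_small_mul (`|K| + (1 + Q p)) e2.
  have [FA AU Ac Qv [hv _]] := H n.
  pose B := A n `&` [set w | pairing I u p + e <= pairing I w p].
  have BU : B `<=` admissible T U by move=> w [/AU].
  have [w hw Qw] := Hup B _ (filterI FA FB) BU (dyadic_cube_gt0 n).
  have pw : pairing I u p + e <= pairing I w p.
    by apply: (midpoint_hull_pairing BU bp _ hw) => w' [].
  have hw' : midpoint_hull (A n) w by apply: midpoint_hullS hw => w' [].
  have bw := admissible_bounded_measurable (midpoint_hull_admissible AU hw').
  have bvn := admissible_bounded_measurable (av n).
  have dist := hull_distance AU Ac hw' hv Qw Qv.
  have bl : bounded_measurable I (fun t => 1 *: w t + (-1) *: v n t).
    exact: bounded_measurable_lin.
  (* The weight is [d = dyadic R n]: the energy of [w - v n] is at most [d ^+ 3 / 8], so that both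
     terms are of order [d]. *)
  have := pairing_young fI bl bp (dyadic_gt0 R n).
  rewrite pairing_lincomb// mul1r mulN1r.
  have d0 := dyadic_gt0 R n; have d1 := dyadic_le1 R n.
  have := HK n; rewrite ler_norml => /andP[_ h1] h2.
  have h3 : (2 * dyadic R n)^-1 * pairing I (fun t => 1 *: w t + -1 *: v n t)
      (fun t => 1 *: w t + -1 *: v n t) <= dyadic R n.
    rewrite -ler_pdivlMl ?invr_gt0 ?mulr_gt0// invrK (le_trans dist)//.
    rewrite /dyadic_cube (_ : 8 * _ = dyadic R n * dyadic R n * (dyadic R n / 8));
      last by field.
    rewrite (_ : 2 * _ * _ = dyadic R n * dyadic R n * 2); last by ring.
    by rewrite ler_pM2l ?mulr_gt0//; lra.
  have h4 : dyadic R n / 2 * Q p <= dyadic R n * Q p.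
    by rewrite ler_wpM2r//; lra.
  have hK : dyadic R n * K <= dyadic R n * `|K| by rewrite ler_pM2l// ler_norm.
  have := Hn n (leqnn n); rewrite !mulrDr mulr1; lra.
move=> p e bp e0.
have bNp : bounded_measurable I (fun t => - p t).
  have := bounded_measurableZ (-1) bp.
  by rewrite (_ : (fun t => -1 *: p t) = fun t => - p t)//;
    apply/funext => t; rewrite scaleN1r.
have pN w : admissible T U w -> pairing I w (fun t => - p t) = - pairing I w p.
  move=> aw; rewrite pairingC (pairingC I w).
  have := @pairing_lincomb R m I (-1) 0 p p w fI bp bp (admissible_bounded_measurable aw).
  rewrite mulN1r mul0r addr0 => <-; congr pairing; apply/funext => t.
  by rewrite scaleN1r scale0r addr0.
have H1 := one_sided p e bp e0; have H2 := one_sided _ e bNp e0.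
(* Here the ultrafilter is essential: if the strip around [pairing I u p] were not in [F], its
   complement would be, and hence one of the two half spaces excluded by [H1] and [H2]. *)
have [//|] := in_ultra_setVsetC [set w | `|pairing I w p - pairing I u p| <= e] UF.
move=> FC.
have [//|FC1] := in_ultra_setVsetC [set w | pairing I u p + e <= pairing I w p] UF.
exfalso; apply: H2; apply: filterS (filterI (filterI FC FC1) Fadm) => w /= [[nw nw1] aw].
rewrite !pN//; move/negP : nw; rewrite -ltNge; move/negP : nw1; rewrite -ltNge.
by rewrite ltr_normr => ? /orP[|]; lra.
Qed.

End WeakCompactness.

(** * Convergence of the states *)

Section VectorIntegrals.
Variable R : realType.
Local Notation mu := (@lebesgue_measure R).
Local Notation len D := (fine (mu D)).

Lemma bounded_by_scale (V : normedModType R) (D : set R) (B C : R) (w : R -> R)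
    (k : R -> V) : bounded_by D B w -> bounded_by D C k ->
  bounded_by D (B * C) (fun t => w t *: k t).
Proof.
rewrite -[B * C]mul1r; apply: bounded_by_bilinear => // [x y|x x' y y'].
  by rewrite mul1r normrZ.
have -> : x *: y - x' *: y' = (x - x') *: y + x' *: (y - y').
  by rewrite scalerBl scalerBr subrKA.
by rewrite mul1r (le_trans (ler_normD _ _))// !normrZ.
Qed.

Lemma bounded_measurable_scale (V : normedModType R) (D : set R) (w : R -> R)
    (k : R -> V) : bounded_measurable D w -> bounded_measurable D k ->
  bounded_measurable D (fun t => w t *: k t).
Proof. by move=> [B bw] [C bk]; exists (B * C); exact: bounded_by_scale. Qed.

Lemma integral_on_scaler (X : completeNormedModType R) (D : set R) (w : R -> R) (v : X) :
  finite_measurable D -> bounded_measurable D w ->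
  integral_on D (fun t => w t *: v) = integral_on D w *: v.
Proof.
move=> fD [B bw]; have bwv := bounded_by_scale bw (bounded_by_cst D v).
apply: (@norm_eps0 _ _ _ _ ((`|v| + 1) * (len D + B * `|v| + B * `|v|) +
  (len D + B + B) * `|v|)) => e e0 _.
have [s a] := bw e e0; have [ss sB [E [mE Ee hs]]] := a.
have av : simple_approx D (B * `|v|) ((`|v| + 1) * e) (fun t => w t *: v) (fun t => s t *: v).
  split.
  - exact: (@simple_function_comp _ _ _ (fun x : R => x *: v)).
  - by move=> t; rewrite normrZ ler_wpM2r.
  exists E; split => //.
    by rewrite (le_trans Ee)// lee_fin mulrDl mul1r lerDr mulr_ge0// ltW.
  move=> t Dt nE; rewrite -scalerBl normrZ mulrDl mul1r ler_wpDr ?(ltW e0)//.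
  by rewrite mulrC ler_wpM2l// hs.
have H1 := integral_on_approx fD bwv av; have H2 := integral_on_approx fD bw a.
have E1 : simple_integral_on D (fun t => s t *: v) = simple_integral_on D s *: v.
  have [r ur sr] := simple_function_range ss.
  rewrite -[X in simple_integral_on D X]/((fun x : R => x *: v) \o s).
  rewrite -[s in RHS]/(id \o s) !(simple_integral_onE _ fD ss ur sr) scaler_suml.
  by apply: eq_bigr => x _; rewrite scalerA.
rewrite -(subrKA (simple_integral_on D s *: v)) (le_trans (ler_normD _ _))//.
rewrite mulrDr lerD//.
  by rewrite distrC -E1 (le_trans H1)// mulrA [e * _]mulrC.
by rewrite -scalerBl normrZ mulrA ler_wpM2r.
Qed.

Lemma bounded_measurable_sum (V : normedModType R) (D : set R) (n : nat)
    (h : 'I_n -> R -> V) : (forall j, bounded_measurable D (h j)) ->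
  bounded_measurable D (fun t => \sum_(j < n) h j t).
Proof.
elim: n h => [|n ih] h bh.
  by under eq_fun do rewrite big_ord0; exact: bounded_measurable_cst.
under eq_fun do rewrite big_ord_recl.
by apply: bounded_measurableD => //; exact: ih.
Qed.

Lemma integral_on_sum (X : completeNormedModType R) (D : set R) (n : nat)
    (h : 'I_n -> R -> X) : finite_measurable D ->
  (forall j, bounded_measurable D (h j)) ->
  integral_on D (fun t => \sum_(j < n) h j t) = \sum_(j < n) integral_on D (h j).
Proof.
move=> fD; elim: n h => [|n ih] h bh.
  by rewrite big_ord0; under eq_fun do rewrite big_ord0; rewrite integral_on_cst0.
under eq_fun do rewrite big_ord_recl.
rewrite integral_onD// ?big_ord_recl ?ih//; exact: bounded_measurable_sum.
Qed.

End VectorIntegrals.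

(** * From weak convergence to uniform smallness of convolutions *)

Section Kernel.
Variables (R : realType) (X : completeNormedModType R) (S : R -> {linear X -> X}).
Hypothesis hS : C0_semigroup S.
Variables (T K : R).
Hypothesis T0 : 0 < T.
Hypothesis K1 : 1 <= K.
Hypothesis KP : forall t x, 0 <= t <= T -> `|S t x| <= K * `|x|.
Local Notation mu := (@lebesgue_measure R).
Local Notation len D := (fine (mu D)).

Let K0 : 0 <= K. Proof. exact: le_trans K1. Qed.

Lemma orbit_measurable (t : R) (x : X) : 0 <= t ->
  bounded_measurable `[0, t] (fun s => S (t - s) x).
Proof. by move=> t0; apply: uniform_bounded_measurable => //; exact: orbit_uniform. Qed.

(* Since [S] is strongly continuous, the integral is approximated, uniformly in
   [t] and [w], by a sum of increments of the primitive of [w] on a fixed grid: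
   this turns weak convergence into uniform convergence. *)
Lemma kernel_small (h : X) (B e : R) : 0 <= B -> 0 < e ->
  exists (N : nat) (n : R), 0 < n /\ forall w : R -> R,
    bounded_measurable `[0, T] w -> ae_on `[0, T] (fun t => `|w t| <= B) ->
    (forall k, (k <= N)%N -> `|integral_on `[0, k%:R * (T / N%:R)] w| <= n) ->
    forall t, 0 <= t <= T ->
      `|integral_on `[0, t] (fun s => w s *: S (t - s) h)| <= e.
Proof.
move=> B0 e0.
(* One third each for the increments of the primitive ([n], chosen after [N]), for the variation of
   the kernel within the cells ([e1] and [d]), and for the incomplete last cell ([d']). *)
have e3 : 0 < e / 3 by rewrite divr_gt0.
pose e1 := e / 3 / (B * T + 1).
have BT1 : 0 < B * T + 1 by rewrite ltr_wpDl// mulr_ge0// ltW.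
have e10 : 0 < e1 by rewrite divr_gt0.
have K_gt0 : 0 < K by rewrite (lt_le_trans ltr01).
have [d d0 Hd] := semigroup_near0 hS h (divr_gt0 e10 K_gt0).
have BKh1 : 0 < B * (K * `|h|) + 1 by rewrite ltr_wpDl// !mulr_ge0.
pose d' := Num.min d (e / 3 / (B * (K * `|h|) + 1)).
have d'0 : 0 < d' by rewrite lt_min d0 divr_gt0.
pose N := (Num.truncn (T / d')).+1.
have N0 : 0 < (N%:R : R) by rewrite ltr0n.
pose del := T / N%:R.
have del0 : 0 < del by rewrite divr_gt0.
have deld' : del <= d'.
  rewrite /del ler_pdivrMr// mulrC -ler_pdivrMr// ltW//.
  by have /andP[] := truncn_itv (ltW (divr_gt0 T0 d'0)).
have deld : del <= d by rewrite (le_trans deld')// /d' ge_min lexx.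
have delB : del * (B * (K * `|h|)) <= e / 3.
  have : del <= e / 3 / (B * (K * `|h|) + 1).
    by rewrite (le_trans deld')// /d' ge_min lexx orbT.
  rewrite ler_pdivlMr// mulrDr mulr1; lra.
have NKh1 : 0 < N%:R * (2 * (K * `|h|)) + 1 by rewrite ltr_wpDl// !mulr_ge0// ltW.
pose n := e / 3 / (N%:R * (2 * (K * `|h|)) + 1).
have n0 : 0 < n by rewrite divr_gt0.
exists N, n; split => // w bw wB wn.
have NT : N%:R * del = T by rewrite /del mulrC divfK// gt_eqF.
have kT k : (k <= N)%N -> 0 <= k%:R * del <= T.
  move=> kN; rewrite mulr_ge0 ?(ltW del0)//= -NT ler_wpM2r ?(ltW del0)//.
  by rewrite ler_nat.
have bwt t : t <= T -> bounded_measurable `[0, t] w.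
  by move=> tT; apply: bounded_measurableW bw; exact: itv_sub.
have bker t : 0 <= t <= T -> bounded_measurable `[0, t] (fun s => w s *: S (t - s) h).
  move=> /andP[t0 tT]; apply: bounded_measurable_scale; first exact: bwt.
  exact: orbit_measurable.
have ocsub a b t : 0 <= a -> b <= t -> `]a, b]%classic `<=` `[0, t].
  move=> a0 bt s; rewrite /= !in_itv /= => /andP[/ltW as_ sb].
  by rewrite (le_trans a0)// (le_trans sb).
have Be1 : 0 <= B * e1 := mulr_ge0 B0 (ltW e10).
have Kh0 : 0 <= K * `|h| by rewrite mulr_ge0.
have step0 : 0 <= 2 * n * (K * `|h|) + B * e1 * del.
  have h1 := mulr_ge0 Be1 (ltW del0); have h2 := mulr_ge0 (ltW n0) Kh0; lra.
have claim k : (k <= N)%N -> forall t, k%:R * del <= t <= T ->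
    `|integral_on `[0, k%:R * del] (fun s => w s *: S (t - s) h)| <=
    k%:R * (2 * n * (K * `|h|) + B * e1 * del).
  elim: k => [_ t /andP[t0 tT]|k ih kN t /andP[kt tT]].
    rewrite !mul0r; rewrite mul0r in t0.
    have b0 : bounded_measurable `[0, 0] (fun s => w s *: S (t - s) h).
      by apply: bounded_measurableW (bker t _); [exact: itv_sub|rewrite t0].
    have [C bC] := b0.
    apply: le_trans (integral_on_norm_bound (finite_measurable_itv _ _) b0
      (bounded_by_ae bC)) _.
    by rewrite len_itv// subrr mulr0.
  have kN' := ltnW kN.
  have t0 : 0 <= t by have /andP[H _] := kT _ kN; exact: le_trans kt.
  have kk : k%:R * del <= k.+1%:R * del by rewrite ler_wpM2r ?(ltW del0)// ler_nat.
  have /andP[k0 _] := kT k kN'; have /andP[k10 k1T] := kT k.+1 kN.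
  have bk1 : bounded_measurable `[0, k.+1%:R * del] (fun s => w s *: S (t - s) h).
    by apply: bounded_measurableW (bker t _); [exact: itv_sub|rewrite t0].
  rewrite (@integral_on_split _ _ (k%:R * del) (k.+1%:R * del))//; last by rewrite k0 kk.
  rewrite (le_trans (ler_normD _ _))//.
  rewrite [leRHS](_ : _ = k%:R * (2 * n * (K * `|h|) + B * e1 * del) +
    (2 * n * (K * `|h|) + B * e1 * del)); last by rewrite -natr1; ring.
  rewrite lerD//.
    by apply: ih => //; rewrite (le_trans kk).
  set J := `]k%:R * del, k.+1%:R * del]%classic.
  have fJ : finite_measurable J := finite_measurable_itvoc _ _.
  have JT : J `<=` `[0, T] by exact: ocsub.
  have bwJ : bounded_measurable J w by exact: bounded_measurableW bw.
  have bJ : bounded_measurable J (fun s => w s *: S (t - s) h).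
    by apply: bounded_measurableW bk1; exact: ocsub.
  (* The kernel is frozen at the right end of the cell. The semigroup law factors
     [S (t - k.+1%:R * del)] out of the error, which leaves the behaviour of [S] near zero and is
     thus uniform in [t]. *)
  pose v := S (t - k.+1%:R * del) h.
  have bv : bounded_measurable J (fun s => w s *: v).
    by apply: bounded_measurable_scale => //; exact: bounded_measurable_cst.
  have tkT : 0 <= t - k.+1%:R * del <= T by lra.
  rewrite addrC -[integral_on J _](subrK (integral_on J (fun s => w s *: v))).
  rewrite (le_trans (ler_normD _ _))// lerD//.
    rewrite -integral_onB//.
    apply: (@le_trans _ _ (B * e1 * len J)).
      apply: integral_on_norm_bound => //; first exact: bounded_measurableB.
      apply: ae_onW wB => // s; rewrite /J /= in_itv /= => /andP[ks sk] wsB.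
      rewrite -scalerBr normrZ ler_pM// /v.
      have [_ _ SD _] := hS.
      have -> : S (t - s) h = S (t - k.+1%:R * del) (S (k.+1%:R * del - s) h).
        rewrite -SD ?subr_ge0//; congr (S _ _); ring.
      rewrite -linearB (le_trans (KP _ tkT))// mulrC -ler_pdivlMr//.
      apply: Hd; rewrite subr_ge0 sk/= (le_trans _ deld)//.
      move: ks; rewrite -natr1 mulrDl mul1r; lra.
    rewrite ler_wpM2l// /J len_itvoc//.
    by rewrite -natr1 mulrDl mul1r addrC addKr.
  rewrite integral_on_scaler// normrZ ler_pM//.
    have H := @integral_on_split _ _ (k%:R * del) (k.+1%:R * del) w.
    have -> : integral_on J w = integral_on `[0, k.+1%:R * del] w -
        integral_on `[0, k%:R * del] w.
      by rewrite H ?k0 ?kk//; [rewrite addrC addKr|exact: bwt].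
    rewrite (le_trans (ler_normB _ _))// (_ : 2 * n = n + n); last by ring.
    by rewrite lerD// wn.
  exact: KP.
move=> t /andP[t0 tT].
pose k := Num.truncn (t / del).
have /andP[H1 H2] := truncn_itv (divr_ge0 t0 (ltW del0)).
rewrite ler_pdivlMr// in H1; rewrite ltr_pdivrMr// in H2.
have kN : (k <= N)%N by rewrite -(ler_nat R) -(ler_pM2r del0) NT (le_trans H1).
have /andP[k0 _] := kT k kN.
rewrite (@integral_on_split _ _ (k%:R * del) t) ?k0 ?H1//; last by apply: bker; rewrite t0.
rewrite (le_trans (ler_normD _ _))//.
have L1 := claim k kN t (introT andP (conj H1 tT)).
have L2 : `|integral_on `]k%:R * del, t] (fun s => w s *: S (t - s) h)| <= e / 3.
  apply: le_trans delB; rewrite [leRHS]mulrC.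
  apply: (@le_trans _ _ (B * (K * `|h|) * len `]k%:R * del, t])).
    apply: integral_on_norm_bound.
    - exact: finite_measurable_itvoc.
    - by apply: bounded_measurableW (bker t _); [exact: ocsub|rewrite t0].
    apply: ae_onW wB; first exact: ocsub.
    move=> s; rewrite /= in_itv /= => /andP[ks st] wsB.
    rewrite normrZ ler_pM// KP//; lra.
  rewrite ler_wpM2l ?mulr_ge0// len_itvoc//.
  by move: H2; rewrite -natr1 mulrDl mul1r -/k; lra.
have L3 : k%:R * (2 * n * (K * `|h|) + B * e1 * del) <= e / 3 + e / 3.
  apply: (@le_trans _ _ (N%:R * (2 * n * (K * `|h|) + B * e1 * del))).
    by rewrite ler_wpM2r ?ler_nat.
  rewrite mulrDr lerD//.
    have : n * (N%:R * (2 * (K * `|h|)) + 1) = e / 3 by rewrite /n divfK// gt_eqF.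
    rewrite mulrDr mulr1; nra.
  rewrite (_ : N%:R * _ = B * e1 * (N%:R * del)); last by ring.
  rewrite NT.
  have : e1 * (B * T + 1) = e / 3 by rewrite /e1 divfK// gt_eqF.
  nra.
lra.
Qed.

End Kernel.

(** * The controlled equation and stability of its solutions *)

Section ControlSystem.
Variables (R : realType) (X : completeNormedModType R) (m : nat) (T : R) (x0 : X).
Variables (U : set 'rV[R]_m) (S : R -> {linear X -> X}).
Variables (f : R -> X -> X) (G : R -> X -> {linear 'rV[R]_m -> X}).
Hypothesis hT : 0 < T.
Hypothesis hUcompact : compact U.
Hypothesis hS : C0_semigroup S.
Local Notation I := (`[0, T]%classic : set R).
Local Notation W := (R -> 'rV[R]_m).

Let T0 : 0 <= T. Proof. exact: ltW. Qed.

Lemma lipschitz_field_intro (V : normedModType R) (M : R) (F : R -> X -> V) : 0 <= M ->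
  (forall y, strongly_measurable (@normdist R V) 0 T (F^~ y)) ->
  ae_on I (fun s => (forall x y, `|F s x - F s y| <= M * `|x - y|) /\ `|F s 0| <= M) ->
  lipschitz_field T M F.
Proof.
move=> M0 mF aF; split => // y; exists (M * (1 + `|y|) + 1).
apply: strongly_measurable_bounded_by => //; first by rewrite mulr_ge0// addr_ge0.
apply: ae_onW aF => // t _ [FL F0].
rewrite -[F t y](subrK (F t 0)) (le_trans (ler_normD _ _))// addrC mulrDr mulr1.
by rewrite lerD// (le_trans (FL _ _))// subr0.
Qed.

Lemma norm_enorm (x : 'rV[R]_m) : `|x| <= enorm x.
Proof. by apply: norm_edot; rewrite ?sqrtr_ge0// enorm_sqr. Qed.

Variables (h : 'I_m -> X) (g : 'I_m -> R -> X -> 'rV[R]_m) (Mf Mg : R).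
Hypothesis Mg0 : 0 <= Mg.
Hypothesis fM : lipschitz_field T Mf f.
Hypothesis gM : forall j, lipschitz_field T Mg (g j).
Hypothesis GE : forall t x u, t \in `[0, T] ->
  G t x u = \sum_(j < m) edot u (g j t x) *: h j.

Definition controlled (u : W) : R -> X -> X := fun s y => f s y + G s y (u s).

Variable B : R.
Hypothesis B0 : 0 <= B.
Hypothesis UB : forall x, U x -> `|x| <= B.

(** The constant does not depend on the control, so that the Gronwall factor is the same along the
    whole filter. The factor [m%:R] compares the scalar product with sup norms. *)
Definition control_lipschitz : R := Mf + \sum_(j < m) m%:R * (B * Mg) * `|h j|.

Lemma admissible_ae_bound u : admissible T U u -> ae_on I (fun s => `|u s| <= B).
Proof. by move=> [_ /ae_on_itv aU]; apply: ae_onW aU => // t _; exact: UB. Qed.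

Lemma ae_on_ord (D : set R) (n : nat) (P : 'I_n -> R -> Prop) :
  (forall j, ae_on D (P j)) -> ae_on D (fun t => forall j, P j t).
Proof.
move=> H; have [|N [mN N0 NP]] := @ae_on_forall R D
    (fun k t => forall j : 'I_n, nat_of_ord j = k -> P j t).
  move=> k; have [kn|kn] := ltnP k n.
    apply: ae_onW (H (Ordinal kn)) => // t _ Pt j jk.
    by rewrite (_ : j = Ordinal kn)//; exact: val_inj.
  by apply: ae_onT => t _ j jk; move: (ltn_ord j); rewrite jk ltnNge kn.
by exists N; split => // t Dt nN j; exact: (NP t Dt nN j j erefl).
Qed.

Lemma control_term_le (v : 'rV[R]_m) (z : 'I_m -> 'rV[R]_m) (c : R) :
  `|v| <= B -> 0 <= c -> (forall j, `|z j| <= Mg * c) ->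
  `|\sum_(j < m) edot v (z j) *: h j| <= (\sum_(j < m) m%:R * (B * Mg) * `|h j|) * c.
Proof.
move=> vB c0 zc; rewrite (le_trans (ler_norm_sum _ _ _))// mulr_suml ler_sum// => j _.
rewrite normrZ mulrAC ler_wpM2r// (le_trans (edot_norm _ _))// -!mulrA ler_wpM2l//.
by rewrite ler_pM.
Qed.

Lemma controlled_lipschitz (u : W) : admissible T U u ->
  lipschitz_field T control_lipschitz (controlled u).
Proof.
move=> au; have [Mf0 bf af] := fM.
have bu := admissible_bounded_measurable hUcompact au.
have ag : ae_on I (fun s => forall j,
    (forall x y, `|g j s x - g j s y| <= Mg * `|x - y|) /\ `|g j s 0| <= Mg).
  by apply: ae_on_ord => j; have [] := gM j.
have KG0 : 0 <= \sum_(j < m) m%:R * (B * Mg) * `|h j|.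
  by apply: sumr_ge0 => j _; rewrite !mulr_ge0.
split; first by rewrite addr_ge0.
  move=> y.
  have : bounded_measurable I (fun s => f s y + \sum_(j < m) edot (u s) (g j s y) *: h j).
    apply: bounded_measurableD; first exact: bf.
    apply: bounded_measurable_sum => j; apply: bounded_measurable_scale.
      by apply: bounded_measurable_edot => //; have [_ bg _] := gM j; exact: bg.
    exact: bounded_measurable_cst.
  move=> [C bC]; exists C; apply: bounded_by_ae_eq bC.
  by apply: ae_onT => t tI; rewrite /controlled GE.
apply: ae_onW (ae_on2 (admissible_ae_bound au) (ae_on2 af ag)) => // t tI [uB [[fL f0] gL]].
split=> [x y|].
  rewrite /controlled !GE// opprD addrACA (le_trans (ler_normD _ _))//.
  rewrite mulrDl lerD// -sumrB.
  rewrite (eq_bigr (fun j => edot (u t) (g j t x - g j t y) *: h j)); last first.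
    by move=> j _; rewrite -scalerBl ![edot (u t) _]edotC edotBl.
  by apply: control_term_le => // j; have [] := gL j.
rewrite /controlled GE// (le_trans (ler_normD _ _))// lerD//.
rewrite -[leRHS]mulr1; apply: control_term_le => // j; rewrite mulr1.
by have [] := gL j.
Qed.

Variable K : R.
Hypothesis K1 : 1 <= K.
Hypothesis KP : forall t x, 0 <= t <= T -> `|S t x| <= K * `|x|.
Local Notation traj u := (state T S f G x0 u).
Local Notation rate := (2 * K * control_lipschitz + 1).

(** The fixed point of the Picard map shows that the choice in [state] is made from a nonempty
    set. *)
Lemma stateP (u : W) : admissible T U u ->
  uniformly_continuous_on T (traj u) /\
  forall t, 0 <= t <= T -> traj u t = picard S x0 (controlled u) (traj u) t.
Proof.
move=> au; have LF := controlled_lipschitz au.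
have MP x := @mild_solutionP _ _ _ hS T x0 K T0 K1 KP m _ f G u x LF.
apply/MP.
have [x ux xE] := picard_fixpoint hS x0 T0 K1 KP LF.
have mx : mild_solution T S f G x0 u x by apply/MP.
by rewrite /state; apply: xgetPex; exists x.
Qed.

(** Read off the weighted contraction: a bound [c * expR (l * t)] on the difference improves to
    [(c / 2 + rho) * expR (l * t)]. Iterating from a crude bound gives the sequence [c n], which
    tends to the fixed point [2 * rho]. *)
Lemma gronwall (F : R -> X -> X) (M rho : R) (x y : R -> X) :
  let l := 2 * K * M + 1 in lipschitz_field T M F ->
  uniformly_continuous_on T x -> uniformly_continuous_on T y ->
  (forall t, 0 <= t <= T -> y t = picard S x0 F y t) ->
  (forall t, 0 <= t <= T -> `|picard S x0 F x t - x t| <= rho) ->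
  forall t, 0 <= t <= T -> `|y t - x t| <= 2 * rho * expR (l * t).
Proof.
move=> l LF ux uy yE xrho.
have [M0 _ _] := LF.
have rho0 : 0 <= rho by apply: le_trans (xrho 0 _); rewrite ?lexx.
have K0 : 0 <= K by exact: le_trans K1.
have l0 : 0 <= l by rewrite /l addr_ge0// !mulr_ge0.
have e1 t : 0 <= t <= T -> 1 <= expR (l * t).
  by move=> /andP[t0 _]; rewrite -expR0 ler_expR mulr_ge0.
have [Bx Bx0 xB] := uniform_bounded_on T0 ux.
have [By By0 yB] := uniform_bounded_on T0 uy.
have bx := uniform_bounded_measurable T0 ux.
have bY := uniform_bounded_measurable T0 uy.
pose c n := dyadic R n * (2 * (Bx + By)) + 2 * rho.
have c0 n : 0 <= c n by rewrite addr_ge0 ?mulr_ge0 ?addr_ge0// ltW// dyadic_gt0.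
have H n : forall t, 0 <= t <= T -> `|y t - x t| <= c n * expR (l * t).
  elim: n => [|n ih] t tT.
    have -> : c 0%N = Bx + By + 2 * rho by rewrite /c /dyadic expn1; field.
    apply: (@le_trans _ _ (Bx + By + 2 * rho)).
      rewrite (le_trans (ler_normB _ _))// -[leLHS]addr0.
      rewrite lerD ?mulr_ge0// addrC lerD ?xB ?yB//.
    by rewrite ler_peMr ?e1// addr_ge0 ?mulr_ge0// addr_ge0.
  have := picard_contraction hS x0 K1 KP LF bY bx (c0 n) ih tT.
  rewrite -yE// => H1.
  rewrite -(subrKA (picard S x0 F x t)) (le_trans (ler_normD _ _))//.
  apply: le_trans (lerD H1 (xrho t tT)) _.
  have -> : c n.+1 = c n / 2 + rho by rewrite /c dyadicS; field.
  by rewrite [leRHS]mulrDl lerD2l ler_peMr// e1.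
move=> t tT; apply/ler_addgt0Pr => e e0.
have [n Hn] := dyadic_small_mul (2 * (Bx + By) * expR (l * t)) e0.
apply: le_trans (H n t tT) _; rewrite /c [leLHS]mulrDl addrC lerD2l -[leLHS]mulrA; exact: Hn.
Qed.

(** A primitive at time [t] becomes a pairing over the whole of [[0, T]], to which weak convergence
    applies. *)
Definition cut (t : R) (p : W) : W := fun s => if s <= t then p s else 0.

Lemma itv_split (t : R) : 0 <= t <= T -> I = `[0, t]%classic `|` `]t, T]%classic.
Proof.
move=> /andP[t0 tT]; apply/seteqP; split => r /=; rewrite !in_itv /=.
  by move=> /andP[-> ->]; case: (leP r t); [left|right].
move=> [/andP[-> rt]|/andP[/ltW tr ->]]; first exact: le_trans tT.
by rewrite (le_trans t0).
Qed.

Lemma cut_measurable (t : R) (p : W) : bounded_measurable I p ->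
  bounded_measurable I (cut t p).
Proof.
move=> bp; have mt : measurable [set s : R | s <= t].
  by rewrite -set_itvNyc; exact: measurable_itv.
pose chi := (fun b : bool => if b then 1 else 0 : R) \o (fun s => `[< [set s | s <= t] s >]).
have schi : simple_function chi by apply: simple_function_comp; exact: simple_function_indic.
have bchi : bounded_measurable I chi.
  exists 1; apply: bounded_by_simple => // s.
  by rewrite /chi /=; case: ifP; rewrite ?normr1 ?normr0.
have := bounded_measurable_scale bchi bp; congr bounded_measurable.
apply/funext => s; rewrite /chi /cut /=.
case: ifPn => [/asboolP /= -> //|/asboolPn /= /negP/negbTE ->]; first by rewrite scale1r.
by rewrite scale0r.
Qed.

Lemma pairing_cut (t : R) (u p : W) : 0 <= t <= T -> bounded_measurable I u ->
  bounded_measurable I p -> pairing I u (cut t p) = pairing `[0, t] u p.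
Proof.
move=> tT bu bp; have /andP[t0 tT'] := tT.
have b := bounded_measurable_edot bu (cut_measurable t bp).
rewrite /pairing (@integral_on_split _ _ t T)//.
have bt : bounded_measurable `[0, t] (fun s => edot (u s) (cut t p s)).
  by apply: bounded_measurableW b; exact: itv_sub.
have bt' : bounded_measurable `]t, T] (fun s => edot (u s) (cut t p s)).
  by apply: bounded_measurableW b; rewrite (itv_split tT); exact: subsetUr.
rewrite (@integral_on_ae_eq _ _ `]t, T] (finite_measurable_itvoc _ _) _
  (fun=> 0) bt'); last first.
  apply: ae_onT => s; rewrite /= in_itv /= => /andP[ts _].
  rewrite /cut leNgt ts /= /edot big1// => i _; by rewrite mxE mulr0.
rewrite integral_on_cst0 ?addr0; last exact: finite_measurable_itvoc.
apply: integral_on_ae_eq => //; first exact: finite_measurable_itv.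
by apply: ae_onT => s; rewrite /= in_itv /= => /andP[_ st]; rewrite /cut st.
Qed.

Variable F : set_system W.
Hypothesis FF : Filter F.
Hypothesis Fadm : F (admissible T U).
Variable v : W.
Hypothesis av : admissible T U v.
Hypothesis Fv : forall p e, bounded_measurable I p -> 0 < e ->
  F [set u | `|pairing I u p - pairing I v p| <= e].

(** The curve [x] is the same in both terms, so [f] cancels and the difference is linear in the
    controls: a sum over [j] of convolutions of scalar functions with orbits of [h j]. Each requires
    only finitely many pairings to be small, so one member of [F] serves all times. *)
Lemma residual_small (x : R -> X) (rho : R) : uniformly_continuous_on T x -> 0 < rho ->
  F [set u | forall t, 0 <= t <= T ->
    `|picard S x0 (controlled u) x t - picard S x0 (controlled v) x t| <= rho].
Proof.
move=> ux rho0.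
have K0 : 0 <= K by exact: le_trans K1.
have bx := uniform_bounded_measurable T0 ux; have [Bx bBx] := bx.
pose p j : W := fun s => g j s (x s).
have bp j : bounded_by I (Mg * (1 + Bx) + 1) (p j) := field_bounded_by (gM j) bBx.
have bmp j : bounded_measurable I (p j) by exists (Mg * (1 + Bx) + 1).
have Bx0 := bounded_by_ge0 bBx.
pose C := m%:R * ((B + B) * (Mg * (1 + Bx) + 1)).
have C0 : 0 <= C by rewrite !mulr_ge0 ?addr_ge0 ?mulr_ge0 ?addr_ge0.
have bv := admissible_bounded_measurable hUcompact av.
(* Dividing by [m + 1] keeps the denominator positive when [m = 0]. *)
have r0 : 0 < rho / m.+1%:R by rewrite divr_gt0.
have /choice[N NP] j := kernel_small hS hT K1 KP (h j) C0 r0.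
have /choice[n {}NP] := NP.
have kT j k : (k <= N j)%N -> 0 <= k%:R * (T / (N j)%:R) <= T.
  (* If [N j] is zero, the grid is the single point zero, because division by zero gives zero. *)
  move=> kN; have [->|N0] := posnP (N j); first by rewrite invr0 !mulr0 lexx.
  rewrite mulr_ge0 ?divr_ge0//= mulrCA ler_piMr// ler_pdivrMr ?ltr0n// mul1r.
  by rewrite ler_nat.
have Fsmall : F [set u | forall j (k : 'I_(N j).+1),
    `|pairing I u (cut (k%:R * (T / (N j)%:R)) (p j)) -
      pairing I v (cut (k%:R * (T / (N j)%:R)) (p j))| <= n j].
  apply: filter_forall => j; apply: filter_forall => k.
  by apply: Fv; [exact: cut_measurable|have [] := NP j].
apply: filterS (filterI Fadm Fsmall) => u /= [au su] t tT.
have bu := admissible_bounded_measurable hUcompact au.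
have /andP[t0 tT'] := tT.
pose w j s : R := edot (u s) (p j s) - edot (v s) (p j s).
have bw j : bounded_measurable I (w j).
  by apply: bounded_measurableB; exact: bounded_measurable_edot.
have wC j : ae_on I (fun s => `|w j s| <= C).
  have ap := bounded_by_ae (bp j).
  apply: ae_onW (ae_on2 ap (ae_on2 (admissible_ae_bound au) (admissible_ae_bound av))) => //.
  move=> s _ [ps [us vs]]; rewrite /w -edotBl (le_trans (edot_norm _ _))// ler_wpM2l//.
  by rewrite ler_pM// (le_trans (ler_normB _ _))// lerD.
have wn j k : (k <= N j)%N -> `|integral_on `[0, k%:R * (T / (N j)%:R)] (w j)| <= n j.
  move=> kN; have kT' := kT j k kN.
  have := su j (Ordinal (kN : (k < (N j).+1)%N)).
  rewrite /= !pairing_cut// /pairing -integral_onB//; first exact: finite_measurable_itv.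
    apply: bounded_measurableW (bounded_measurable_edot bu (bmp j)).
    by apply: itv_sub; have /andP[] := kT'.
  apply: bounded_measurableW (bounded_measurable_edot bv (bmp j)).
  by apply: itv_sub; have /andP[] := kT'.
have ws j := (NP j).2 (w j) (bw j) (wC j) (wn j) t tT.
have ft := finite_measurable_itv 0 t.
have LFu := controlled_lipschitz au; have LFv := controlled_lipschitz av.
have b1 := integrand_measurable hS K1 KP LFu bx tT.
have b2 := integrand_measurable hS K1 KP LFv bx tT.
rewrite /picard opprD addrACA subrr add0r -integral_onB//.
have bwt j : bounded_measurable `[0, t] (fun s => w j s *: S (t - s) (h j)).
  apply: bounded_measurable_scale; last exact: orbit_measurable.
  by apply: bounded_measurableW (bw j); exact: itv_sub.
rewrite (@integral_on_ae_eq _ _ `[0, t] ft _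
  (fun s => \sum_(j < m) w j s *: S (t - s) (h j)) (bounded_measurableB b1 b2)); last first.
  apply: ae_onT => s; rewrite /= in_itv /= => /andP[s0 st].
  have sI : s \in `[0, T] by rewrite in_itv /= s0 (le_trans st).
  rewrite -linearB /controlled !GE// opprD addrACA subrr add0r -sumrB linear_sum.
  by apply: eq_bigr => j _; rewrite -scalerBl linearZ.
rewrite integral_on_sum// (le_trans (ler_norm_sum _ _ _))//.
apply: (@le_trans _ _ (\sum_(j < m) rho / m.+1%:R)); first exact: ler_sum.
rewrite sumr_const card_ord -[_ *+ m]mulr_natr mulrAC ler_pdivrMr//.
by rewrite ler_wpM2l ?(ltW rho0)// ler_nat.
Qed.

(** The state of [v] is inserted into the equation of [u], of which it is an approximate solution by
    [residual_small]; Gronwall then compares it with the state of [u]. *)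
Lemma state_cvg (e : R) : 0 < e -> F [set u | `|traj u T - traj v T| <= e].
Proof.
move=> e0; have [uv vE] := stateP av.
have r0 : 0 < e / (2 * expR (rate * T)) by rewrite divr_gt0// mulr_gt0// expR_gt0.
apply: filterS (filterI Fadm (residual_small uv r0)) => u /= [au Hu].
have [uu uE] := stateP au.
have TT : 0 <= T <= T by rewrite T0 lexx.
apply: le_trans (gronwall (controlled_lipschitz au) uv uu uE _ TT) _.
  by move=> t tT; rewrite vE//; exact: Hu.
rewrite le_eqVlt; apply/orP; left; apply/eqP; field.
by rewrite gt_eqF// expR_gt0.
Qed.

End ControlSystem.

(** * Lower semicontinuity of the cost and existence of a minimizer *)

Lemma cost_pairing (R : realType) (X : completeNormedModType R) (m : nat) (T alpha : R)
    (S : R -> {linear X -> X}) (f : R -> X -> X)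
    (G : R -> X -> {linear 'rV[R]_m -> X}) (l : X -> R) (x0 : X) (U : set 'rV[R]_m)
    (u : R -> 'rV[R]_m) : compact U -> admissible T U u ->
  cost T alpha S f G l x0 u = l (state T S f G x0 u T) + alpha / 2 * pairing `[0, T] u u.
Proof.
move=> cU au; congr (_ + _ * _); have bu := admissible_bounded_measurable cU au.
rewrite (_ : (fun t => enorm (u t) ^+ 2) = fun t => edot (u t) (u t)); last first.
  by apply/funext => t; rewrite enorm_sqr.
apply: integral_on_Rintegral; first exact: finite_measurable_itv.
  exact: bounded_measurable_edot.
by move=> t _; exact: edot_ge0.
Qed.

Theorem theorem1 (R : realType) (X : completeNormedModType R) (m : nat)
    (T alpha : R) (x0 : X) (U : set 'rV[R]_m)
    (DA : set X) (A : X -> X) (S : R -> {linear X -> X})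
    (f : R -> X -> X) (G : R -> X -> {linear 'rV[R]_m -> X}) (l : X -> R)
    (hT : 0 < T) (halpha : 0 <= alpha)
    (hU0 : U !=set0) (hUcompact : compact U)
    (hUconvex : convex_set (U : set (convex_lmodType 'rV[R]_m)))
    (hA : linear_operator DA A) (hS : C0_semigroup S) (hAS : generates DA A S)
    (assA : assumption_A T f G) (assB : assumption_B l)
    (assC : assumption_C T G) :
  exists2 ustar : R -> 'rV[R]_m, admissible T U ustar &
    (cost T alpha S f G l x0 ustar)%:E =
    ereal_inf [set (cost T alpha S f G l x0 u)%:E | u in admissible T U].
Proof.
have [mf _ [Mf [MG [Mf0 _ /ae_on_itv aA]]]] := assA.
have [h [g [GE mg [Mg Mg0 /ae_on_itv aC]]]] := assC.
have fM : lipschitz_field T Mf f.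
  by apply: lipschitz_field_intro => //; apply: ae_onW aA => // t _ [].
have gM j : lipschitz_field T Mg (g j).
  apply: lipschitz_field_intro => //; apply: ae_onW aC => // t _ /(_ j)[gL g0].
  by split => [x y|]; rewrite (le_trans (norm_enorm _)).
have [B B0 UB] := compact_norm_bound hUcompact.
have [K K1 KP] := semigroup_bound hS T.
have T0 := ltW hT.
pose J := cost T alpha S f G l x0.
have [a Ua] := hU0.
have adm_a : admissible T U (fun=> a).
  split; first exact: bounded_by_strongly_measurable (bounded_by_cst _ _).
  by apply: ae_on_ae; exact: ae_onT.
(* An ultrafilter containing all the sublevel sets of the cost replaces a
   minimizing sequence, so that no subsequences have to be extracted. *)
pose F0 := filter_from (admissible T U)
  (fun u' => [set u | admissible T U u /\ J u <= J u']).
have PF0 : ProperFilter F0.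
  apply: filter_from_proper; last by move=> u au; exists u.
  apply: filter_from_filter; first by exists (fun=> a).
  move=> u w au aw; have [uw|wu] := leP (J u) (J w).
    by exists u => // z [az zu]; split; split => //; exact: le_trans uw.
  by exists w => // z [az zw]; split; split => //; rewrite (le_trans zw)// ltW.
have [F [UF F0F]] := ultraFilterLemma PF0.
have FF : Filter F by exact: @filter_filter.
have FJ u : admissible T U u -> F [set w | admissible T U w /\ J w <= J u].
  by move=> au; apply: F0F; exists u.
have Fadm : F (admissible T U) by apply: filterS (FJ _ adm_a) => w [].
have [v av [Fe Fp]] := weak_limit hUcompact hUconvex UF Fadm.
have Fs e : 0 < e -> F [set u | `|state T S f G x0 u T - state T S f G x0 v T| <= e].
  exact: (state_cvg x0 hT hUcompact hS Mg0 fM gM GE B0 UB K1 KP FF Fadm av Fp).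
have opt u : admissible T U u -> J v <= J u.
  move=> au; rewrite leNgt; apply/negP => uv.
  (* Half of the gap: passing from [v] to [w], the terminal cost drops by less than [e] and the
     energy term by at most [e], hence [J w > J v - 2 * e = J u], a contradiction. *)
  pose e := (J v - J u) / 2.
  have e0 : 0 < e by rewrite divr_gt0// subr_gt0.
  have [|V /nbhs_ballP[r /= r0 rV] Vl] := assB (state T S f G x0 v T)
    (l (state T S f G x0 v T) - e).
    by rewrite lte_fin ltrBlDr ltrDl.
  have r20 : 0 < r / 2 by rewrite divr_gt0.
  (* This tolerance on the energy becomes at most [e] after multiplication by [alpha / 2]; the [+ 1]
     covers [alpha = 0]. *)
  have e10 : 0 < e / (alpha / 2 + 1) by rewrite divr_gt0// ltr_wpDl// divr_ge0.
  have [w [[[/= sw Qw] _] [aw Jw]]] :=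
    filter_ex (filterI (filterI (filterI (Fs _ r20) (Fe _ e10)) Fadm) (FJ u au)).
  have lw : l (state T S f G x0 v T) - e < l (state T S f G x0 w T).
    rewrite -lte_fin; apply/Vl/rV; rewrite -ball_normE /= distrC (le_lt_trans sw)//.
    by rewrite ltr_pdivrMr// ltr_pMr// ltr1n.
  have Qe : alpha / 2 * (e / (alpha / 2 + 1)) <= e.
    rewrite mulrCA ler_piMr ?(ltW e0)// ler_pdivrMr ?mul1r ?lerDl//.
    by rewrite ltr_wpDl// divr_ge0.
  have a20 : 0 <= alpha / 2 by rewrite divr_ge0.
  have := ler_wpM2l a20 Qw; rewrite mulrBr.
  move: Jw; rewrite /J (cost_pairing _ _ _ _ _ _ hUcompact aw) => Jw.
  have Jv : J v = l (state T S f G x0 v T) + alpha / 2 * pairing `[0, T] v v.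
    exact: cost_pairing hUcompact av.
  have Ee : 2 * e = J v - J u by rewrite /e mulrC divfK.
  rewrite -/(J u) in Jw; lra.
exists v => //; apply/eqP; rewrite eq_le; apply/andP; split.
  by apply: le_ereal_inf_tmp => _ [u au <-]; rewrite lee_fin; exact: opt.
by apply: ereal_inf_lbound; exists v.
Qed.
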